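(* Let $\mu$ be a finite positive Borel measure on $[0,1)$. Then the following conditions are equivalent. (i) $\mu$ is a $1$-logarithmic $1$-Carleson measure. (ii) $\mathcal H_\mu$ is a bounded operator from $H^1$ into itself. (iii) $\mathcal H_\mu$ is a bounded operator from $H^1$ into $\mathcal D^1_0$. (iv) $\mathcal H_\mu$ is a bounded operator from $\mathcal D^1_0$ into $\mathcal D^1_0$.
   Context: $\mathbb D$ is the open unit disc in $\mathbb C$, $H^1$ is the classical Hardy space on $\mathbb D$, and $dA=\frac1\pi\,dx\,dy$ is normalized area measure on $\mathbb D$. The space of Dirichlet type $\mathcal D^1_0$ consists of all analytic $f$ in $\mathbb D$ with $\|f\|_{\mathcal D^1_0}=|f(0)|+\int_{\mathbb D}|f'(z)|\,dA(z)<\infty$. For a finite positive Borel measure $\mu$ on $[0,1)$ and $n\ge 0$, let $\mu_n=\int_{[0,1)}t^n\,d\mu(t)$. For $f(z)=\sum_{k\ge0}a_kz^k$ analytic in $\mathbb D$, define formally $$\mathcal H_\mu f(z)=\sum_{n=0}^\infty\Big(\sum_{k=0}^\infty \mu_{n+k}a_k\Big)z^n,\quad z\in\mathbb D;$$ $\mathcal H_\mu f$ is well defined if the inner series converge and the resulting power series defines an analytic function in $\mathbb D$. Saying that $\mathcal H_\mu$ is a bounded operator from a space $X$ into a space $Y$ includes that $\mathcal H_\mu f$ is well defined for every $f\in X$. For $\alpha\ge0$ and $s>0$, a finite positive Borel measure $\mu$ on $[0,1)$ is an $\alpha$-logarithmic $s$-Carleson measure if there is a constant $C>0$ such that $\mu([t,1))\left(\log\frac{1}{1-t}\right)^{\alpha}\le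 C(1-t)^s$ for all $0\le t<1$. *)

(* Defs.v *)
From HB Require Import structures.
From mathcomp Require Import all_boot all_order all_algebra.
From mathcomp Require Import complex.
From mathcomp Require Import all_classical all_reals all_analysis.

Set Implicit Arguments.
Unset Strict Implicit.
Unset Printing Implicit Defensive.

Import Order.TTheory GRing.Theory Num.Theory.
Import numFieldNormedType.Exports.
Import Normc.

Local Open Scope classical_set_scope.
Local Open Scope complex_scope.
Local Open Scope ring_scope.

(* The library topologizes an abstract numFieldType; this gives the concrete
   field R[i] the same (usual) topology, so that convergence and derivability
   below are those over the complex field. *)
HB.instance Definition _ (R : rcfType) := NormedModule.copy R[i] R[i]^o.

Definition unit_disc (R : realType) : set R[i] := [set z | normc z < 1].

(* Functions on the disc are total functions of which only the values on the
   disc are ever used; [derivable] is complex differentiability here. *)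
Definition analytic_disc (R : realType) (f : R[i] -> R[i]) : Prop :=
  forall z, unit_disc z -> derivable f z 1.

(* The library's [pseries] is restricted to real coefficients. *)
Definition power_series (R : realType) (a : nat -> R[i]) (z : R[i]) : R[i]^nat :=
  series (fun k => a k * z ^+ k).

Definition power_sum (R : realType) (a : nat -> R[i]) (z : R[i]) : R[i] :=
  limn (power_series a z).

Definition expands (R : realType) (f : R[i] -> R[i]) (a : nat -> R[i]) : Prop :=
  forall z, unit_disc z -> power_series a z @ \oo --> f z.

Definition circle_mean (R : realType) (f : R[i] -> R[i]) (r : R) : \bar R :=
  (((2 * pi)^-1)%:E * \int[lebesgue_measure]_(t in `[0%R, (2 * pi)%R])
     (normc (f ((r * cos t) +i* (r * sin t))))%:E)%E.

(* The supremum is taken in \bar R: +oo exactly when the means are unbounded. *)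
Definition hardy1_norm (R : realType) (f : R[i] -> R[i]) : \bar R :=
  ereal_sup [set circle_mean f r | r in `]0, 1[].

Definition area_integral (R : realType) (g : R[i] -> \bar R) : \bar R :=
  ((pi^-1)%:E * \int[(@lebesgue_measure R \x @lebesgue_measure R)]_(p in
      [set p : R * R | unit_disc (p.1 +i* p.2)]) g (p.1 +i* p.2))%E.

Definition dirichlet1_norm (R : realType) (f : R[i] -> R[i]) : \bar R :=
  ((normc (f 0))%:E + area_integral (fun z => (normc (derive1 f z))%:E))%E.

Definition in_space (R : realType) (N : (R[i] -> R[i]) -> \bar R)
    (f : R[i] -> R[i]) : Prop :=
  analytic_disc f /\ (N f < +oo)%E.

(* A measure on [0, 1) is a Borel measure on the line carried by [0, 1). *)
Definition carried_by_01 (R : realType)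
    (mu : {finite_measure set (measurableTypeR R) -> \bar R}) : Prop :=
  mu (~` `[0%R, 1%R[) = 0%E.

Definition log_carleson (R : realType) (alpha s : R)
    (mu : {finite_measure set (measurableTypeR R) -> \bar R}) : Prop :=
  exists2 C : R, 0 < C & forall t : R, 0 <= t < 1 ->
    (mu `[t, 1%R[%classic * (ln ((1 - t)^-1) `^ alpha)%:E
       <= (C * (1 - t) `^ s)%:E)%E.

Definition moment (R : realType)
    (mu : {finite_measure set (measurableTypeR R) -> \bar R}) (n : nat) : R :=
  \int[mu]_(t in `[0%R, 1%R[) (t ^+ n).

Definition hankel_row (R : realType)
    (mu : {finite_measure set (measurableTypeR R) -> \bar R})
    (a : nat -> R[i]) (n : nat) : nat -> R[i] :=
  fun k => (moment mu (n + k))%:C * a k.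

Definition hankel_coef (R : realType)
    (mu : {finite_measure set (measurableTypeR R) -> \bar R})
    (a : nat -> R[i]) (n : nat) : R[i] :=
  limn (series (hankel_row mu a n)).

(* The image of the function with Taylor coefficients [a]; meaningful only under
   [hankel_defined], since [limn] is a total function. *)
Definition hankel (R : realType)
    (mu : {finite_measure set (measurableTypeR R) -> \bar R})
    (a : nat -> R[i]) : R[i] -> R[i] :=
  power_sum (hankel_coef mu a).

Definition hankel_defined (R : realType)
    (mu : {finite_measure set (measurableTypeR R) -> \bar R})
    (a : nat -> R[i]) : Prop :=
  [/\ forall n, cvgn (series (hankel_row mu a n)),
      forall z, unit_disc z ->
        cvgn (power_series (hankel_coef mu a) z) &
      analytic_disc (hankel mu a)].

(* By Taylor's theorem every [f] in the space has exactly one expansion [a], so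
   quantifying over the pairs (f, a) is quantifying over the [f]. *)
Definition hankel_bounded (R : realType)
    (mu : {finite_measure set (measurableTypeR R) -> \bar R})
    (NX NY : (R[i] -> R[i]) -> \bar R) : Prop :=
  exists C : R, forall (f : R[i] -> R[i]) (a : nat -> R[i]),
    in_space NX f -> expands f a ->
    [/\ hankel_defined mu a, in_space NY (hankel mu a) &
        (NY (hankel mu a) <= C%:E * NX f)%E].

(* Main.v *)
Require Import Defs.
From HB Require Import structures.
From mathcomp Require Import all_boot all_order all_algebra.
From mathcomp Require Import complex.
From mathcomp Require Import all_classical all_reals all_analysis.
From mathcomp Require Import measurable_realfun.
From mathcomp Require Import ring lra.

(* Every implication passes through the weighted sum S(a) = sum |a_k|/(k+1) of
   the Taylor coefficients and the weight w(t) = 1 - log(1 - t).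

   Hardy's inequality gives S(a) <= C |f| both in H^1 and in D^1_0.  In H^1 one
   approximates a polynomial on the circle by products g h of polynomials with
   |g|^2, |h|^2 close to |f|, and applies Hilbert's inequality and Parseval's
   identity to g and h.  For D^1_0 the H^1 inequality is integrated over circles,
   polar coordinates being replaced by the rotation invariance of area.

   Under the Carleson condition, int t^k w dmu <= C/(k+1), so with
   Phi(t) = sum |a_k| t^k one has int Phi w dmu <= C S(a).  Since |H f(z)| and
   |(H f)'(z)| are at most twice the integrals of Phi(t) |1 - tz|^-1 and
   Phi(t) |1 - tz|^-2 against mu, and the circle means of the first kernel and the
   area integral of the second are O(w(t)), Tonelli bounds both norms of H f by
   C S(a), hence by either norm of f.

   Conversely f_b = (1-b)/(1-bz)^2 is bounded in both spaces.  Hardy's inequality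
   for H f_b, together with mu_m >= b^m mu([b,1)) and the first ~ 1/(1-b)
   coefficients, yields mu([b,1)) log(1/(1-b)) <= C (1-b).  So boundedness between
   any two of the spaces is equivalent to the Carleson condition. *)

Set Implicit Arguments.
Unset Strict Implicit.
Unset Printing Implicit Defensive.

Import Order.TTheory GRing.Theory Num.Theory.
Import numFieldNormedType.Exports.
Import Normc.

Local Open Scope classical_set_scope.
Local Open Scope complex_scope.
Local Open Scope ring_scope.

Local Notation Re := complex.Re.
Local Notation Im := complex.Im.

(** The argument rests on a match of two weights 1/(k+1): Hardy's inequality produces this weight
    from a norm, and the Carleson condition produces it from the moments of w dmu. The sum S(a) then
    serves both domains at once, so no embedding of D^1_0 into H^1 and no duality enters;
    sufficiency sees the domain only through [hardy_ineq].

    Riesz factorization of H^1 functions into H^2 functions is replaced by an approximate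
    factorization of polynomials on the circle. That property is multiplicative, so only linear
    factors need a construction, and its uniform error moves each of a fixed number of coefficients
    by at most epsilon, hence disappears in the limit.

    The image H f is never identified with the integral of f(t)/(1 - tz): upper bounds of finite
    double sums suffice, and for these the exchange with mu is plain linearity. The factor 2 in
    front of the kernels pays for truncated geometric sums. *)

Section normc_facts.
Variable R : realType.
Implicit Types (z w : R[i]) (r : R).

Lemma normC_normc z : `|z| = (normc z)%:C.
Proof. by case: z. Qed.

Lemma normc_ge0 z : 0 <= normc z.
Proof. by case: z => a b; apply: sqrtr_ge0. Qed.

Lemma normc_real r : normc r%:C = `|r|.
Proof. by rewrite /normc /= expr0n /= addr0 sqrtr_sqr. Qed.

Lemma normcX z n : normc (z ^+ n) = normc z ^+ n.
Proof.
by elim: n => [|n IH]; rewrite ?expr0 ?normc1 // !exprS normcM IH.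
Qed.

Lemma ler_normc_sum I (s : seq I) (P : pred I) (F : I -> R[i]) :
  normc (\sum_(i <- s | P i) F i) <= \sum_(i <- s | P i) normc (F i).
Proof.
elim/big_ind2: _ => [|x1 x2 y1 y2 h1 h2|//]; first by rewrite normc0.
by apply: le_trans (le_normcD _ _) _; apply: lerD.
Qed.

Lemma normcB z w : normc (z - w) = normc (w - z).
Proof. by rewrite -normcN opprB. Qed.

Lemma ler_dist_normc z w : `|normc z - normc w| <= normc (z - w).
Proof.
rewrite ler_norml; apply/andP; split.
  rewrite lerNl opprB lerBlDr normcB; apply: le_trans (le_normcD _ _).
  by rewrite subrK.
by rewrite lerBlDr; apply: le_trans (le_normcD _ _); rewrite subrK.
Qed.

Lemma normc_1B_gt0 z : normc z < 1 -> 0 < normc (1 - z).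
Proof.
move=> z1; have := ler_dist_normc 1 z; rewrite normc1 => /(le_trans (ler_norm _)).
by apply: lt_le_trans; rewrite subr_gt0.
Qed.

Lemma normcZ_lt1 r z : 0 <= r -> r <= 1 -> normc z < 1 -> normc (r%:C * z) < 1.
Proof.
move=> r0 r1; rewrite normcM normc_real ger0_norm //; apply: le_lt_trans.
by rewrite ler_piMl ?normc_ge0.
Qed.

Lemma normc_conj z : normc z^* = normc z.
Proof. by case: z => a b; rewrite /= sqrrN. Qed.

Lemma normc_sqr z : normc z ^+ 2 = Re z ^+ 2 + Im z ^+ 2.
Proof. by case: z => a b /=; rewrite sqr_sqrtr // addr_ge0 // sqr_ge0. Qed.

Lemma ler_Re_normc z : `|Re z| <= normc z.
Proof.
by case: z => a b /=; rewrite -sqrtr_sqr ler_sqrt ?lerDl ?addr_ge0 ?sqr_ge0.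
Qed.

Lemma ler_Im_normc z : `|Im z| <= normc z.
Proof.
by case: z => a b /=; rewrite -sqrtr_sqr ler_sqrt ?lerDr ?addr_ge0 ?sqr_ge0.
Qed.

Lemma normc_le_ReIm z : normc z <= `|Re z| + `|Im z|.
Proof.
case: z => a b; rewrite [X in normc X](_ : _ = a%:C + 'i%C * b%:C); last first.
  exact: (complexE (a +i* b)).
apply: le_trans (le_normcD _ _) _.
by rewrite normcM !normc_real /= expr0n expr1n /= add0r sqrtr1 mul1r.
Qed.

Lemma ReD z w : Re (z + w) = Re z + Re w.
Proof. by case: z w => [? ?] [? ?]. Qed.

Lemma ImD z w : Im (z + w) = Im z + Im w.
Proof. by case: z w => [? ?] [? ?]. Qed.

Lemma ReB z w : Re (z - w) = Re z - Re w.
Proof. by case: z w => [? ?] [? ?]. Qed.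

Lemma ImB z w : Im (z - w) = Im z - Im w.
Proof. by case: z w => [? ?] [? ?]. Qed.

Lemma ReM z w : Re (z * w) = Re z * Re w - Im z * Im w.
Proof. by case: z w => [? ?] [? ?]. Qed.

Lemma ImM z w : Im (z * w) = Re z * Im w + Im z * Re w.
Proof. by case: z w => [? ?] [? ?]. Qed.

Lemma Re_sum I (s : seq I) (P : pred I) (F : I -> R[i]) :
  Re (\sum_(i <- s | P i) F i) = \sum_(i <- s | P i) Re (F i).
Proof. by apply: (big_morph _ ReD). Qed.

Lemma Im_sum I (s : seq I) (P : pred I) (F : I -> R[i]) :
  Im (\sum_(i <- s | P i) F i) = \sum_(i <- s | P i) Im (F i).
Proof. by apply: (big_morph _ ImD). Qed.

Lemma ReZ r z : Re (r%:C * z) = r * Re z.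
Proof. by rewrite ReM /= mul0r subr0. Qed.

(** Linearizes the modulus: [u] is the conjugate phase of [z]. It brings a complex modulus under a
    real integral in [normc_moment_sum]. *)
Lemma normc_eq1_dual z : exists2 u : R[i], normc u = 1 & Re (u * z) = normc z.
Proof.
have [->|z0] := eqVneq z 0; first by exists 1; rewrite ?mulr0 ?normc1 ?normc0.
have nz0 : normc z != 0 by apply: contra z0 => /eqP /eq0_normc ->.
exists ((normc z)^-1%:C * z^*).
  by rewrite normcM normc_conj normc_real ger0_norm ?invr_ge0 ?normc_ge0 // mulVf.
rewrite -mulrA ReZ; have -> : Re (z^* * z) = normc z ^+ 2.
  by rewrite normc_sqr; case: (z) => a b /=; ring.
by rewrite expr2 mulKf.
Qed.

End normc_facts.

Section normc_limits.
Variable R : realType.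

(** The norm of [R[i]] takes its values in [R[i]], so the epsilon of the general criterion is a
    positive complex number. Positivity forces it to be real, which lets the criterion pass to the
    real-valued [normc]. *)
Lemma cvg_normcP (T : Type) (F : set_system T) (FF : Filter F)
    (u : T -> R[i]) (l : R[i]) :
  u @ F --> l <-> (normc (u x - l)) @[x --> F] --> (0 : R).
Proof.
split.
  move=> /cvgrPdist_lt h; apply/cvgrPdist_lt => e e0.
  have := h e%:C; rewrite ltcR => /(_ e0); apply: filterS => x.
  by rewrite normC_normc ltcR sub0r normrN ger0_norm ?normc_ge0 // normcB.
move=> /cvgrPdist_lt h; apply/cvgrPdist_lt => e e0.
have ee : e = (Re e)%:C by rewrite RRe_real // ger0_real // ltW.
have := h (Re e); rewrite ee ltcR in e0 => /(_ e0); apply: filterS => x.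
by rewrite ee normC_normc ltcR sub0r normrN ger0_norm ?normc_ge0 // normcB.
Qed.

Lemma cvg_normc (T : Type) (F : set_system T) (FF : Filter F)
    (u : T -> R[i]) (l : R[i]) :
  u @ F --> l -> normc (u x) @[x --> F] --> normc l.
Proof.
move=> /cvg_normcP h; apply/cvgrPdist_le => e e0.
move/cvgrPdist_le : h => /(_ e e0); apply: filterS => x.
rewrite sub0r normrN ger0_norm ?normc_ge0 //; apply: le_trans.
by rewrite distrC ler_dist_normc.
Qed.

Lemma cvg_Re (T : Type) (F : set_system T) (FF : Filter F)
    (u : T -> R[i]) (l : R[i]) :
  u @ F --> l -> Re (u x) @[x --> F] --> Re l.
Proof.
move=> /cvg_normcP h; apply/cvgrPdist_le => e e0.
move/cvgrPdist_le : h => /(_ e e0); apply: filterS => x.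
rewrite sub0r normrN ger0_norm ?normc_ge0 //; apply: le_trans.
by rewrite distrC -ReB ler_Re_normc.
Qed.

Lemma cvg_Im (T : Type) (F : set_system T) (FF : Filter F)
    (u : T -> R[i]) (l : R[i]) :
  u @ F --> l -> Im (u x) @[x --> F] --> Im l.
Proof.
move=> /cvg_normcP h; apply/cvgrPdist_le => e e0.
move/cvgrPdist_le : h => /(_ e e0); apply: filterS => x.
rewrite sub0r normrN ger0_norm ?normc_ge0 //; apply: le_trans.
by rewrite distrC -ImB ler_Im_normc.
Qed.

Lemma cvg_ReIm (T : Type) (F : set_system T) (FF : Filter F)
    (u : T -> R[i]) (l : R[i]) :
  Re (u x) @[x --> F] --> Re l -> Im (u x) @[x --> F] --> Im l -> u @ F --> l.
Proof.
move=> hr hi; apply/cvg_normcP/cvgrPdist_lt => e e0.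
have e20 : 0 < e / 2 by rewrite divr_gt0.
move/cvgrPdist_lt : hr => /(_ _ e20) hr; move/cvgrPdist_lt : hi => /(_ _ e20) hi.
near=> x; rewrite sub0r normrN ger0_norm ?normc_ge0 //.
apply: le_lt_trans (normc_le_ReIm _) _; rewrite ReB ImB [e]splitr.
by rewrite ltrD // distrC; near: x.
Unshelve. all: by end_near. Qed.

(* [R[i]] carries no completeness instance, hence the detour through the
   real and imaginary parts. *)
Lemma normc_series_cvg (u : nat -> R[i]) :
  cvgn (series (fun k => normc (u k))) -> cvgn (series u).
Proof.
move=> h.
have hr : cvgn (series (fun k => Re (u k))).
  apply: normed_cvg; apply: series_le_cvg h => n //=; rewrite ?normc_ge0 //.
  exact: ler_Re_normc.
have hi : cvgn (series (fun k => Im (u k))).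
  apply: normed_cvg; apply: series_le_cvg h => n //=; rewrite ?normc_ge0 //.
  exact: ler_Im_normc.
apply/cvg_ex; exists (limn (series (fun k => Re (u k))) +i*
                      limn (series (fun k => Im (u k)))).
apply: cvg_ReIm.
  rewrite [X in X @ _](_ : _ = series (fun k => Re (u k))) //.
  by apply/funext => n; rewrite /series /= Re_sum.
rewrite [X in X @ _](_ : _ = series (fun k => Im (u k))) //.
by apply/funext => n; rewrite /series /= Im_sum.
Qed.

Lemma normc_lim_le (u : nat -> R[i]) (l : R[i]) (C : R) :
  u @ \oo --> l -> (\forall n \near \oo, normc (u n) <= C) -> normc l <= C.
Proof.
move=> /cvg_normc h hC.
by rewrite -(cvg_lim _ h) //; apply: limr_le => //; apply/cvg_ex; exists (normc l).
Qed.

Lemma Re_lim_ge (u : nat -> R[i]) (l : R[i]) (C : R) :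
  u @ \oo --> l -> (\forall n \near \oo, C <= Re (u n)) -> C <= Re l.
Proof.
move=> /cvg_Re h hC.
by rewrite -(cvg_lim _ h) //; apply: limr_ge => //; apply/cvg_ex; exists (Re l).
Qed.

End normc_limits.

(** * Power series in the unit disc *)

Section power_series_disc.
Variable R : realType.
Implicit Types (a : nat -> R[i]) (f : R[i] -> R[i]).

(** Radius of convergence at least 1, in terms of real series only. Unlike [expands] it mentions no
    function, and it is stable under [deriv_coef]. *)
Definition abs_expansion a := forall rho : R, 0 <= rho -> rho < 1 ->
  cvgn (series (fun k => normc (a k) * rho ^+ k)).

Definition deriv_coef a : nat -> R[i] := fun k => a k.+1 *+ k.+1.

(** Stated over any commutative ring because it is used at real points for convergence and at
    complex points for the kernel of the derivative. *)
Lemma sum_derive_geometric (F : comNzRingType) (x : F) n :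
  (1 - x) ^+ 2 * \sum_(0 <= k < n) (x ^+ k *+ k.+1) =
  1 - x ^+ n *+ n.+1 + x ^+ n.+1 *+ n.
Proof.
elim: n => [|n IH]; first by rewrite big_nil mulr0 expr0 !mulr0n mulr1n subrr addr0.
rewrite big_nat_recr //= mulrDr IH !exprS; ring.
Qed.

Lemma sum_derive_geometric_le (x : R) n : 0 <= x -> x < 1 ->
  \sum_(0 <= k < n) (x ^+ k *+ k.+1) <= ((1 - x) ^+ 2)^-1.
Proof.
move=> x0 x1; have y0 : 0 < (1 - x) ^+ 2 by rewrite exprn_gt0 // subr_gt0.
rewrite -[leRHS]mul1r ler_pdivlMr // mulrC sum_derive_geometric.
rewrite -addrA gerDl addrC subr_le0 exprS -mulrnAr.
apply: le_trans (_ : x ^+ n *+ n <= _); last first.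
  by rewrite mulrSr lerDl exprn_ge0.
by rewrite ler_piMl ?(ltW x1) // mulrn_wge0 // exprn_ge0.
Qed.

Lemma bounded_nondecreasing_cvg (u : nat -> R) (M : R) : (forall n, 0 <= u n) ->
  (forall n, series u n <= M) -> cvgn (series u).
Proof.
move=> u0 uM; apply: nondecreasing_is_cvgn; first exact: nondecreasing_series.
by exists M => _ [n _ <-].
Qed.

Lemma series_le_lim (u : nat -> R) n : (forall n, 0 <= u n) ->
  cvgn (series u) -> series u n <= limn (series u).
Proof.
move=> u0 cu; apply: nondecreasing_cvgn_le => //; exact: nondecreasing_series.
Qed.

Lemma cvg_terms_bounded a (z : R[i]) : cvgn (power_series a z) ->
  exists2 M : R, 0 <= M & forall k, normc (a k) * normc z ^+ k <= M.
Proof.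
move=> /cvg_series_cvg_0/cvg_normc; rewrite normc0 => h.
have /cvg_seq_bounded[M [Mr hM]] : cvgn (fun k => normc (a k * z ^+ k)).
  by apply/cvg_ex; exists 0.
exists (`|M| + 1) => [|k]; first by rewrite addr_ge0.
have := hM (`|M| + 1); rewrite (le_lt_trans (ler_norm _)) ?ltrDl // => /(_ isT k I) /=.
by rewrite ger0_norm ?normc_ge0 // normcM normcX.
Qed.

(** Abel's lemma: the terms are dominated by M (rho/sigma)^k. *)
Lemma terms_bounded_abs_summable a (sigma rho M : R) : 0 <= rho -> rho < sigma ->
  (forall k, normc (a k) * sigma ^+ k <= M) ->
  cvgn (series (fun k => normc (a k) * rho ^+ k)).
Proof.
move=> r0 rs hM; have s0 : 0 < sigma by apply: le_lt_trans rs.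
have q1 : `|rho / sigma| < 1.
  by rewrite ger0_norm ?divr_ge0 ?(ltW s0) // ltr_pdivrMr // mul1r.
apply: series_le_cvg (is_cvg_geometric_series (a := M) q1) => n /=.
- by rewrite mulr_ge0 ?normc_ge0 ?exprn_ge0.
- rewrite mulr_ge0 ?exprn_ge0 ?divr_ge0 ?(ltW s0) //.
  by apply: le_trans (hM 0%N); rewrite mulr_ge0 ?normc_ge0 // exprn_ge0 ?ltW.
rewrite expr_div_n mulrA ler_pdivlMr ?exprn_gt0 // mulrAC.
by rewrite ler_wpM2r // exprn_ge0.
Qed.

Lemma disc_cvg_abs_expansion a :
  (forall z, unit_disc z -> cvgn (power_series a z)) -> abs_expansion a.
Proof.
move=> ca rho r0 r1; pose s := (rho + 1) / 2.
have rs : rho < s by rewrite /s; lra.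
have s1 : s < 1 by rewrite /s; lra.
have s0 : 0 <= s by rewrite /s; lra.
have ns : normc s%:C = s by rewrite normc_real ger0_norm.
have := ca s%:C; rewrite /unit_disc /mkset ns => /(_ s1)/cvg_terms_bounded[M M0].
rewrite ns => hM; exact: terms_bounded_abs_summable hM.
Qed.

Lemma expands_abs_expansion f a : expands f a -> abs_expansion a.
Proof.
by move=> fa; apply: disc_cvg_abs_expansion => z /fa h; apply/cvg_ex; exists (f z).
Qed.

Lemma abs_expansion_cvg a z : abs_expansion a -> unit_disc z ->
  power_series a z @ \oo --> power_sum a z.
Proof.
move=> ha hz; apply: normc_series_cvg.
rewrite [X in series X](_ : _ = fun k => normc (a k) * normc z ^+ k).
  by apply: ha => //; exact: normc_ge0.
by apply/funext => k; rewrite normcM normcX.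
Qed.

Lemma abs_expansion_bounded a (rho : R) : abs_expansion a -> 0 <= rho -> rho < 1 ->
  exists2 M : R, 0 <= M & forall k, normc (a k) * rho ^+ k <= M.
Proof.
move=> ha r0 r1; have /cvg_ex[l hl] := ha _ r0 r1.
have nr : normc rho%:C = rho by rewrite normc_real ger0_norm.
have hz : unit_disc rho%:C by rewrite /unit_disc /mkset nr.
by have := cvg_terms_bounded (abs_expansion_cvg ha hz); rewrite nr.
Qed.

Lemma abs_expansion_deriv a : abs_expansion a -> abs_expansion (deriv_coef a).
Proof.
move=> ha rho r0 r1; pose s := (rho + 1) / 2.
have rs : rho < s by rewrite /s; lra.
have s1 : s < 1 by rewrite /s; lra.
have s0 : 0 < s by rewrite /s; lra.
have [M M0 hM] := abs_expansion_bounded ha (ltW s0) s1.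
have x0 : 0 <= rho / s by rewrite divr_ge0 // ltW.
have x1 : rho / s < 1 by rewrite ltr_pdivrMr // mul1r.
apply: (@bounded_nondecreasing_cvg _ (M / s * ((1 - rho / s) ^+ 2)^-1)) => n.
  by rewrite mulr_ge0 ?normc_ge0 ?exprn_ge0.
apply: le_trans (_ : M / s * \sum_(0 <= k < n) ((rho / s) ^+ k *+ k.+1) <= _); last first.
  apply: ler_wpM2l; first by rewrite divr_ge0 // ltW.
  exact: sum_derive_geometric_le.
rewrite /series /= mulr_sumr; apply: ler_sum => k _.
rewrite /deriv_coef normcMn mulrnAl mulrnAr lerMn2r //=.
rewrite expr_div_n mulrA ler_pdivlMr ?exprn_gt0 // mulrAC ler_wpM2r ?exprn_ge0 //.
by rewrite ler_pdivlMr // -mulrA -exprSr.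
Qed.

(** Second-order Taylor remainder of a power, without the factor 1/2. The remainder at exponent k+3
    is [w] times the one at k+2 plus (k+2) (w - z)^2 z^(k+1), and the bound satisfies the same
    recursion with room to spare. *)
Lemma expr_remainder_le (z w : R[i]) (rho : R) k :
  normc z <= rho -> normc w <= rho ->
  normc (w ^+ k.+2 - z ^+ k.+2 - (w - z) * (z ^+ k.+1 *+ k.+2)) <=
    normc (w - z) ^+ 2 * (rho ^+ k *+ k.+1 *+ k.+2).
Proof.
move=> hz hw; have r0 : 0 <= rho by apply: le_trans hz; apply: normc_ge0.
elim: k => [|k IH].
  rewrite (_ : _ - _ = (w - z) ^+ 2); last by ring.
  by rewrite normcX expr0 mulr1n mulr2n ler_peMr ?exprn_ge0 ?normc_ge0 // lerDl.
rewrite (_ : _ - _ - _ = w * (w ^+ k.+2 - z ^+ k.+2 - (w - z) * (z ^+ k.+1 *+ k.+2)) +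
   (w - z) ^+ 2 * (z ^+ k.+1 *+ k.+2)); last first.
  by rewrite !exprS; ring.
apply: le_trans (le_normcD _ _) _.
rewrite (normcM w) (normcM ((w - z) ^+ 2)) (normcX (w - z)) normcMn (normcX z).
apply: le_trans (_ : rho * (normc (w - z) ^+ 2 * (rho ^+ k *+ k.+1 *+ k.+2)) +
  normc (w - z) ^+ 2 * (rho ^+ k.+1 *+ k.+2) <= _).
  apply: lerD; first by rewrite ler_pM ?normc_ge0.
  apply: ler_wpM2l; first by rewrite exprn_ge0 ?normc_ge0.
  by rewrite lerMn2r /= lerXn2r ?nnegrE ?normc_ge0.
rewrite -subr_ge0 (_ : _ - _ = normc (w - z) ^+ 2 * rho ^+ k.+1 * k.+2%:R).
  by rewrite !mulr_ge0 ?exprn_ge0 ?normc_ge0.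
by rewrite !exprS; ring.
Qed.

(** The shifts are such that the terms of degree 0 and 1 cancel exactly, leaving only second-order
    remainders. *)
Lemma power_series_remainder a (z w : R[i]) n :
  power_series a w n.+2 - power_series a z n.+2 -
    (w - z) * power_series (deriv_coef a) z n.+1 =
  \sum_(0 <= k < n) a k.+2 *
     (w ^+ k.+2 - z ^+ k.+2 - (w - z) * (z ^+ k.+1 *+ k.+2)).
Proof.
rewrite /power_series /series /= !(big_nat_recl n.+1) // !(big_nat_recl n) //=.
rewrite !expr0 !expr1 /deriv_coef mulr1n !mulr1.
rewrite [X in X = _](_ : _ = \sum_(0 <= k < n) a k.+2 * w ^+ k.+2 -
   \sum_(0 <= k < n) a k.+2 * z ^+ k.+2 -
   (w - z) * \sum_(0 <= k < n) a k.+2 *+ k.+2 * z ^+ k.+1); last by ring.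
rewrite mulr_sumr -!sumrB; apply: eq_bigr => k _.
ring.
Qed.

Lemma expands_remainder_le f a (z w : R[i]) (rho : R) : expands f a ->
  normc z <= rho -> normc w <= rho -> rho < 1 ->
  normc (f w - f z - (w - z) * power_sum (deriv_coef a) z) <=
  normc (w - z) ^+ 2 *
     limn (series (fun k => normc (deriv_coef (deriv_coef a) k) * rho ^+ k)).
Proof.
move=> fa hz hw r1; have r0 : 0 <= rho by apply: le_trans hz; apply: normc_ge0.
have ha := expands_abs_expansion fa.
have hda := abs_expansion_deriv ha; have hdda := abs_expansion_deriv hda.
have zD : unit_disc z by apply: le_lt_trans r1.
have wD : unit_disc w by apply: le_lt_trans r1.
have h : (fun n => power_series a w n.+2 - power_series a z n.+2 -
    (w - z) * power_series (deriv_coef a) z n.+1) @ \oo -->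
    f w - f z - (w - z) * power_sum (deriv_coef a) z.
  apply: cvgB; first apply: cvgB.
  - by rewrite (cvg_shiftS (fun n => power_series a w n.+1)) cvg_shiftS; exact: fa.
  - by rewrite (cvg_shiftS (fun n => power_series a z n.+1)) cvg_shiftS; exact: fa.
  apply: cvgM; first exact: cvg_cst.
  by rewrite cvg_shiftS; exact: abs_expansion_cvg.
apply: normc_lim_le h _; apply: nearW => n.
rewrite power_series_remainder; apply: le_trans (ler_normc_sum _ _ _) _.
apply: le_trans (_ : normc (w - z) ^+ 2 *
   series (fun k => normc (deriv_coef (deriv_coef a) k) * rho ^+ k) n <= _); last first.
  rewrite ler_wpM2l ?exprn_ge0 ?normc_ge0 //; apply: series_le_lim => [k|].
    by rewrite mulr_ge0 ?normc_ge0 ?exprn_ge0.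
  exact: hdda.
rewrite /series /= mulr_sumr; apply: ler_sum => k _.
rewrite normcM /deriv_coef !normcMn.
apply: le_trans (_ : normc (a k.+2) * (normc (w - z) ^+ 2 * (rho ^+ k *+ k.+1 *+ k.+2)) <= _).
  by rewrite ler_wpM2l ?normc_ge0 // expr_remainder_le.
by rewrite le_eqVlt; apply/orP; left; apply/eqP; ring.
Qed.

(** The first-order remainder is at most K |w - z|^2, with K uniform on the disc whose radius [rho]
    lies midway between |z| and 1. *)
Lemma expands_is_derive f a z : expands f a -> unit_disc z ->
  is_derive z 1 f (power_sum (deriv_coef a) z).
Proof.
move=> fa zD; pose rho := (normc z + 1) / 2.
have z1 : normc z < 1 by [].
have zr : normc z < rho by rewrite /rho; lra.
have r1 : rho < 1 by rewrite /rho; lra.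
pose K := limn (series (fun k => normc (deriv_coef (deriv_coef a) k) * rho ^+ k)).
have h : (fun h : R[i] => h^-1 *: (f (h *: 1 + z) - f z)) @ 0^' -->
    power_sum (deriv_coef a) z.
  apply/cvg_normcP; apply/cvgrPdist_lt => e e0.
  have K0 : 0 <= K.
    have := expands_remainder_le fa (ltW zr) (_ : normc z <= rho) r1.
    have : 0 <= series (fun k => normc (deriv_coef (deriv_coef a) k) * rho ^+ k) 0%N.
      by rewrite /series /= big_nil.
    move=> h0 _; apply: le_trans h0 _; apply: series_le_lim => [k|].
      by rewrite mulr_ge0 ?normc_ge0 ?exprn_ge0 // (le_trans (normc_ge0 z)) // ltW.
    apply: (abs_expansion_deriv (abs_expansion_deriv (expands_abs_expansion fa))) => //.
    by rewrite (le_trans (normc_ge0 z)) // ltW.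
  (* The first bound keeps the perturbed point in the disc of radius [rho]; the second makes K |x| <
     e, with K + 1 in the denominator since K may vanish. *)
  pose d := Num.min (rho - normc z) (e / (K + 1)).
  have d0 : 0 < d.
    by rewrite /d lt_min subr_gt0 zr divr_gt0 // (le_lt_trans K0) // ltrDl.
  have : \forall x \near (0 : R[i])^', normc x < d /\ x != 0.
    near=> x; split; last by near: x; exact: nbhs_dnbhs_neq.
    rewrite -ltcR -normC_normc; near: x; apply: dnbhs0_lt.
    by rewrite ltcR.
  apply: filterS => x [xd x0].
  have [xr xe] : normc x < rho - normc z /\ normc x < e / (K + 1).
    by move: xd; rewrite /d lt_min => /andP.
  have wr : normc (x + z) <= rho by have := le_normcD x z; lra.
  have := expands_remainder_le fa (ltW zr) wr r1; rewrite addrK -/K => hR.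
  have nx0 : 0 < normc x.
    by rewrite lt_neqAle normc_ge0 andbT eq_sym; apply: contra x0 => /eqP/eq0_normc ->.
  rewrite sub0r normrN ger0_norm ?normc_ge0 //.
  rewrite (_ : _ - _ = x^-1 * (f (x + z) - f z - x * power_sum (deriv_coef a) z)); last first.
    have sc (u v : R[i]) : u *: v = u * v by [].
    by rewrite !sc mulr1 [RHS]mulrBr mulKf.
  rewrite normcM normcV -(ltr_pM2l nx0) mulrA divff ?gt_eqF // mul1r.
  apply: le_lt_trans hR _; rewrite expr2 -mulrA ltr_pM2l //.
  have : normc x * (K + 1) < e by rewrite -ltr_pdivlMr // ltr_pwDr.
  by move=> h2; apply: le_lt_trans h2; rewrite ler_wpM2l ?normc_ge0 // lerDl.
apply: DeriveDef; first by apply/cvg_ex; exists (power_sum (deriv_coef a) z).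
exact: cvg_lim h.
Unshelve. all: by end_near. Qed.

Lemma expands_derivE f a z : expands f a -> unit_disc z ->
  derive1 f z = power_sum (deriv_coef a) z.
Proof. by move=> fa zD; rewrite derive1E; apply: derive_val; exact: expands_is_derive. Qed.

Lemma expands_analytic f a : expands f a -> analytic_disc f.
Proof. by move=> fa z zD; case: (expands_is_derive fa zD). Qed.

Lemma abs_expansion_expands a : abs_expansion a -> expands (power_sum a) a.
Proof. by move=> ha z; exact: abs_expansion_cvg. Qed.

End power_series_disc.

(** * Parseval's identity on the circle *)

Section complex_measurability.
Context d (T : measurableType d) (R : realType).
Implicit Types (D : set T) (F G : T -> R[i]).

Definition cmeasurable D F :=
  measurable_fun D (fun x => Re (F x)) /\ measurable_fun D (fun x => Im (F x)).

Lemma cmeasurable_cst D c : cmeasurable D (cst c).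
Proof. by split; exact: measurable_cst. Qed.

Lemma cmeasurableD D F G : cmeasurable D F -> cmeasurable D G ->
  cmeasurable D (fun x => F x + G x).
Proof.
move=> [? ?] [? ?]; split; under eq_fun do rewrite ?ReD ?ImD;
  exact: measurable_funD.
Qed.

Lemma cmeasurableM D F G : cmeasurable D F -> cmeasurable D G ->
  cmeasurable D (fun x => F x * G x).
Proof.
move=> [? ?] [? ?]; split.
  by under eq_fun do rewrite ReM; apply: measurable_funB; exact: measurable_funM.
by under eq_fun do rewrite ImM; apply: measurable_funD; exact: measurable_funM.
Qed.

Lemma cmeasurableX D F n : cmeasurable D F -> cmeasurable D (fun x => F x ^+ n).
Proof.
move=> mF; elim: n => [|n IH].
  by under eq_fun do rewrite expr0; exact: cmeasurable_cst.
by under eq_fun do rewrite exprS; exact: cmeasurableM.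
Qed.

Lemma cmeasurable_real D (f : T -> R) : measurable_fun D f ->
  cmeasurable D (fun x => (f x)%:C).
Proof. by move=> mf; split => //=; exact: measurable_cst. Qed.

Lemma cmeasurable_sum D I (s : seq I) (F : I -> T -> R[i]) :
  (forall i, cmeasurable D (F i)) -> cmeasurable D (fun x => \sum_(i <- s) F i x).
Proof.
move=> mF; elim: s => [|i s IH].
  by under eq_fun do rewrite big_nil; exact: cmeasurable_cst.
by under eq_fun do rewrite big_cons; exact: cmeasurableD.
Qed.

Lemma cmeasurable_horner D F (p : {poly R[i]}) : cmeasurable D F ->
  cmeasurable D (fun x => p.[F x]).
Proof.
move=> mF; under eq_fun do rewrite horner_coef.
apply: cmeasurable_sum => i; apply: cmeasurableM; first exact: cmeasurable_cst.
exact: cmeasurableX.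
Qed.

Lemma measurable_sqrt : measurable_fun [set: R] (@Num.sqrt R).
Proof. by apply: continuous_measurable_fun; exact: sqrt_continuous. Qed.

Lemma measurable_normc D F : cmeasurable D F -> measurable_fun D (fun x => normc (F x)).
Proof.
move=> [mr mi].
rewrite (_ : (fun _ => _) = (@Num.sqrt R) \o (fun x => Re (F x) ^+ 2 + Im (F x) ^+ 2)).
  apply: measurableT_comp; first exact: measurable_sqrt.
  by apply: measurable_funD; exact: measurable_funX.
by apply/funext => x /=; case: (F x).
Qed.

Lemma cmeasurable_cvg D (u : nat -> T -> R[i]) F : (forall n, cmeasurable D (u n)) ->
  (forall x, D x -> u ^~ x @ \oo --> F x) -> cmeasurable D F.
Proof.
move=> mu hF; split.
  apply: (@measurable_fun_cvg _ _ _ D (fun n x => Re (u n x))) => [n|x /hF].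
    by case: (mu n).
  exact: cvg_Re.
apply: (@measurable_fun_cvg _ _ _ D (fun n x => Im (u n x))) => [n|x /hF].
  by case: (mu n).
exact: cvg_Im.
Qed.

(** A function with an expansion is a pointwise limit of polynomials, so measurability needs no
    continuity of [f]. *)
Lemma cmeasurable_expands D F (f : R[i] -> R[i]) a : expands f a ->
  cmeasurable D F -> (forall x, D x -> unit_disc (F x)) ->
  cmeasurable D (fun x => f (F x)).
Proof.
move=> fa mF FD; apply: (@cmeasurable_cvg D (fun n x => power_series a (F x) n)).
  move=> n; apply: cmeasurable_sum => k; apply: cmeasurableM.
    exact: cmeasurable_cst.
  exact: cmeasurableX.
by move=> x /FD /fa.
Qed.

End complex_measurability.

(** * Trigonometric integrals and Parseval for polynomials *)

Section circle.
Variable R : realType.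
Local Notation mu := (@lebesgue_measure R).
Local Notation circ := (`[0%R, (2 * pi)%R]%classic : set R).

Definition cis (t : R) : R[i] := cos t +i* sin t.

Lemma normc_cis t : normc (cis t) = 1.
Proof. by rewrite /= cos2Dsin2 sqrtr1. Qed.

Lemma cis0 : cis 0 = 1.
Proof. by rewrite /cis cos0 sin0. Qed.

Lemma cisD s t : cis (s + t) = cis s * cis t.
Proof.
rewrite /cis cosD sinD; apply/eqP; rewrite eq_complex /=; apply/andP; split => //.
by rewrite addrC.
Qed.

Lemma cisX t n : cis t ^+ n = cis (n%:R * t).
Proof.
by elim: n => [|n IH]; rewrite ?expr0 ?mul0r ?cis0 // exprS IH -cisD mulrS mulrDl mul1r.
Qed.

Lemma cis_2pi_nat n : cis (n%:R * (2 * pi)) = 1.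
Proof.
rewrite -cisX (_ : cis (2 * pi) = 1) ?expr1n //.
by rewrite /cis mulr2n mulrDl mul1r -mulr2n cos2pi sin2pi.
Qed.

Lemma cmeasurable_cis : cmeasurable [set: R] cis.
Proof.
by split; apply: continuous_measurable_fun; [exact: continuous_cos|exact: continuous_sin].
Qed.

Lemma lebesgue_circ : mu circ = (2 * pi)%:E.
Proof.
by rewrite lebesgue_measure_itv /= lte_fin mulr_gt0 ?pi_gt0 // -EFinB subr0.
Qed.

Lemma measurable_circ : measurable circ.
Proof. exact: measurable_itv. Qed.

Lemma bounded_integrable_circ (F : R -> R) (M : R) : measurable_fun [set: R] F ->
  (forall t, `|F t| <= M) -> mu.-integrable circ (EFin \o F).
Proof.
move=> mF hM; apply: measurable_bounded_integrable.
- exact: measurable_itv.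
- by move: (ltry (2 * pi : R)); rewrite -lebesgue_circ.
- exact: measurable_funTS.
by exists M; split; [exact: num_real|move=> x Mx t _ /=; apply: le_trans (hM t) (ltW Mx)].
Qed.

Lemma FTC_circ (f F : R -> R) : continuous f -> (forall t : R, is_derive t (1 : R) F (f t)) ->
  \int[mu]_(t in circ) f t = F (2 * pi) - F 0.
Proof.
move=> cf dF; have pi0 : 0 < 2 * pi :> R by rewrite mulr_gt0 ?pi_gt0.
have cF : continuous F.
  move=> t; apply: differentiable_continuous; apply/derivable1_diffP.
  by case: (dF t).
rewrite /Rintegral (@continuous_FTC2 _ f F) //.
- exact: continuous_subspaceT.
- split; [by move=> t _; case: (dF t)| |].
    by apply: cvg_at_right_filter; exact: cF.
  by apply: cvg_at_left_filter; exact: cF.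
- by move=> t _; rewrite derive1E; exact: derive_val.
Qed.

Lemma integral_cos_nat n : (0 < n)%N -> \int[mu]_(t in circ) cos (n%:R * t) = 0.
Proof.
move=> n0; have nz : n%:R != 0 :> R by rewrite pnatr_eq0 -lt0n.
have dF (t : R) : is_derive t (1 : R) (fun t => n%:R^-1 * sin (n%:R * t)) (cos (n%:R * t)).
  by apply: is_derive_eq; rewrite /GRing.scale /=; field.
rewrite (FTC_circ _ dF).
  have := cis_2pi_nat n; rewrite /cis => -[_ ->].
  by rewrite !mulr0 sin0 mulr0 subrr.
move=> t; apply: continuous_comp; last exact: continuous_cos.
exact: mulrl_continuous.
Qed.

Lemma integral_sin_nat n : (0 < n)%N -> \int[mu]_(t in circ) sin (n%:R * t) = 0.
Proof.
move=> n0; have nz : n%:R != 0 :> R by rewrite pnatr_eq0 -lt0n.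
have dF (t : R) : is_derive t (1 : R) (fun t => - n%:R^-1 * cos (n%:R * t)) (sin (n%:R * t)).
  by apply: is_derive_eq; rewrite /GRing.scale /=; field.
rewrite (FTC_circ _ dF).
  have := cis_2pi_nat n; rewrite /cis => -[-> _].
  by rewrite mulr0 cos0 subrr.
move=> t; apply: continuous_comp; last exact: continuous_sin.
exact: mulrl_continuous.
Qed.

(** The Wiener norm: a crude bound for [p] on the closed disc that makes every circle integral below
    finite. *)
Definition coef_norm (p : {poly R[i]}) := \sum_(i < size p) normc p`_i.

Lemma coef_norm_ge0 p : 0 <= coef_norm p.
Proof. by apply: sumr_ge0 => i _; exact: normc_ge0. Qed.

Lemma horner_le_coef_norm (p : {poly R[i]}) z : normc z <= 1 -> normc p.[z] <= coef_norm p.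
Proof.
move=> z1; rewrite horner_coef; apply: le_trans (ler_normc_sum _ _ _) _.
apply: ler_sum => i _; rewrite normcM normcX ler_piMr ?normc_ge0 //.
by rewrite exprn_ile1 ?normc_ge0.
Qed.

Lemma integrable_Re_horner (p : {poly R[i]}) n :
  mu.-integrable circ (EFin \o (fun t => Re (p.[cis t] * cis t ^+ n))).
Proof.
apply: (@bounded_integrable_circ _ (coef_norm p)).
  suff [] : cmeasurable [set: R] (fun t => p.[cis t] * cis t ^+ n) by [].
  apply: cmeasurableM; first exact: cmeasurable_horner cmeasurable_cis.
  exact: cmeasurableX cmeasurable_cis.
move=> t; apply: le_trans (ler_Re_normc _) _.
by rewrite normcM normcX normc_cis expr1n mulr1 horner_le_coef_norm // normc_cis.
Qed.

Lemma integrable_normc_horner (p : {poly R[i]}) n :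
  mu.-integrable circ (EFin \o (fun t => normc p.[cis t] ^+ n)).
Proof.
apply: (@bounded_integrable_circ _ (coef_norm p ^+ n)).
  apply: measurable_funX; apply: measurable_normc.
  exact: cmeasurable_horner cmeasurable_cis.
move=> t; rewrite ger0_norm ?exprn_ge0 ?normc_ge0 //.
by rewrite lerXn2r ?nnegrE ?normc_ge0 ?coef_norm_ge0 // horner_le_coef_norm // normc_cis.
Qed.

(** Only strictly positive frequencies occur. The exponent [n] is general because peeling one
    coefficient off [p] raises it by one. *)
Lemma integral_Re_horner (p : {poly R[i]}) n : (0 < n)%N ->
  \int[mu]_(t in circ) Re (p.[cis t] * cis t ^+ n) = 0.
Proof.
elim/poly_ind: p n => [|p c IH] n n0.
  under eq_Rintegral do rewrite horner0 mul0r /=.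
  by rewrite Rintegral_cst ?mul0r //; exact: measurable_circ.
have E t : Re ((p * 'X + c%:P).[cis t] * cis t ^+ n) =
    Re (p.[cis t] * cis t ^+ n.+1) + (Re c * cos (n%:R * t) - Im c * sin (n%:R * t)).
  rewrite hornerD hornerM hornerX hornerC mulrDl -mulrA -exprS ReD; congr (_ + _).
  by rewrite cisX ReM.
under eq_Rintegral do rewrite E.
have ic : mu.-integrable circ (EFin \o (fun t => cos (n%:R * t))).
  apply: (@bounded_integrable_circ _ 1) => [|t]; last by rewrite ler_norml cos_geN1 cos_le1.
  apply: continuous_measurable_fun => t; apply: continuous_comp; last exact: continuous_cos.
  exact: mulrl_continuous.
have isn : mu.-integrable circ (EFin \o (fun t => sin (n%:R * t))).
  apply: (@bounded_integrable_circ _ 1) => [|t]; last by rewrite ler_norml sin_geN1 sin_le1.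
  apply: continuous_measurable_fun => t; apply: continuous_comp; last exact: continuous_sin.
  exact: mulrl_continuous.
have icc : mu.-integrable circ (EFin \o (fun t => Re c * cos (n%:R * t))).
  by apply: (integrableZl _ (Re c)) ic; exact: measurable_circ.
have iss : mu.-integrable circ (EFin \o (fun t => Im c * sin (n%:R * t))).
  by apply: (integrableZl _ (Im c)) isn; exact: measurable_circ.
rewrite RintegralD //; last 2 first.
- exact: integrable_Re_horner.
- by apply: (integrableB _ icc iss); exact: measurable_circ.
rewrite IH // add0r RintegralB //.
rewrite !RintegralZl //.
by rewrite integral_cos_nat // integral_sin_nat // !mulr0 subrr.
Qed.

Lemma normc_sqrD (u v : R[i]) :
  normc (u + v) ^+ 2 = normc v ^+ 2 + (2 * Re (v^* * u) + normc u ^+ 2).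
Proof. by rewrite !normc_sqr; case: u v => [a b] [c e] /=; ring. Qed.

(** Induction on p = q X + c: on the circle |q z + c|^2 is |c|^2 + |q|^2 plus the cross term 2 Re
    (c^* q z), whose mean vanishes by [integral_Re_horner]. *)
Lemma parseval_poly n (p : {poly R[i]}) : (size p <= n)%N ->
  \int[mu]_(t in circ) (normc p.[cis t] ^+ 2) =
  2 * pi * \sum_(i < n) normc p`_i ^+ 2.
Proof.
have z0 m : \int[mu]_(t in circ) (normc (0 : {poly R[i]}).[cis t] ^+ 2) =
    2 * pi * \sum_(i < m) normc (0 : {poly R[i]})`_i ^+ 2.
  under eq_Rintegral do rewrite horner0 normc0 expr0n /=.
  rewrite Rintegral_cst // mul0r.
  by rewrite big1 ?mulr0 // => i _; rewrite coef0 normc0 expr0n.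
elim/poly_ind: p n => [|p c IH] n hn; first exact: z0.
case: n hn => [|n] hn.
  by move: hn; rewrite size_poly_leq0 => /eqP ->; exact: z0.
have hp : (size p <= n)%N.
  have [->|p0] := eqVneq p 0; first by rewrite size_poly0.
  by move: hn; rewrite size_MXaddC (negbTE p0) /= ltnS.
have E t : normc (p * 'X + c%:P).[cis t] ^+ 2 =
    normc c ^+ 2 + (2 * Re ((c^*%:P * p).[cis t] * cis t ^+ 1) + normc p.[cis t] ^+ 2).
  rewrite !(hornerD, hornerM, hornerX, hornerC) expr1 normc_sqrD normcM normc_cis mulr1.
  by rewrite mulrA.
under eq_Rintegral do rewrite E.
have i2 := integrable_normc_horner p 2.
have i1 : mu.-integrable circ (EFin \o (fun t => 2 * Re ((c^*%:P * p).[cis t] * cis t ^+ 1))).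
  by apply: (integrableZl _ 2 (integrable_Re_horner _ _)); exact: measurable_circ.
have i0 : mu.-integrable circ (EFin \o (fun=> normc c ^+ 2)).
  apply: (@bounded_integrable_circ _ (normc c ^+ 2)) => [|t]; first exact: measurable_cst.
  by rewrite ger0_norm ?exprn_ge0 ?normc_ge0.
rewrite RintegralD //; last by apply: (integrableD _ i1 i2); exact: measurable_circ.
rewrite RintegralD //.
have -> : \int[mu]_(t in circ) (2 * Re ((c^*%:P * p).[cis t] * cis t ^+ 1)) = 0.
  rewrite RintegralZl ?integral_Re_horner ?mulr0 //; exact: integrable_Re_horner.
rewrite add0r (IH n hp) Rintegral_cst //.
rewrite (_ : fine _ = 2 * pi); last by rewrite -[RHS]/(fine (2 * pi)%:E) -lebesgue_circ.
rewrite [X in _ = _ * X]big_ord_recl [RHS]mulrDr /=; congr (_ + _).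
  by rewrite mulrC coefD coefMX coefC /= add0r.
congr (_ * _); apply: eq_bigr => i _.
by rewrite coefD coefMX coefC /= addr0.
Qed.

End circle.

(** * Hardy's inequality for polynomials *)

Section hilbert.
Variable R : realType.
Implicit Types x y : nat -> R.

(** This and the next lemma are the telescoping forms of the integrals of x^(-1/2) and x^(-3/2). *)
Lemma sqrtS_sub (n : nat) :
  (Num.sqrt n.+1%:R : R)^-1 <= 2 * (Num.sqrt n.+1%:R - Num.sqrt n%:R).
Proof.
set a := Num.sqrt n%:R; set b := Num.sqrt n.+1%:R.
have a0 : 0 <= a by exact: sqrtr_ge0.
have b0 : 0 < b by rewrite sqrtr_gt0 ltr0n.
have ab : b ^+ 2 = a ^+ 2 + 1 by rewrite !sqr_sqrtr ?ler0n // natr1.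
have ab' : a <= b by rewrite ler_wsqrtr // ler_nat.
rewrite -[leLHS]mul1r ler_pdivrMr //; nra.
Qed.

Lemma sqrt_invS_sub (n : nat) : (0 < n)%N ->
  (n.+1%:R * Num.sqrt n.+1%:R : R)^-1 <=
     2 * ((Num.sqrt n%:R)^-1 - (Num.sqrt n.+1%:R)^-1).
Proof.
move=> n0; set a : R := Num.sqrt n%:R; set b : R := Num.sqrt n.+1%:R.
have a0 : 0 < a by rewrite sqrtr_gt0 ltr0n.
have b0 : 0 < b by rewrite sqrtr_gt0 ltr0n.
have ab : b ^+ 2 = a ^+ 2 + 1 by rewrite !sqr_sqrtr ?ler0n // natr1.
have ab' : a <= b by rewrite ler_wsqrtr // ler_nat.
have -> : n.+1%:R = b ^+ 2 by rewrite sqr_sqrtr.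
have -> : 2 * (a^-1 - b^-1) = 2 * (b - a) / (a * b) by field; rewrite ?gt_eqF.
rewrite ler_pdivlMr ?mulr_gt0 // mulrC ler_pdivrMr ?mulr_gt0 ?exprn_gt0 //.
have h : (b - a) * (b + a) = 1 by rewrite -subr_sqr ab; ring.
have h2 : a * (b + a) <= 2 * b ^+ 2 by nra.
have h3 : 0 <= (b - a) * b by rewrite mulr_ge0 ?subr_ge0 // ltW.
have := ler_wpM2r h3 h2.
have -> : a * (b + a) * ((b - a) * b) = a * b * ((b - a) * (b + a)) by ring.
by rewrite h mulr1 => /le_trans; apply; rewrite le_eqVlt; apply/orP; left; apply/eqP; ring.
Qed.

(** Schur's test for the Hilbert matrix with weights (j+1)^(-1/2). The sum is cut at j = i+1, and
    each half contributes at most 2. *)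
Lemma schur_row (i N : nat) :
  \sum_(j < N) (Num.sqrt i.+1%:R / Num.sqrt j.+1%:R / (i + j).+1%:R) <= 4 :> R.
Proof.
set c := Num.sqrt i.+1%:R; have c0 : 0 < c by rewrite sqrtr_gt0 ltr0n.
have cc : c ^+ 2 = i.+1%:R by rewrite sqr_sqrtr.
(* Below the diagonal 1/(i+j+1) is replaced by 1/(i+1), and the sum of (j+1)^(-1/2) telescopes. *)
have h1 n : (n <= i.+1)%N -> \sum_(j < n) (c / Num.sqrt j.+1%:R / (i + j).+1%:R) <=
    2 * Num.sqrt n%:R / c.
  elim: n => [|n IH] hn; first by rewrite big_ord0 sqrtr0 mulr0 mul0r.
  rewrite big_ord_recr /=; have := IH (ltnW hn); have := sqrtS_sub n.
  set a := Num.sqrt n%:R; set b := Num.sqrt n.+1%:R; set s := \sum_(_ < _) _ => hab hs.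
  have b0 : 0 < b by rewrite sqrtr_gt0 ltr0n.
  have : c / b / (i + n).+1%:R <= b^-1 / c.
    rewrite ler_pdivrMr ?ltr0n // (_ : b^-1 / c * _ = (i + n).+1%:R / c / b); last first.
      by field; rewrite !gt_eqF.
    by rewrite ler_pM2r ?invr_gt0 // ler_pdivlMr // -expr2 cc ler_nat ltnS leq_addr.
  have : b^-1 / c <= 2 * (b - a) / c by rewrite ler_wpM2r ?invr_ge0 // ltW.
  have -> : 2 * (b - a) / c = 2 * b / c - 2 * a / c by ring.
  by move=> l1 l2; have := lerD hs (le_trans l2 l1); rewrite [X in _ <= X]addrC subrK.
have [Ni|iN] := leqP N i.+1.
  apply: le_trans (h1 _ Ni) _; rewrite ler_pdivrMr //.
  have : Num.sqrt N%:R <= c by rewrite ler_wsqrtr // ler_nat.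
  by nra.
(* Above the diagonal 1/(i+j+1) is replaced by 1/(j+1). The subtracted term is the part of the
   telescoping bound not yet consumed; at m = 0 the right side is exactly the 2 given by [h1]. *)
suff h2 m : \sum_(j < i.+1 + m) (c / Num.sqrt j.+1%:R / (i + j).+1%:R) <=
    4 - 2 * c / Num.sqrt (i.+1 + m)%:R.
  have := h2 (N - i.+1)%N; rewrite subnKC ?(ltnW iN) // => h.
  apply: le_trans h _; rewrite gerBl mulr_ge0 ?invr_ge0 ?sqrtr_ge0 //.
  by rewrite mulr_ge0 // ltW.
elim: m => [|m IH].
  rewrite addn0; apply: le_trans (h1 _ (leqnn _)) _.
  rewrite -/c !mulfK ?gt_eqF //; lra.
rewrite addnS big_ord_recr /=; move: IH; set k := (i.+1 + m)%N.
have k0 : (0 < k)%N by rewrite /k.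
have := sqrt_invS_sub k0.
set a := Num.sqrt k%:R; set b := Num.sqrt k.+1%:R; set s := \sum_(_ < _) _ => hab hs.
have b0 : 0 < b by rewrite sqrtr_gt0 ltr0n.
have : c / b / (i + k).+1%:R <= c * (k.+1%:R * b)^-1.
  rewrite invfM -!mulrA ler_wpM2l ?(ltW c0) // mulrC ler_wpM2r ?invr_ge0 ?(ltW b0) //.
  by rewrite lef_pV2 ?posrE ?ltr0n // ler_nat ltnS leq_addl.
have : c * (k.+1%:R * b)^-1 <= c * (2 * (a^-1 - b^-1)) by rewrite ler_wpM2l // ltW.
have -> : c * (2 * (a^-1 - b^-1)) = 2 * c / a - 2 * c / b by ring.
by move=> l1 l2; have := lerD hs (le_trans l2 l1); rewrite addrA subrK.
Qed.

(** The arithmetic-geometric inequality splits x_i y_j into x_i^2 s_i/s_j and y_j^2 s_j/s_i, each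
    with factor 1/2; [schur_row] sums either one by 4, whence the constant 2. *)
Lemma hilbert_ineq x y N : (forall i, 0 <= x i) -> (forall i, 0 <= y i) ->
  \sum_(i < N) \sum_(j < N) x i * y j / (i + j).+1%:R <=
  2 * (\sum_(i < N) x i ^+ 2 + \sum_(i < N) y i ^+ 2).
Proof.
move=> x0 y0; pose s n : R := Num.sqrt n.+1%:R.
have s0 n : 0 < s n by rewrite sqrtr_gt0 ltr0n.
apply: le_trans (_ : \sum_(i < N) \sum_(j < N)
   (2^-1 * (x i ^+ 2 * (s i / s j / (i + j).+1%:R)) +
    2^-1 * (y j ^+ 2 * (s j / s i / (i + j).+1%:R))) <= _).
  apply: ler_sum => i _; apply: ler_sum => j _.
  rewrite !mulrA -!mulrDl ler_wpM2r ?invr_ge0 ?ler0n //.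
  rewrite -subr_ge0 (_ : _ - _ = (x i * s i - y j * s j) ^+ 2 / (2 * s i * s j)).
    by rewrite divr_ge0 ?sqr_ge0 // !mulr_ge0 // ltW.
  by field; rewrite !gt_eqF.
under eq_bigr do rewrite big_split /=.
rewrite big_split /= mulrDr lerD //.
  rewrite mulr_sumr; apply: ler_sum => i _; rewrite -!mulr_sumr.
  have := schur_row i N; have := sqr_ge0 (x i); rewrite -/(s i) => ? ?; nra.
rewrite exchange_big /= mulr_sumr; apply: ler_sum => j _; rewrite -!mulr_sumr.
have -> : \sum_(i < N) (s j / s i / (i + j).+1%:R) =
    \sum_(i < N) (s j / s i / (j + i).+1%:R).
  by apply: eq_bigr => i _; rewrite addnC.
have := schur_row j N; have := sqr_ge0 (y j); rewrite -/(s j) => ? ?; nra.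
Qed.

End hilbert.

(** * Polynomial square roots of 1 - X on the closed disc *)

Section sqrt_poly.
Variable R : realType.

(* [sqrt_iter n] increases coefficientwise to [1 - sqrt (1 - X)], whence
   polynomial squares approximating [1 - X] uniformly on the closed disc. *)
Fixpoint sqrt_iter (n : nat) : {poly R} :=
  if n is n'.+1 then 2^-1 *: ('X + sqrt_iter n' ^+ 2) else 0.

Definition nneg_coef (p : {poly R}) := forall i, 0 <= p`_i.

Lemma nneg_coefD p q : nneg_coef p -> nneg_coef q -> nneg_coef (p + q).
Proof. by move=> hp hq i; rewrite coefD addr_ge0. Qed.

Lemma nneg_coefM p q : nneg_coef p -> nneg_coef q -> nneg_coef (p * q).
Proof. by move=> hp hq i; rewrite coefM sumr_ge0 // => j _; rewrite mulr_ge0. Qed.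

Lemma nneg_coef_half p : nneg_coef p -> nneg_coef (2^-1 *: p).
Proof. by move=> hp i; rewrite coefZ mulr_ge0 ?invr_ge0. Qed.

Lemma sqrt_iter_nneg n : nneg_coef (sqrt_iter n).
Proof.
elim: n => [|n IH]; first by move=> i; rewrite coef0.
apply: nneg_coef_half; apply: nneg_coefD; first by move=> i; rewrite coefX ler0n.
by rewrite expr2; exact: nneg_coefM.
Qed.

(** The next increment is half the product of the current increment and a sum of iterates, both with
    nonnegative coefficients. *)
Lemma sqrt_iter_incr n : nneg_coef (sqrt_iter n.+1 - sqrt_iter n).
Proof.
elim: n => [|n IH].
  by rewrite subr0; exact: sqrt_iter_nneg.
rewrite (_ : _ - _ = 2^-1 *: ((sqrt_iter n.+1 - sqrt_iter n) *
    (sqrt_iter n.+1 + sqrt_iter n))).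
  apply: nneg_coef_half; apply: nneg_coefM => //.
  by apply: nneg_coefD; exact: sqrt_iter_nneg.
by rewrite -subr_sqr [LHS]/= -scalerBr opprD addrACA subrr add0r.
Qed.

Lemma nneg_horner1 (p : {poly R}) : nneg_coef p -> 0 <= p.[1].
Proof.
by move=> h; rewrite horner_coef; apply: sumr_ge0 => i _; rewrite expr1n mulr1.
Qed.

Lemma sqrt_iter1_le n : (sqrt_iter n).[1] <= 1.
Proof.
elim: n => [|n IH] /=; first by rewrite horner0.
rewrite hornerZ hornerD hornerX horner_exp.
have := nneg_horner1 (sqrt_iter_nneg n); nra.
Qed.

(** The values at 1 start at 0 and stay below 1, so the increments cannot all exceed [e]. One small
    increment suffices, since the residual of the approximate square root is twice an increment. *)
Lemma sqrt_iter_gap (e : R) : 0 < e ->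
  exists n, (sqrt_iter n.+1).[1] - (sqrt_iter n).[1] <= e.
Proof.
move=> e0; apply/not_existsP => h.
have h' n : n%:R * e <= (sqrt_iter n).[1].
  elim: n => [|n IH]; first by rewrite mul0r horner0.
  have /negP := h n; rewrite -ltNge; rewrite -natr1 mulrDl mul1r; lra.
have [n hn] : exists n : nat, 1 < n%:R * e.
  exists (Num.bound e^-1); rewrite -ltr_pdivrMr // mul1r.
  by apply: archi_boundP; rewrite invr_ge0 ltW.
have := h' n; have := sqrt_iter1_le n; lra.
Qed.

(** Nonnegative coefficients make the value at 1 dominate the whole closed disc, which turns control
    at one point into uniform control. *)
Lemma normc_map_nneg (p : {poly R}) (w : R[i]) : nneg_coef p ->
  normc w <= 1 -> normc (map_poly (real_complex R) p).[w] <= p.[1].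
Proof.
move=> h w1; rewrite [leRHS]horner_coef horner_coef size_map_poly.
apply: le_trans (ler_normc_sum _ _ _) _; apply: ler_sum => i _.
rewrite coef_map /= normcM normcX normc_real expr1n mulr1.
by rewrite ger0_norm // ler_piMr // exprn_ile1 ?normc_ge0.
Qed.

Lemma sqrt_poly_approx (e : R) : 0 < e -> exists s : {poly R[i]},
  forall w, normc w <= 1 -> normc (s.[w] ^+ 2 - (1 - w)) <= e.
Proof.
move=> e0; have e20 : 0 < e / 2 by rewrite divr_gt0.
have [n hn] := sqrt_iter_gap e20.
pose c := map_poly (real_complex R).
exists (1 - c (sqrt_iter n)) => w w1.
have E : (c (sqrt_iter n.+1)).[w] *+ 2 = w + (c (sqrt_iter n)).[w] ^+ 2.
  rewrite /c /= map_polyZ rmorphD rmorphXn /= map_polyX hornerZ hornerD hornerX horner_exp.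
  rewrite -mulrnAl -rmorphMn /= -mulr_natr mulVf ?pnatr_eq0 //.
  by rewrite (_ : 1%:C = 1) // mul1r.
rewrite hornerD hornerN hornerC.
(* With q_n the iterate and s = 1 - q_n, the residual s^2 - (1 - w) is w + q_n^2 - 2 q_n, that is 2
   (q_(n+1) - q_n). *)
rewrite (_ : _ - _ = (c (sqrt_iter n.+1 - sqrt_iter n)).[w] *+ 2); last first.
  by rewrite /c rmorphB hornerD hornerN mulrnBl -/c E; ring.
rewrite normcMn -mulr_natr.
have := normc_map_nneg (sqrt_iter_incr n) w1; rewrite -/c hornerD hornerN; lra.
Qed.

End sqrt_poly.

(** * Approximate factorization of polynomials on the unit circle *)

Section factorization.
Variable R : realType.
Implicit Types f g h : {poly R[i]}.

(** An approximate form of the Riesz factorization f = g h with |g|^2 = |h|^2 = |f| on the circle.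
    Upper bounds on |g| and |h| are enough for Hardy's inequality. *)
Definition circle_factor f (e : R) g h := forall z, normc z = 1 ->
  [/\ normc (f.[z] - g.[z] * h.[z]) <= e,
      normc g.[z] ^+ 2 <= normc f.[z] + e &
      normc h.[z] ^+ 2 <= normc f.[z] + e].

Definition circle_factorable f := forall e : R, 0 < e -> exists g h, circle_factor f e g h.

Lemma circle_factorable_const c : circle_factorable c%:P.
Proof.
move=> e e0; exists (sqrtc c)%:P, (sqrtc c)%:P => z _; rewrite !hornerC.
rewrite -expr2 -normcX sqr_sqrtc subrr normc0 lerDl; split => //; exact: ltW.
Qed.

Lemma circle_factorableM f1 f2 : circle_factorable f1 -> circle_factorable f2 ->
  circle_factorable (f1 * f2).
Proof.
move=> h1 h2 e e0; set M1 := coef_norm f1; set M2 := coef_norm f2.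
have M10 : 0 <= M1 by exact: coef_norm_ge0.
have M20 : 0 <= M2 by exact: coef_norm_ge0.
(* Both the product error and the excess of the squares are at most d (M1 + M2 + d), and d <= 1
   bounds this by d (M1 + M2 + 1). *)
pose d := Num.min 1 (e / (M1 + M2 + 1)).
have M0 : 0 < M1 + M2 + 1 by lra.
have d0 : 0 < d by rewrite lt_min ltr01 divr_gt0.
have d1 : d <= 1 by rewrite ge_min lexx.
have de : d * (M1 + M2 + 1) <= e by rewrite -ler_pdivlMr // ge_min lexx orbT.
have [g1 [k1 H1]] := h1 d d0; have [g2 [k2 H2]] := h2 d d0.
exists (g1 * g2), (k1 * k2) => z z1; rewrite !hornerM.
have [A1 A2 A3] := H1 z z1; have [B1 B2 B3] := H2 z z1.
have F1 : normc f1.[z] <= M1 by apply: horner_le_coef_norm; rewrite z1.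
have F2 : normc f2.[z] <= M2 by apply: horner_le_coef_norm; rewrite z1.
have P u1 v1 u2 v2 : 0 <= u1 -> 0 <= u2 -> u1 <= v1 + d -> u2 <= v2 + d ->
    0 <= v1 -> 0 <= v2 -> v1 <= M1 -> v2 <= M2 -> u1 * u2 <= v1 * v2 + e.
  move=> u10 u20 uv1 uv2 v10 v20 vM1 vM2.
  apply: le_trans (_ : (v1 + d) * (v2 + d) <= _); first by rewrite ler_pM.
  have : d * (v1 + v2 + d) <= d * (M1 + M2 + 1).
    by rewrite ler_wpM2l ?(ltW d0) //; lra.
  rewrite -subr_ge0 => ?; rewrite -subr_ge0; nra.
split; last 2 first.
- by rewrite !normcM exprMn; apply: P; rewrite ?sqr_ge0 ?normc_ge0.
- by rewrite !normcM exprMn; apply: P; rewrite ?sqr_ge0 ?normc_ge0.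
have G2 : normc (g2.[z] * k2.[z]) <= M2 + d.
  rewrite (_ : _ * _ = f2.[z] - (f2.[z] - g2.[z] * k2.[z])); last by ring.
  by apply: le_trans (le_normcD _ _) _; rewrite normcN lerD.
rewrite (_ : _ - _ = f1.[z] * (f2.[z] - g2.[z] * k2.[z]) +
   g2.[z] * k2.[z] * (f1.[z] - g1.[z] * k1.[z])); last by ring.
apply: le_trans (le_normcD _ _) _; rewrite (normcM f1.[z]) (normcM (g2.[z] * k2.[z])).
apply: le_trans (_ : M1 * d + (M2 + d) * d <= _).
  by rewrite lerD // ler_pM ?normc_ge0.
apply: le_trans de; rewrite -subr_ge0 (_ : _ - _ = d * (1 - d)); last by ring.
by rewrite mulr_ge0 ?subr_ge0 // ltW.
Qed.

Lemma circle_factorable_prod I (s : seq I) (F : I -> {poly R[i]}) :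
  (forall i, circle_factorable (F i)) -> circle_factorable (\prod_(i <- s) F i).
Proof.
move=> hF; elim: s => [|i s IH]; first by rewrite big_nil; exact: circle_factorable_const.
by rewrite big_cons; exact: circle_factorableM.
Qed.

Lemma sqrt_linear_approx (b : R[i]) (e : R) : normc b <= 1 -> 0 < e ->
  exists s : {poly R[i]}, forall z, normc z = 1 -> normc (s.[z] ^+ 2 - (1 - b * z)) <= e.
Proof.
move=> b1 e0; have [s hs] := sqrt_poly_approx e0.
exists (s \Po (b *: 'X)) => z z1; rewrite horner_comp hornerZ hornerX; apply: hs.
by rewrite normcM z1 mulr1.
Qed.

(** A linear factor without zeros in the open disc: both factors are the same approximate square
    root, as [b * z] stays in the closed disc. *)
Lemma circle_factorable_outer (b : R[i]) : normc b <= 1 -> circle_factorable (1 - b *: 'X).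
Proof.
move=> b1 e e0; have [s hs] := sqrt_linear_approx b1 e0.
exists s, s => z /hs; rewrite hornerD hornerN hornerC hornerZ hornerX -expr2 => h.
have h' : normc s.[z] ^+ 2 <= normc (1 - b * z) + e.
  rewrite -normcX -[s.[z] ^+ 2](subrK (1 - b * z)) addrC.
  by apply: le_trans (le_normcD _ _) _; rewrite lerD.
by split => //; rewrite normcB.
Qed.

(* On the circle [|z - a| = |1 - a^* z|], so [z - a] is the square of
   [sqrt (1 - a^* z)] times a Blaschke factor; the latter is truncated to a
   polynomial. *)
Lemma circle_factorable_inner (a : R[i]) : normc a < 1 -> circle_factorable ('X - a%:P).
Proof.
(* The largest error is in the last bound: for |f| <= 2 and d <= 1, (|f| + d) (1 + d)^2 exceeds |f|
   by at most 10 d. *)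
move=> a1 e e0; pose d := Num.min 1 (e / 13).
have d0 : 0 < d by rewrite lt_min ltr01 divr_gt0.
have d1 : d <= 1 by rewrite ge_min lexx.
have de : d * 13 <= e by rewrite -ler_pdivlMr // ge_min lexx orbT.
have b1 : normc a^* <= 1 by rewrite normc_conj ltW.
have [s hs] := sqrt_linear_approx b1 d0.
have [J hJ] : exists J, normc a ^+ J <= d.
  have /cvgrPdist_le/(_ d d0) [J _ /(_ J (leqnn J))] : (fun n => normc a ^+ n) @ \oo --> (0 : R).
    by apply: cvg_expr; rewrite ger0_norm ?normc_ge0.
  rewrite /= sub0r normrN ger0_norm ?exprn_ge0 ?normc_ge0 // => ?.
  by exists J.
(* [p] truncates the geometric series of 1 / (1 - a^* z), so ('X - a) p approximates the Blaschke
   factor; multiplying it by s^2, close to 1 - a^* z, gives back z - a. *)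
pose p : {poly R[i]} := \sum_(j < J) (a^* *: 'X) ^+ j.
exists s, (s * ('X - a%:P) * p) => z z1.
have pz : (1 - a^* * z) * p.[z] = 1 - (a^* * z) ^+ J.
  rewrite /p horner_sum; under eq_bigr do rewrite horner_exp hornerZ hornerX.
  have := subrXX 1 (a^* * z) J; rewrite expr1n => ->; congr (_ * _).
  by apply: eq_bigr => j _; rewrite expr1n mul1r.
rewrite !hornerM hornerD hornerN hornerC hornerX.
set F := 1 - a^* * z in pz *; set f := z - a; set P := p.[z]; set S := s.[z].
have nfF : normc f = normc F.
  have -> : F = z * (f)^*.
    have : (z)^* * z = 1.
      apply/eqP; rewrite eq_complex /=; move: z1; case: (z) => u v /= h.
      have h2 : u ^+ 2 + v ^+ 2 = 1.
        by rewrite -[LHS]sqr_sqrtr ?h ?expr1n // addr_ge0 // sqr_ge0.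
      by apply/andP; split; apply/eqP; [rewrite -h2|]; ring.
    by move=> zz; rewrite /f rmorphB mulrBr [z * (z)^*]mulrC zz mulrC.
  by rewrite normcM z1 mul1r normc_conj.
have aJ : normc ((a^* * z) ^+ J) <= d by rewrite normcX normcM z1 mulr1 normc_conj.
have nfP : normc (f * P) <= 1 + d.
  rewrite normcM nfF -normcM pz; apply: le_trans (le_normcD _ _) _.
  by rewrite normcN normc1 lerD.
have f2 : normc f <= 2.
  by apply: le_trans (le_normcD _ _) _; rewrite normcN z1; lra.
have f0 := normc_ge0 f.
have hS : normc (S ^+ 2 - F) <= d := hs z z1.
have S2 : normc S ^+ 2 <= normc f + d.
  rewrite -normcX -[S ^+ 2](subrK F) addrC nfF.
  by apply: le_trans (le_normcD _ _) _; rewrite lerD.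
split.
- rewrite (_ : _ - _ = f * (a^* * z) ^+ J - (f * P) * (S ^+ 2 - F)); last first.
    transitivity (f * (1 - F * P) - f * P * (S ^+ 2 - F)); first by ring.
    by rewrite pz; congr (_ * _ - _); ring.
  apply: le_trans (le_normcD _ _) _; rewrite normcN (normcM f) (normcM (f * P)).
  apply: le_trans (_ : 2 * d + 2 * d <= _); last by lra.
  by rewrite lerD // ler_pM ?normc_ge0 //; lra.
- by lra.
rewrite -mulrA normcM exprMn.
apply: le_trans (_ : (normc f + d) * (1 + d) ^+ 2 <= _).
  by rewrite ler_pM ?sqr_ge0 // lerXn2r ?nnegrE ?normc_ge0 //; lra.
apply: le_trans (_ : normc f + d * 13 <= _); last by lra.
have : 0 <= d * (1 - d) by rewrite mulr_ge0 ?subr_ge0 // ltW.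
have : 0 <= (2 - normc f) * d by rewrite mulr_ge0 ?subr_ge0 // ltW.
by nra.
Qed.

(** The polynomial splits into linear factors over [R[i]]. A root of modulus at least 1 is handled
    as z - a = -a (1 - z/a), any other by [circle_factorable_inner]. *)
Lemma circle_factorable_poly f : circle_factorable f.
Proof.
have [r ->] := closed_field_poly_normal f.
rewrite -mul_polyC; apply: circle_factorableM; first exact: circle_factorable_const.
apply: circle_factorable_prod => a; have [a1|a1] := ltrP (normc a) 1.
  exact: circle_factorable_inner.
have a0 : a != 0 by apply: contraTneq a1 => ->; rewrite normc0 ler10.
rewrite (_ : 'X - a%:P = (- a)%:P * (1 - a^-1 *: 'X)).
  apply: circle_factorableM; first exact: circle_factorable_const.
  by apply: circle_factorable_outer; rewrite normcV invf_le1 // (lt_le_trans _ a1).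
rewrite mulrBr mulr1 mul_polyC scalerA mulNr divff // scaleN1r opprK addrC.
by rewrite polyCN.
Qed.

End factorization.

(** * From the factorization to Hardy's inequality *)

Section hardy.
Variable R : realType.
Local Notation mu := (@lebesgue_measure R).
Local Notation circ := (`[0%R, (2 * pi)%R]%classic : set R).
Implicit Types f g h : {poly R[i]}.

Lemma integral_circ_cst (c : R) : \int[mu]_(t in circ) c = c * (2 * pi).
Proof.
rewrite Rintegral_cst //; congr (_ * _).
by rewrite -[RHS]/(fine (2 * pi)%:E) -lebesgue_circ.
Qed.

Lemma integrable_circ_cst (c : R) : mu.-integrable circ (EFin \o (fun=> c)).
Proof. by apply: (@bounded_integrable_circ _ _ `|c|) => //; exact: measurable_cst. Qed.

Lemma bessel_poly f N :
  2 * pi * \sum_(i < N) normc f`_i ^+ 2 <= \int[mu]_(t in circ) (normc f.[cis t] ^+ 2).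
Proof.
rewrite (parseval_poly (leq_maxr N (size f))).
rewrite ler_wpM2l ?mulr_ge0 ?pi_ge0 //.
rewrite -!(big_mkord xpredT (fun i => normc f`_i ^+ 2)).
rewrite [leRHS](big_cat_nat (n := N)) ?leq_maxl //= lerDl.
by apply: sumr_ge0 => i _; rewrite exprn_ge0 ?normc_ge0.
Qed.

(** Bessel's inequality with a single term kept. It transfers the uniform error of the factorization
    to the coefficients. *)
Lemma coef_le_sup f (e : R) i : 0 <= e -> (forall z, normc z = 1 -> normc f.[z] <= e) ->
  normc f`_i <= e.
Proof.
move=> e0 hf; have pi0 : 0 < 2 * pi :> R by rewrite mulr_gt0 ?pi_gt0.
rewrite -(@ler_pXn2r _ 2) ?nnegrE ?normc_ge0 // -(ler_pM2l pi0).
have := bessel_poly f i.+1; rewrite big_ord_recr /= mulrDr => h.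
apply: le_trans (_ : 2 * pi * normc f`_i ^+ 2 <= _) _ => //.
have : 0 <= 2 * pi * \sum_(j < i) normc f`_j ^+ 2.
  by rewrite mulr_ge0 ?(ltW pi0) // sumr_ge0 // => j _; rewrite exprn_ge0 ?normc_ge0.
have : \int[mu]_(t in circ) (normc f.[cis t] ^+ 2) <= e ^+ 2 * (2 * pi).
  rewrite -integral_circ_cst; apply: le_Rintegral => //.
  - exact: integrable_normc_horner.
  - exact: integrable_circ_cst.
  by move=> t _; rewrite lerXn2r ?nnegrE ?normc_ge0 // hf // normc_cis.
by move=> h1 h2; have h3 := le_trans h h1; lra.
Qed.

(** Substituting j = k - i in the Cauchy product turns 1/(k+1) into 1/(i+j+1), and the triangle i +
    j < N is enlarged to the square of Hilbert's inequality. *)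
Lemma coefM_hardy g h N : \sum_(k < N) normc (g * h)`_k / k.+1%:R <=
  2 * (\sum_(i < N) normc g`_i ^+ 2 + \sum_(i < N) normc h`_i ^+ 2).
Proof.
apply: le_trans (@hilbert_ineq _ (fun i => normc g`_i) (fun i => normc h`_i) N _ _);
  [|by move=> i; exact: normc_ge0..].
apply: le_trans (_ : \sum_(k < N) \sum_(i < N | (i <= k)%N)
   normc g`_i * normc h`_(k - i) / k.+1%:R <= _).
  apply: ler_sum => k _; rewrite coefM -mulr_suml ler_wpM2r ?invr_ge0 ?ler0n //.
  apply: le_trans (ler_normc_sum _ _ _) _; under eq_bigr do rewrite normcM.
  rewrite -(big_mkord xpredT (fun i => normc g`_i * normc h`_(k - i))).
  by rewrite (big_nat_widen _ _ N) ?ltn_ord //= big_mkord.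
rewrite (exchange_big_dep xpredT) //=; apply: ler_sum => i _.
rewrite -(big_mkord (fun k => i <= k)%N (fun k => normc g`_i * normc h`_(k - i) / k.+1%:R)).
rewrite -(big_mkord xpredT (fun j => normc g`_i * normc h`_j / (i + j).+1%:R)).
have iN : (i <= N)%N by rewrite ltnW.
rewrite (big_cat_nat (n := i)) //= [X in X + _]big_nat_cond [X in X + _]big1 ?add0r; last first.
  by move=> k /andP[/andP[_ ki] ik]; move: (leq_ltn_trans ik ki); rewrite ltnn.
rewrite -{1}[nat_of_ord i]add0n big_addn.
rewrite [leRHS](big_cat_nat (n := N - i)%N) ?leq_subr //=.
apply: le_trans (_ : \sum_(0 <= j < N - i) normc g`_i * normc h`_j / (i + j).+1%:R <= _).
  rewrite [leRHS]big_nat_cond big_nat_cond [leLHS]big_mkcond [leRHS]big_mkcond /=.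
  apply: ler_sum => j _; case: ifP => [/andP[hj _]|_].
    by rewrite hj addnK addnC.
  by case: ifP => // _; rewrite divr_ge0 ?mulr_ge0 ?normc_ge0.
by rewrite lerDl sumr_ge0 // => j _; rewrite divr_ge0 ?mulr_ge0 ?normc_ge0.
Qed.

Lemma hardy_poly f N :
  2 * pi * \sum_(k < N) normc f`_k / k.+1%:R <= 4 * \int[mu]_(t in circ) normc f.[cis t].
Proof.
have pi0 : 0 < 2 * pi :> R by rewrite mulr_gt0 ?pi_gt0.
set I := \int[mu]_(t in circ) _.
(* The error 4 + N splits as N from the N perturbed coefficients and 4 = 2 (1 + 1) from the excess
   of |g|^2 and |h|^2; the factor 4 of the main term has the latter origin too. As N is fixed, e
   tends to 0. *)
have H e : 0 < e -> 2 * pi * \sum_(k < N) normc f`_k / k.+1%:R <=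
    4 * I + e * (2 * pi * (4 + N%:R)).
  move=> e0; have [g [h gh]] := circle_factorable_poly f e0.
  have cf k : normc (f - g * h)`_k <= e.
    apply: coef_le_sup => [|z /gh[]]; first exact: ltW.
    by rewrite hornerD hornerN hornerM.
  have G p : (forall z, normc z = 1 -> normc p.[z] ^+ 2 <= normc f.[z] + e) ->
      2 * pi * \sum_(i < N) normc p`_i ^+ 2 <= I + e * (2 * pi).
    move=> hp; apply: le_trans (bessel_poly p N) _.
    have i1 : mu.-integrable circ (EFin \o (fun t => normc f.[cis t])).
      exact: (integrable_normc_horner f 1).
    rewrite -integral_circ_cst -RintegralD //; last exact: integrable_circ_cst.
    apply: le_Rintegral => //.
    - exact: integrable_normc_horner.
    - by apply: (integrableD _ i1 (integrable_circ_cst e)).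
    by move=> t _; apply: hp; rewrite normc_cis.
  have Gg : 2 * pi * \sum_(i < N) normc g`_i ^+ 2 <= I + e * (2 * pi).
    by apply: G => z /gh[].
  have Gh : 2 * pi * \sum_(i < N) normc h`_i ^+ 2 <= I + e * (2 * pi).
    by apply: G => z /gh[].
  have S1 : \sum_(k < N) normc f`_k / k.+1%:R <=
      N%:R * e + \sum_(k < N) normc (g * h)`_k / k.+1%:R.
    have -> : N%:R * e = \sum_(k < N) e by rewrite sumr_const card_ord mulr_natl.
    rewrite -big_split /=; apply: ler_sum => k _.
    have k1 : 1 <= k.+1%:R :> R by rewrite ler1n.
    rewrite ler_pdivrMr ?ltr0n // mulrDl divfK ?pnatr_eq0 //.
    have -> : f`_k = (f - g * h)`_k + (g * h)`_k by rewrite -coefD subrK.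
    apply: le_trans (le_normcD _ _) _.
    by rewrite lerD2r; apply: le_trans (cf k) _; rewrite ler_peMr // ltW.
  have := ler_wpM2l (ltW pi0) S1.
  have := ler_wpM2l (ltW pi0) (coefM_hardy g h N).
  by lra.
apply/ler_addgt0Pr => e e0.
have K0 : 0 < 2 * pi * (4 + N%:R) :> R by rewrite mulr_gt0 // ltr_pwDl.
by have := H _ (divr_gt0 e0 K0); rewrite divfK ?gt_eqF.
Qed.

End hardy.

(** * Hardy's inequality in H^1 *)

Section hardy_series.
Variable R : realType.
Local Notation mu := (@lebesgue_measure R).
Local Notation circ := (`[0%R, (2 * pi)%R]%classic : set R).

Lemma power_series_tail (u : nat -> R[i]) (z l : R[i]) n :
  cvgn (series (fun k => normc (u k))) -> normc z <= 1 ->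
  power_series u z @ \oo --> l ->
  normc (l - power_series u z n) <=
    limn (series (fun k => normc (u k))) - series (fun k => normc (u k)) n.
Proof.
move=> cu z1 hl.
have h : (fun N => power_series u z N - power_series u z n) @ \oo --> l - power_series u z n.
  by apply: cvgB; [exact: hl|exact: cvg_cst].
apply: normc_lim_le h _; exists n => // N /= nN.
apply: le_trans (_ : series (fun k => normc (u k)) N - series (fun k => normc (u k)) n <= _).
  rewrite /power_series !sub_series_geq //.
  apply: le_trans (ler_normc_sum _ _ _) _; apply: ler_sum => k _.
  by rewrite normcM normcX ler_piMr ?normc_ge0 // exprn_ile1 ?normc_ge0.
by rewrite lerD2r; apply: series_le_lim => // k; exact: normc_ge0.
Qed.

(** Truncation at some n >= K leaves the first K coefficients intact and changes the boundary
    function by at most [d] uniformly; [d] is chosen so that four times its integral over the circle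
    is [e]. *)
Lemma hardy_abs_series (u : nat -> R[i]) (F : R -> R[i]) K :
  cvgn (series (fun k => normc (u k))) ->
  (forall t, power_series u (cis t) @ \oo --> F t) ->
  ((2 * pi * \sum_(k < K) normc (u k) / k.+1%:R)%:E <=
    4%:E * \int[mu]_(t in circ) (normc (F t))%:E)%E.
Proof.
move=> cu hF; set L := limn (series (fun k => normc (u k))).
have pi0 : 0 < 2 * pi :> R by rewrite mulr_gt0 ?pi_gt0.
have tail t n : normc (F t - power_series u (cis t) n) <= L - series (fun k => normc (u k)) n.
  by apply: power_series_tail => //; rewrite normc_cis.
have mF : measurable_fun [set: R] (fun t => normc (F t)).
  apply: measurable_normc.
  apply: (@cmeasurable_cvg _ _ _ _ (fun n t => power_series u (cis t) n)) => [n|t _]; last exact: hF.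
  apply: cmeasurable_sum => k; apply: cmeasurableM; first exact: cmeasurable_cst.
  by apply: cmeasurableX; exact: cmeasurable_cis.
have FL t : normc (F t) <= L.
  by have := tail t 0%N; rewrite /power_series /series /= !big_nil !subr0.
have iF : mu.-integrable circ (EFin \o (fun t => normc (F t))).
  by apply: (@bounded_integrable_circ _ _ L) => // t; rewrite ger0_norm ?normc_ge0.
rewrite -[X in (_ <= _ * X)%E]fineK; last exact: (integrable_fin_num _ iF).
rewrite -EFinM lee_fin -/(Rintegral _ _ _).
apply/ler_addgt0Pr => e e0; pose d := e / (4 * (2 * pi)).
have d0 : 0 < d by rewrite divr_gt0 // mulr_gt0.
have [n [Kn hn]] : exists n, (K <= n)%N /\ L - series (fun k => normc (u k)) n <= d.
  move/cvgrPdist_le : (cu) => /(_ d d0) [n _ hn].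
  exists (maxn K n); split; first exact: leq_maxl.
  by apply: le_trans (hn _ (leq_maxr K n)); exact: ler_norm.
pose p := \poly_(k < n) u k.
have pE t : p.[cis t] = power_series u (cis t) n.
  by rewrite horner_poly /power_series /series /= big_mkord.
have ip : mu.-integrable circ (EFin \o (fun t => normc p.[cis t])).
  exact: (integrable_normc_horner p 1).
have -> : \sum_(k < K) normc (u k) / k.+1%:R = \sum_(k < K) normc p`_k / k.+1%:R.
  by apply: eq_bigr => k _; rewrite coef_poly (leq_trans (ltn_ord k) Kn).
apply: le_trans (hardy_poly p K) _.
have -> : e = 4 * (d * (2 * pi)).
  by rewrite mulrCA /d divfK // gt_eqF // mulr_gt0.
rewrite -mulrDr ler_wpM2l //.
apply: le_trans (_ : \int[mu]_(t in circ) (normc (F t) + d) <= _).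
  apply: le_Rintegral => //.
    by apply: (integrableD _ iF (integrable_circ_cst d)).
  move=> t _; rewrite pE -[X in normc X](subrK (F t)) addrC.
  by apply: le_trans (le_normcD _ _) _; rewrite lerD2l normcB; apply: le_trans (tail t n) hn.
rewrite RintegralD //; last exact: integrable_circ_cst.
by rewrite integral_circ_cst.
Qed.

Lemma expands_scale_cvg (f : R[i] -> R[i]) a (z : R[i]) t : expands f a -> unit_disc z ->
  power_series (fun k => a k * z ^+ k) (cis t) @ \oo --> f (z * cis t).
Proof.
move=> fa zD; have /fa : unit_disc (z * cis t) by rewrite /unit_disc /= normcM normc_cis mulr1.
rewrite (_ : power_series a _ = power_series (fun k => a k * z ^+ k) (cis t)) //.
by apply/funext => n; apply: eq_bigr => k _; rewrite exprMn mulrA.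
Qed.

(** Dilation makes the coefficients absolutely summable. The centre of the rotation orbit is a
    general point [z] rather than a radius because [area_hardy] applies this at every point of the
    disc. *)
Lemma hardy_disc (f : R[i] -> R[i]) a (z : R[i]) K : expands f a -> unit_disc z ->
  ((2 * pi * \sum_(k < K) normc (a k) * normc z ^+ k / k.+1%:R)%:E <=
    4%:E * \int[mu]_(t in circ) (normc (f (z * cis t)))%:E)%E.
Proof.
move=> fa zD.
rewrite (eq_bigr (fun k : 'I_K => normc (a k * z ^+ k) / k.+1%:R)); last first.
  by move=> k _; rewrite normcM normcX.
apply: (@hardy_abs_series (fun k => a k * z ^+ k) (fun t => f (z * cis t))).
  rewrite (_ : (fun _ => _) = fun k => normc (a k) * normc z ^+ k).
    by apply: (expands_abs_expansion fa) => //; exact: normc_ge0.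
  by apply/funext => k; rewrite normcM normcX.
by move=> t; exact: expands_scale_cvg.
Qed.

Lemma circle_meanE (f : R[i] -> R[i]) r :
  circle_mean f r = (((2 * pi)^-1)%:E *
    \int[mu]_(t in circ) (normc (f (r%:C * cis t)))%:E)%E.
Proof.
congr (_ * _)%E; apply: eq_integral => t _; congr (normc (f _))%:E.
by apply/eqP; rewrite eq_complex /= !mul0r subr0 addr0 !eqxx.
Qed.

Lemma poly_le_at1 (p : {poly R}) c : (forall r, 0 < r -> r < 1 -> p.[r] <= c) -> p.[1] <= c.
Proof.
move=> h; have cp : p.[r] @[r --> 1^'-] --> p.[1].
  by apply: cvg_at_left_filter; exact: continuous_horner.
rewrite -(cvg_lim _ cp) //; apply: limr_le; first by apply/cvg_ex; exists p.[1].
near=> r; apply: h; near: r; first exact: nbhs_left_gt.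
exact: nbhs_left_lt.
Unshelve. all: by end_near. Qed.

(** With K fixed the left side at radius r is a polynomial in r, so r may tend to 1 by continuity
    and no boundary values of [f] are needed. *)
Lemma hardy_H1 (f : R[i] -> R[i]) a K : expands f a ->
  ((\sum_(k < K) normc (a k) / k.+1%:R)%:E <= 4%:E * hardy1_norm f)%E.
Proof.
move=> fa; have pi0 : 0 < 2 * pi :> R by rewrite mulr_gt0 ?pi_gt0.
have H r : 0 < r -> r < 1 ->
    ((\sum_(k < K) normc (a k) * r ^+ k / k.+1%:R)%:E <= 4%:E * hardy1_norm f)%E.
  move=> r0 r1; have nr : normc r%:C = r by rewrite normc_real ger0_norm // ltW.
  have zD : unit_disc r%:C by rewrite /unit_disc /= expr0n addr0 sqrtr_sqr ger0_norm // ltW.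
  have := hardy_disc K fa zD; rewrite nr => h.
  apply: le_trans (_ : 4%:E * circle_mean f r <= _)%E; last first.
    by apply: lee_wpmul2l; rewrite ?lee_fin //; apply: ereal_sup_ubound; exists r; rewrite //= in_itv /= r0.
  rewrite circle_meanE muleCA.
  have := lee_wpmul2l (_ : 0%E <= ((2 * pi)^-1)%:E)%E h.
  rewrite lee_fin invr_ge0 (ltW pi0) => /(_ isT).
  by rewrite -EFinM mulKf ?gt_eqF.
have [->|Nfin] := eqVneq (hardy1_norm f) +oo%E; first by rewrite gt0_muley ?leey // lte_fin.
have N0 : (0 <= hardy1_norm f)%E.
  apply: le_trans (_ : circle_mean f 2^-1 <= _)%E.
    rewrite /circle_mean mule_ge0 // ?lee_fin ?invr_ge0 ?(ltW pi0) //.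
    by apply: integral_ge0 => t _; rewrite lee_fin normc_ge0.
  apply: ereal_sup_ubound; exists 2^-1 => //=.
  by rewrite in_itv /= invr_gt0 ltr0n /= invf_lt1 // ltr1n.
have Nf : hardy1_norm f \is a fin_num by rewrite ge0_fin_numE // lt_neqAle Nfin leey.
rewrite -(fineK Nf) -EFinM lee_fin.
pose p := \poly_(k < K) (normc (a k) / k.+1%:R).
have pE r : p.[r] = \sum_(k < K) normc (a k) * r ^+ k / k.+1%:R.
  by rewrite horner_poly; apply: eq_bigr => k _; rewrite mulrAC.
have := @poly_le_at1 p (4 * fine (hardy1_norm f)); rewrite pE.
rewrite (eq_bigr (fun k : 'I_K => normc (a k) / k.+1%:R)); last first.
  by move=> k _; rewrite expr1n mulr1.
apply => r r0 r1; rewrite pE.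
by rewrite -lee_fin EFinM (fineK Nf); exact: H.
Qed.

End hardy_series.

(** * Hardy's inequality in the Dirichlet-type space *)

Section tonelli_on.
Local Open Scope ereal_scope.
Context d1 d2 (T1 : measurableType d1) (T2 : measurableType d2) (R : realType).
Variables (m1 : {sigma_finite_measure set T1 -> \bar R})
  (m2 : {sigma_finite_measure set T2 -> \bar R}).
Variables (D1 : set T1) (D2 : set T2) (f : T1 * T2 -> \bar R).
Hypotheses (mD1 : measurable D1) (mD2 : measurable D2).
Hypothesis mf : measurable_fun (D1 `*` D2) f.
Hypothesis f0 : forall x y, D1 x -> D2 y -> 0 <= f (x, y).

Let g := f \_ (D1 `*` D2).

Let mg : measurable_fun setT g.
Proof. by apply/(measurable_restrictT _ _).1 => //; exact: measurableX. Qed.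

Let g0 z : 0 <= g z.
Proof.
rewrite /g /patch; case: ifPn => // /[!inE] -[D1x D2x].
by case: z D1x D2x => x y; exact: f0.
Qed.

Let gF : (fun x => \int[m2]_y g (x, y)) = (fun x => \int[m2]_(y in D2) f (x, y)) \_ D1.
Proof.
apply/funext => x; rewrite /patch; case: ifPn => xD.
  rewrite [RHS]integral_mkcond; apply: eq_integral => y _.
  rewrite /g /patch; have [yD|yD] := boolP (y \in D2).
    by rewrite mem_set //; split; apply/set_mem.
  by rewrite memNset // => -[_ /= h]; move/negP : yD; apply; exact/mem_set.
rewrite integral0_eq // => y _; rewrite /g /patch memNset // => -[/= h _].
by move/negP : xD; apply; exact/mem_set.
Qed.

Let gG : (fun y => \int[m1]_x g (x, y)) = (fun y => \int[m1]_(x in D1) f (x, y)) \_ D2.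
Proof.
apply/funext => y; rewrite /patch; case: ifPn => yD.
  rewrite [RHS]integral_mkcond; apply: eq_integral => x _.
  rewrite /g /patch; have [xD|xD] := boolP (x \in D1).
    by rewrite mem_set //; split; apply/set_mem.
  by rewrite memNset // => -[/= h _]; move/negP : xD; apply; exact/mem_set.
rewrite integral0_eq // => x _; rewrite /g /patch memNset // => -[_ /= h].
by move/negP : yD; apply; exact/mem_set.
Qed.

Lemma tonelli_on : \int[m1]_(x in D1) \int[m2]_(y in D2) f (x, y) =
  \int[m2]_(y in D2) \int[m1]_(x in D1) f (x, y).
Proof.
by rewrite integral_mkcond -gF [RHS]integral_mkcond -gG; exact: fubini_tonelli.
Qed.

Lemma measurable_tonelli_on : measurable_fun D1 (fun x => \int[m2]_(y in D2) f (x, y)).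
Proof.
apply/(measurable_restrictT _ _) => //; rewrite -gF.
exact: measurable_fun_fubini_tonelli_F.
Qed.

Lemma product_integral_on : \int[m1 \x m2]_(z in D1 `*` D2) f z =
  \int[m1]_(x in D1) \int[m2]_(y in D2) f (x, y).
Proof.
by rewrite integral_mkcond fubini_tonelli1 // [RHS]integral_mkcond -gF.
Qed.

End tonelli_on.

(** * Rotation invariance of area *)

Section rotation.
Variable R : realType.
Local Notation mu := (@lebesgue_measure R).

Lemma measurable_shift (c : R) :
  measurable_fun setT ((fun x => x + c) : measurableTypeR R -> measurableTypeR R).
Proof. by apply: measurable_funD; [exact: measurable_id|exact: measurable_cst]. Qed.

Lemma lebesgue_measure_shift (c : R) (A : set R) : measurable A ->
  pushforward mu ((fun x => x + c) : _ -> measurableTypeR R) A = mu A.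
Proof.
move=> mA; apply/esym/lebesgue_measure_unique => //=.
  exact: measurable_shift.
move=> _ _ [[a b]] _ <-; rewrite /pushforward.
rewrite (_ : _ @^-1` _ = `](a - c), (b - c)]%classic).
  rewrite !lebesgue_measure_itv /= !lte_fin ltrD2r.
  by case: ifP => // _; rewrite -!EFinB; congr EFin; ring.
by apply/seteqP; split => x /=; rewrite !in_itv /= ltrBlDr lerBrDr.
Qed.

Lemma ge0_integral_shift (f : R -> \bar R) (c : R) : measurable_fun setT f ->
  (forall x, (0 <= f x)%E) -> (\int[mu]_x f (x + c)%R = \int[mu]_x f x)%E.
Proof.
move=> mf f0; rewrite (_ : (fun x => f (x + c)) = f \o (fun x => x + c)) //.
rewrite -[X in (\int[_]_(_ in X) _)%E](preimage_setT (fun x : R => x + c)).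
rewrite -(ge0_integral_pushforward (measurable_shift c)) //.
apply: eq_measure_integral; first exact: measurable_shift.
by move=> mshift A mA _; exact: lebesgue_measure_shift.
Qed.

Local Notation mu2 := (mu \x mu)%E.

Lemma measurable_pair1 (f g : R * R -> R) : measurable_fun setT f -> measurable_fun setT g ->
  measurable_fun setT (fun p => (f p, g p) : R * R).
Proof. by move=> mf mg; exact: measurable_fun_pair. Qed.

Definition rot (c s : R) (p : R * R) : R * R := (c * p.1 - s * p.2, s * p.1 + c * p.2).

Definition shear1 (a : R) (p : R * R) : R * R := (p.1 + a * p.2, p.2).
Definition shear2 (a : R) (p : R * R) : R * R := (p.1, p.2 + a * p.1).

Lemma measurable_shear1 a : measurable_fun setT (shear1 a).
Proof.
apply: measurable_pair1 => //; apply: measurable_funD => //.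
by apply: measurable_funM.
Qed.

Lemma measurable_shear2 a : measurable_fun setT (shear2 a).
Proof.
apply: measurable_pair1 => //; apply: measurable_funD => //.
by apply: measurable_funM.
Qed.

Lemma integral_shear1 (F : R * R -> \bar R) a : measurable_fun setT F ->
  (forall p, (0 <= F p)%E) -> (\int[mu2]_p F (shear1 a p) = \int[mu2]_p F p)%E.
Proof.
move=> mF F0; rewrite !fubini_tonelli2 //; last first.
  by apply: measurableT_comp => //; exact: measurable_shear1.
apply: eq_integral => y _; rewrite /fubini_G.
rewrite /shear1 /= (@ge0_integral_shift (fun x => F (x, y)) (a * y)) //.
exact: measurable_fun_pair1.
Qed.

Lemma integral_shear2 (F : R * R -> \bar R) a : measurable_fun setT F ->
  (forall p, (0 <= F p)%E) -> (\int[mu2]_p F (shear2 a p) = \int[mu2]_p F p)%E.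
Proof.
move=> mF F0; rewrite !fubini_tonelli1 //; last first.
  by apply: measurableT_comp => //; exact: measurable_shear2.
apply: eq_integral => x _; rewrite /fubini_F.
rewrite /shear2 /= (@ge0_integral_shift (fun y => F (x, y)) (a * x)) //.
exact: measurable_fun_pair2.
Qed.

Lemma measurable_rot c s : measurable_fun setT (rot c s).
Proof.
apply: measurable_pair1.
  by apply: measurable_funB; apply: measurable_funM.
by apply: measurable_funD; apply: measurable_funM.
Qed.

(* A rotation is a product of three shears, under which the integral is
   invariant by translation invariance in one variable. *)
Lemma integral_rot (F : R * R -> \bar R) c s : c ^+ 2 + s ^+ 2 = 1 ->
  measurable_fun setT F -> (forall p, (0 <= F p)%E) ->
  (\int[mu2]_p F (rot c s p) = \int[mu2]_p F p)%E.
Proof.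
move=> cs mF F0.
have H (G : R * R -> \bar R) c' s' : s' != 0 -> c' ^+ 2 + s' ^+ 2 = 1 ->
    measurable_fun setT G -> (forall p, (0 <= G p)%E) ->
    (\int[mu2]_p G (rot c' s' p) = \int[mu2]_p G p)%E.
  (* For a rotation by theta this is -tan(theta/2), the parameter of the outer two shears; the
     middle shear has parameter sin(theta). *)
  move=> s0 cs' mG G0; pose a := (c' - 1) / s'.
  have as1 : a * s' = c' - 1 by rewrite /a divfK.
  have ac : a * (1 + c') = - s'.
    apply: (mulfI s0); rewrite mulrA [s' * a]mulrC as1.
    have -> : s' * - s' = - s' ^+ 2 by rewrite mulrN expr2.
    by rewrite -[s' ^+ 2](addKr (c' ^+ 2)) cs'; ring.
  have as2 : 1 + a * s' = c' by rewrite as1 addrC subrK.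
  have E p : rot c' s' p = shear1 a (shear2 s' (shear1 a p)).
    case: p => x y; rewrite /rot /shear1 /shear2 /=; congr (_, _).
      have -> : x + a * y + a * (y + s' * (x + a * y)) =
        x * (1 + a * s') + a * y * (1 + (1 + a * s')) by ring.
      rewrite as2; have -> : a * y * (1 + c') = y * (a * (1 + c')) by ring.
      by rewrite ac; ring.
    have -> : y + s' * (x + a * y) = s' * x + y * (1 + a * s') by ring.
    by rewrite as2; ring.
  under eq_integral do rewrite E.
  have m1 : measurable_fun setT (fun p => G (shear1 a p)).
    by apply: measurableT_comp => //; exact: measurable_shear1.
  have m2 : measurable_fun setT (fun p => G (shear1 a (shear2 s' p))).
    by apply: (measurableT_comp m1); exact: measurable_shear2.
  rewrite (@integral_shear1 (fun p => G (shear1 a (shear2 s' p)))) //.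
  by rewrite (@integral_shear2 (fun p => G (shear1 a p))) // integral_shear1.
(* The shear parameter does not exist when s = 0: the rotation is then the identity, or a half turn,
   which is two quarter turns. *)
have [s0|s0] := eqVneq s 0; last exact: H.
have /eqP : c ^+ 2 = 1 by rewrite -cs s0 expr0n addr0.
rewrite sqrf_eq1 => /orP[/eqP c1|/eqP c1].
  by apply: eq_integral => -[x y] _; rewrite /rot c1 s0 /= !mul0r subr0 add0r !mul1r.
have E p : rot c s p = rot 0 1 (rot 0 1 p).
  by case: p => x y; rewrite /rot c1 s0 /=; congr (_, _); ring.
under eq_integral do rewrite E.
have h01 : 0 ^+ 2 + 1 ^+ 2 = 1 :> R by rewrite expr0n expr1n add0r.
rewrite (H (fun p => F (rot 0 1 p))) ?oner_eq0 //; first by rewrite H ?oner_eq0.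
by apply: measurableT_comp => //; exact: measurable_rot.
Qed.

End rotation.

(* The library registers a sigma-finite structure on products of
   sub-probabilities only. *)
Definition lebesgue2 (R : realType) :=
  (@lebesgue_measure R \x @lebesgue_measure R)%E.

HB.instance Definition _ (R : realType) := Measure.on (@lebesgue2 R).

Lemma sigma_finite_lebesgue2 (R : realType) : sigma_finite setT (@lebesgue2 R).
Proof.
pose I n : set R := `[- n%:R, n%:R]%classic.
exists (fun n => I n `*` I n).
  apply/esym; rewrite -subTset => -[x y] _; set m := `|x| + `|y|.
  exists (Num.bound m) => //.
  have hm : m < (Num.bound m)%:R by apply: archi_boundP; rewrite addr_ge0.
  by split; rewrite /I /= in_itv /= -ler_norml; apply: le_trans (ltW hm);
    rewrite /m ?lerDl ?lerDr.
move=> n; split; first by apply: measurableX; exact: measurable_itv.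
rewrite /lebesgue2 product_measure1E; [|exact: measurable_itv..].
have hI : (@lebesgue_measure R (I n) < +oo)%E.
  by rewrite lebesgue_measure_itv /=; case: ifP => _; rewrite ?ltry // -EFinB ltry.
by apply: lte_mul_pinfty => //; rewrite ge0_fin_numE.
Qed.

HB.instance Definition _ (R : realType) :=
  Measure_isSigmaFinite.Build _ _ _ (@lebesgue2 R) (sigma_finite_lebesgue2 R).

(** * From circles to area *)

Section hardy_area.
Variable R : realType.
Local Notation mu := (@lebesgue_measure R).
Local Notation mu2 := (mu \x mu)%E.
Local Notation circ := (`[0%R, (2 * pi)%R]%classic : set R).

Definition toC (p : R * R) : R[i] := p.1 +i* p.2.

Definition disc2 : set (R * R) := [set p | unit_disc (p.1 +i* p.2)].

Lemma cmeasurable_toC : cmeasurable [set: R * R] toC.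
Proof. by split => /=; [exact: measurable_fst|exact: measurable_snd]. Qed.

Lemma measurable_disc2 : measurable disc2.
Proof.
rewrite (_ : disc2 = (fun p => normc (toC p)) @^-1` `]-oo, 1[%classic).
  rewrite -[X in measurable X]setTI.
  by apply: (measurable_normc cmeasurable_toC) => //; exact: measurable_itv.
by apply/seteqP; split => p; rewrite /disc2 /unit_disc /= in_itv.
Qed.

Lemma toC_rot t p : toC (rot (cos t) (sin t) p) = toC p * cis t.
Proof.
case: p => x y; apply/eqP; rewrite eq_complex /=; apply/andP; split; apply/eqP; ring.
Qed.

Lemma FTC_itv (f F : R -> R) (a b : R) : a < b -> continuous f ->
  (forall t : R, is_derive t (1 : R) F (f t)) ->
  (\int[mu]_(t in `[a, b]) (f t)%:E = (F b - F a)%:E)%E.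
Proof.
move=> ab cf dF.
have cF : continuous F.
  move=> t; apply: differentiable_continuous; apply/derivable1_diffP.
  by case: (dF t).
rewrite (@continuous_FTC2 _ f F) //.
- exact: continuous_subspaceT.
- split; [by move=> t _; case: (dF t)| |].
    by apply: cvg_at_right_filter; exact: cF.
  by apply: cvg_at_left_filter; exact: cF.
- by move=> t _; rewrite derive1E; exact: derive_val.
Qed.

Lemma measurable_normc_pow k : measurable_fun disc2 (fun p => (normc (toC p) ^+ k)%:E).
Proof.
apply/measurable_EFinP; apply: measurable_funX; apply: measurable_normc.
by case: cmeasurable_toC => m1 m2; split; exact: measurable_funTS.
Qed.

(** For |z| < 1 and 0 <= y <= 1 one has |z|^k >= |z|^(2k) y, and the latter has primitive (x^2 +
    y^2)^(k+1) / (2 (k+1)) in y. Up to the circle this gives (1 - x^(2k+2)) / (2 (k+1)), and x^2 <=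
    1/4 leaves the factor 3/4. *)
Lemma disc_slice_moment (x : R) k : 0 <= x <= 2^-1 ->
  ((3 / (8 * k.+1%:R))%:E <=
    \int[mu]_y ((fun p => (normc (toC p) ^+ k)%:E) \_ disc2) (x, y))%E.
Proof.
move=> /andP[x0 x1]; have k0 : 0 < k.+1%:R :> R by rewrite ltr0n.
set E := _ \_ disc2; have mE : measurable_fun setT E.
  by apply/(measurable_restrictT _ _).1; [exact: measurable_disc2|exact: measurable_normc_pow].
have E0 p : (0 <= E p)%E.
  by rewrite /E /patch; case: ifP => // _; rewrite lee_fin exprn_ge0 ?normc_ge0.
have x2 : x ^+ 2 <= 4^-1 by nra.
pose b := Num.sqrt (1 - x ^+ 2); have bb : b ^+ 2 = 1 - x ^+ 2 by rewrite sqr_sqrtr //; lra.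
have b0 : 0 < b by rewrite sqrtr_gt0; lra.
pose P : {poly R} := (2 * k.+1%:R)^-1 *: ((x ^+ 2)%:P + 'X^2) ^+ k.+1.
pose F y := P.[y]; pose f y := P^`().[y].
have FE y : F y = (x ^+ 2 + y ^+ 2) ^+ k.+1 / (2 * k.+1%:R).
  by rewrite /F hornerZ horner_exp hornerD hornerC hornerXn mulrC.
have fE y : f y = (x ^+ 2 + y ^+ 2) ^+ k * y.
  rewrite /f derivZ deriv_exp derivD derivC derivXn add0r.
  rewrite hornerZ hornerMn hornerM horner_exp hornerMn hornerD hornerC !hornerXn expr1.
  rewrite /= -(mulr_natl (y *+ 2 * _) k.+1).
  by move: (k.+1%:R) k0 => M M0; field; rewrite gt_eqF.
have dF (y : R) : is_derive y (1 : R) F (f y) by exact: is_derive_poly.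
have cf : continuous f by exact: continuous_horner.
have mf : measurable_fun [set: R] f by exact: continuous_measurable_fun.
apply: le_trans (_ : (\int[mu]_(y in `[0%R, b[) (f y)%:E)%E <= _)%E; last first.
  apply: le_trans (_ : (\int[mu]_(y in `[0%R, b[) E (x, y))%E <= _)%E; last first.
    by apply: ge0_subset_integral => //; exact: measurable_fun_pair2.
  apply: ge0_le_integral => //.
  - move=> y /=; rewrite in_itv /= => /andP[y0 _].
    by rewrite lee_fin fE mulr_ge0 // exprn_ge0 // addr_ge0 // sqr_ge0.
  - by apply/measurable_EFinP; exact: measurable_funTS.
  - by apply: measurable_funTS; exact: measurable_fun_pair2.
  move=> y /=; rewrite in_itv /= => /andP[y0 yb].
  have yb2 : y ^+ 2 < b ^+ 2 by rewrite ltrXn2r // nnegrE // ltW.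
  have n2 : normc (toC (x, y)) ^+ 2 = x ^+ 2 + y ^+ 2 by rewrite normc_sqr.
  have n1 : normc (toC (x, y)) < 1.
    by rewrite -(@ltr_pXn2r _ 2) ?nnegrE ?normc_ge0 // n2 expr1n; lra.
  rewrite /E /patch mem_set // lee_fin fE -n2 -exprM.
  have y1 : y <= 1 by rewrite -(@ler_pXn2r _ 2) ?nnegrE // expr1n; nra.
  rewrite -[leRHS]mulr1 ler_pM ?exprn_ge0 ?normc_ge0 //.
  apply: ler_wiXn2l; [exact: normc_ge0|exact: ltW|].
  by rewrite leq_pmull.
rewrite integral_itv_bndo_bndc; last by apply/measurable_EFinP; exact: measurable_funTS.
rewrite (FTC_itv b0 cf dF) lee_fin !FE bb addrCA subrr addr0 expr1n expr0n /= addr0 mul1r.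
have : (x ^+ 2) ^+ k.+1 <= 4^-1.
  rewrite exprS; apply: le_trans (_ : x ^+ 2 * 1 <= _); last by rewrite mulr1.
  by rewrite ler_wpM2l ?sqr_ge0 // exprn_ile1 ?sqr_ge0 //; lra.
set q := _ ^+ k.+1 => hq.
rewrite -subr_ge0 (_ : _ - _ = (4^-1 - q) / (2 * k.+1%:R)); last first.
  by field; rewrite gt_eqF.
by rewrite divr_ge0 ?subr_ge0 // mulr_ge0 // ltW.
Qed.

(** Slices over 0 <= x <= 1/2 are enough. This bound stands in for the radial integral of polar
    coordinates and keeps the right order 1/(k+1). *)
Lemma disc_moment k :
  ((3 / (16 * k.+1%:R))%:E <= \int[mu2]_(p in disc2) (normc (toC p) ^+ k)%:E)%E.
Proof.
have k0 : 0 < k.+1%:R :> R by rewrite ltr0n.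
rewrite integral_mkcond; set E := _ \_ disc2; have mE : measurable_fun setT E.
  by apply/(measurable_restrictT _ _).1; [exact: measurable_disc2|exact: measurable_normc_pow].
have E0 p : (0 <= E p)%E.
  by rewrite /E /patch; case: ifP => // _; rewrite lee_fin exprn_ge0 ?normc_ge0.
rewrite fubini_tonelli1 //.
have F0 x : (0 <= fubini_F mu E x)%E by apply: integral_ge0.
have mF : measurable_fun setT (fubini_F mu E) by exact: measurable_fun_fubini_tonelli_F.
apply: le_trans (_ : \int[mu]_(x in `[0%R, (2^-1)%R]) fubini_F mu E x <= _)%E; last first.
  by apply: ge0_subset_integral.
apply: le_trans (_ : \int[mu]_(x in `[0%R, (2^-1)%R]) cst (3 / (8 * k.+1%:R))%:E x <= _)%E; last first.
  apply: ge0_le_integral => //.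
  - by move=> x _; rewrite lee_fin divr_ge0 // mulr_ge0 // ltW.
  - exact: measurable_funTS.
  by move=> x /=; rewrite in_itv /= => hx; exact: disc_slice_moment.
rewrite integral_cst //= lebesgue_measure_itv /= lte_fin invr_gt0 ltr0n.
rewrite -EFinB -EFinM lee_fin subr0 le_eqVlt; apply/orP; left; apply/eqP.
by field; rewrite gt_eqF.
Qed.

(** Averaging over all rotations writes 2 pi times the area integral as an integral over z of the
    circle integrals of |h(z e^(it))|. [hardy_disc] at each z gives one factor 1/(k+1), and
    [disc_moment] gives the second. *)
Lemma area_hardy (h : R[i] -> R[i]) b K : expands h b ->
  ((\sum_(k < K) normc (b k) / k.+1%:R / k.+1%:R)%:E <=
    32%:E * \int[mu2]_(p in disc2) (normc (h (p.1 +i* p.2)))%:E)%E.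
Proof.
move=> hb; have pi0 : 0 < 2 * pi :> R by rewrite mulr_gt0 ?pi_gt0.
rewrite integral_mkcond; set F := _ \_ disc2.
have mF : measurable_fun setT F.
  apply/(measurable_restrictT _ _).1; first exact: measurable_disc2.
  apply/measurable_EFinP; apply: measurable_normc.
  apply: (@cmeasurable_expands _ _ _ _ toC) hb _ _ => //.
  by case: cmeasurable_toC => m1 m2; split; exact: measurable_funTS.
have F0 p : (0 <= F p)%E.
  by rewrite /F /patch; case: ifP => // _; rewrite lee_fin normc_ge0.
set A := (\int[mu2]_p F p)%E; have A0 : (0 <= A)%E by exact: integral_ge0.
pose f (q : R * (R * R)) := F (rot (cos q.1) (sin q.1) q.2).
have mf : measurable_fun setT f.
  apply: measurableT_comp => //.
  have mc : measurable_fun [set: R * (R * R)] (fun q => cos q.1).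
    by apply: (measurableT_comp (continuous_measurable_fun (@continuous_cos R))).
  have ms : measurable_fun [set: R * (R * R)] (fun q => sin q.1).
    by apply: (measurableT_comp (continuous_measurable_fun (@continuous_sin R))).
  have m1 : measurable_fun [set: R * (R * R)] (fun q => q.2.1).
    by apply: (measurableT_comp measurable_fst).
  have m2 : measurable_fun [set: R * (R * R)] (fun q => q.2.2).
    by apply: (measurableT_comp measurable_snd).
  apply: measurable_fun_pair.
    by apply: measurable_funB; apply: measurable_funM.
  by apply: measurable_funD; apply: measurable_funM.
have S1 : ((2 * pi)%:E * A = \int[mu]_(t in circ) \int[mu2]_p f (t, p))%E.
  have Et t : (\int[mu2]_p f (t, p) = A)%E.
    exact: (integral_rot (cos2Dsin2 t) mF F0).
  under eq_integral do rewrite Et.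
  by rewrite integral_cst //= muleC -lebesgue_circ.
have S2 : ((2 * pi)%:E * A = \int[mu2]_p \int[mu]_(t in circ) f (t, p))%E.
  have mf1 : measurable_fun (circ `*` setT) f by exact: measurable_funTS.
  have T := tonelli_on mu (@lebesgue2 R) (@measurable_circ R) measurableT mf1 (fun x y _ _ => F0 _).
  by rewrite S1; exact: T.
(* The k-th coefficient in [hardy_disc] after division by 4. *)
pose c k : R := 2^-1 * pi * normc (b k) / k.+1%:R.
have c0 k : 0 <= c k by rewrite divr_ge0 // mulr_ge0 ?normc_ge0 // mulr_ge0 ?pi_ge0.
have mI : measurable_fun setT (fun p => \int[mu]_(t in circ) f (t, p))%E.
  have mf' : measurable_fun (setT `*` circ) (fun q => f (q.2, q.1)).
    by apply: measurable_funTS; apply: (measurableT_comp mf); exact: measurable_swap.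
  exact: (measurable_tonelli_on mu measurableT (@measurable_circ R) mf' (fun p t _ _ => F0 _)).
have mc k : measurable_fun disc2 (fun p => (c k)%:E * (normc (toC p) ^+ k)%:E)%E.
  by apply: measurable_funeM; exact: measurable_normc_pow.
have S3 : (\int[mu2]_(p in disc2) (\sum_(k < K) ((c k)%:E * (normc (toC p) ^+ k)%:E)) <=
    (2 * pi)%:E * A)%E.
  rewrite S2; apply: le_trans (_ : \int[mu2]_(p in disc2) \int[mu]_(t in circ) f (t, p) <= _)%E; last first.
    apply: ge0_subset_integral => //; first exact: measurable_disc2.
    by move=> p _; apply: integral_ge0 => t _; exact: F0.
  apply: ge0_le_integral; first exact: measurable_disc2.
  - move=> p _; apply: sume_ge0 => k _.
    by rewrite mule_ge0 // lee_fin // exprn_ge0 ?normc_ge0.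
  - by apply: emeasurable_sum => k *; exact: mc.
  - exact: measurable_funTS.
  move=> p pD; have := hardy_disc K hb (pD : unit_disc (toC p)) => hd.
  rewrite (_ : \int[mu]_(t in circ) f (t, p) =
      \int[mu]_(t in circ) (normc (h (toC p * cis t)))%:E)%E; last first.
    apply: eq_integral => t _; rewrite /f /F /patch mem_set.
      by rewrite -[X in h X]/(toC _) toC_rot.
    change (normc (toC (rot (cos t) (sin t) p)) < 1).
    by rewrite toC_rot normcM normc_cis mulr1; exact: pD.
  have q0 : (0%E <= (4^-1 : R)%:E)%E by rewrite lee_fin.
  have := lee_wpmul2l q0 hd.
  rewrite muleA -!EFinM mulVf ?pnatr_eq0 // mul1e; apply: le_trans.
  under eq_bigr do rewrite -EFinM.
  rewrite sumEFin lee_fin mulrA mulr_sumr le_eqVlt; apply/orP; left; apply/eqP.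
  by apply: eq_bigr => k _; rewrite /c; move: (k.+1%:R^-1) => M; field.
have ck0 k p : disc2 p -> (0 <= (c k)%:E * (normc (toC p) ^+ k)%:E)%E.
  by move=> _; rewrite mule_ge0 // lee_fin // exprn_ge0 ?normc_ge0.
have E : (\int[mu2]_(p in disc2) (\sum_(k < K) ((c k)%:E * (normc (toC p) ^+ k)%:E)) =
    \sum_(k < K) \int[mu2]_(p in disc2) ((c k)%:E * (normc (toC p) ^+ k)%:E))%E.
  apply: ge0_integral_sum; last by move=> k p pD; exact: ck0 pD.
  - exact: measurable_disc2.
  - by move=> k; exact: mc.
rewrite E in S3.
have S4 : ((\sum_(k < K) c k * (3 / (16 * k.+1%:R)))%:E <= (2 * pi)%:E * A)%E.
  apply: le_trans S3; rewrite -sumEFin; apply: lee_sum => k _.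
  have -> : (\int[mu2]_(p in disc2) ((c k)%:E * (normc (toC p) ^+ k)%:E) =
      (c k)%:E * \int[mu2]_(p in disc2) (normc (toC p) ^+ k)%:E)%E.
    apply: ge0_integralZl.
    - exact: measurable_disc2.
    - exact: measurable_normc_pow.
    - by move=> p _; rewrite lee_fin exprn_ge0 ?normc_ge0.
    by rewrite lee_fin.
  by rewrite EFinM lee_wpmul2l ?lee_fin // disc_moment.
(* The inverse of (pi/2) (3/16), the constants of [c] and of [disc_moment]; what remains is 64/3,
   rounded up to 32. *)
have q0 : (0%E <= ((2 * pi)^-1 * (64 / 3) : R)%:E)%E.
  by rewrite lee_fin mulr_ge0 ?invr_ge0 ?(ltW pi0).
have := lee_wpmul2l q0 S4.
rewrite -EFinM muleA -EFinM => S5.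
apply: le_trans (_ : ((2 * pi)^-1 * (64 / 3) * (2 * pi))%:E * A <= _)%E; last first.
  apply: lee_wpmul2r => //; rewrite lee_fin mulrAC mulVf ?gt_eqF // mul1r; lra.
apply: le_trans S5; rewrite lee_fin mulr_sumr; apply: ler_sum => k _.
rewrite le_eqVlt; apply/orP; left; apply/eqP; rewrite /c.
have k0 : k.+1%:R != 0 :> R by rewrite pnatr_eq0.
have pn : pi != 0 :> R by rewrite gt_eqF ?pi_gt0.
have key (p M x : R) : p != 0 -> M != 0 ->
    x / M / M = (2 * p)^-1 * (64 / 3) * (2^-1 * p * x / M * (3 / (16 * M))).
  by move=> p0 M0; field; rewrite M0 p0.
exact: key.
Qed.

Lemma expands_at0 (f : R[i] -> R[i]) a : expands f a -> f 0 = a 0%N.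
Proof.
move=> fa; have z0 : unit_disc (0 : R[i]) by rewrite /unit_disc /mkset normc0.
have h := fa 0 z0.
have h' : power_series a 0 @ \oo --> a 0%N.
  apply/cvg_normcP/cvgrPdist_lt => e e0; exists 1%N => // n /= n0.
  rewrite (_ : power_series a 0 n = a 0%N) ?subrr ?normc0 ?subr0 ?normr0 //.
  case: n n0 => // n _; rewrite /power_series /series /= big_nat_recl // expr0 mulr1.
  by rewrite big1 ?addr0 // => k _; rewrite exprS mul0r mulr0.
exact: (cvg_unique _ h h').
Qed.

Lemma area_integral_derive (f : R[i] -> R[i]) a : expands f a ->
  area_integral (fun z => (normc (derive1 f z))%:E) =
  ((pi^-1)%:E * \int[mu2]_(p in disc2)
      (normc (power_sum (deriv_coef a) (p.1 +i* p.2)))%:E)%E.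
Proof.
move=> fa; congr (_ * _)%E; apply: eq_integral => p /set_mem pD.
by rewrite (expands_derivE fa pD).
Qed.

(** [area_hardy] for the derivative: its coefficient (k+1) a_(k+1) absorbs one of the two factors
    1/(k+1), and 1/(k+1) >= 1/(k+2). The factor pi undoes the normalization of area, and |f(0)| pays
    for a_0. *)
Lemma hardy_dirichlet (f : R[i] -> R[i]) a K : expands f a ->
  ((\sum_(k < K) normc (a k) / k.+1%:R)%:E <= (32 * pi)%:E * dirichlet1_norm f)%E.
Proof.
move=> fa; have pi0 : 0 < pi :> R by exact: pi_gt0.
have hda := abs_expansion_expands (abs_expansion_deriv (expands_abs_expansion fa)).
have := area_hardy K hda; rewrite /dirichlet1_norm (area_integral_derive fa).
set A := (\int[mu2]_(p in disc2) _)%E => hA.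
have A0 : (0 <= A)%E by apply: integral_ge0 => p _; rewrite lee_fin normc_ge0.
rewrite ge0_muleDr ?lee_fin ?normc_ge0 //; last first.
  by rewrite mule_ge0 // lee_fin invr_ge0 ltW.
rewrite muleA -!EFinM mulfK ?gt_eqF //.
apply: le_trans (_ : (normc (a 0%N))%:E + 32%:E * A <= _)%E; last first.
  apply: leeD => //; rewrite (expands_at0 fa) lee_fin ler_peMl ?normc_ge0 //.
  by have := pi_ge2 R; lra.
apply: le_trans (leeD (le_refl (normc (a 0%N))%:E) hA).
rewrite -EFinD lee_fin; case: K {hA} => [|K].
  by rewrite !big_ord0 addr0 normc_ge0.
rewrite big_ord_recl divr1 lerD2l big_ord_recr /=.
apply: le_trans (_ : \sum_(i < K) normc (deriv_coef a i) / i.+1%:R / i.+1%:R <= _); last first.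
  by rewrite lerDl !divr_ge0 ?normc_ge0.
apply: ler_sum => k _; rewrite /deriv_coef normcMn -(mulr_natr (normc (a k.+1)) k.+1) mulfK ?pnatr_eq0 //.
by rewrite ler_wpM2l ?normc_ge0 // lef_pV2 ?posrE ?ltr0n // ler_nat.
Qed.

End hardy_area.

Arguments disc2 {R}.

(** * The Carleson condition and the kernel integrals *)

Section real_tools.
Variable R : realType.
Local Notation mu := (@lebesgue_measure R).

Lemma expR_Nln (x : R) : 0 < x -> expR (- ln x) = x^-1.
Proof. by move=> x0; rewrite expRN lnK. Qed.

Lemma measurable_inv_pos d (T : measurableType d) (D : set T) (f : T -> R) :
  measurable D -> measurable_fun D f -> (forall x, D x -> 0 < f x) ->
  measurable_fun D (fun x => (f x)^-1).
Proof.
move=> mD mf f0; apply: (eq_measurable_fun (fun x => expR (- ln (f x)))).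
  by move=> x /set_mem Dx; rewrite expR_Nln // f0.
apply: measurableT_comp; first exact: measurable_expR.
apply: measurable_funN; apply: measurableT_comp => //; exact: measurable_ln.
Qed.

Lemma FTC_on (f F : R -> R) (a b : R) : a < b ->
  (forall t : R, a <= t <= b -> {for t, continuous f}) ->
  (forall t : R, a <= t <= b -> is_derive t (1 : R) F (f t)) ->
  (\int[mu]_(t in `[a, b]) (f t)%:E = (F b - F a)%:E)%E.
Proof.
move=> ab cf dF.
have cF (t : R) : a <= t <= b -> {for t, continuous F}.
  move=> tab; apply: differentiable_continuous; apply/derivable1_diffP.
  by case: (dF t tab).
rewrite (@continuous_FTC2 _ f F) //.
- by apply: continuous_in_subspaceT => t /set_mem /=; rewrite in_itv; exact: cf.
- split.
  + move=> t; rewrite in_itv /= => /andP[h1 h2].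
    by case: (dF t _) => //; rewrite !ltW.
  + by apply: cvg_at_right_filter; apply: cF; rewrite lexx ltW.
  + by apply: cvg_at_left_filter; apply: cF; rewrite lexx ltW.
- move=> t; rewrite in_itv /= => /andP[h1 h2]; rewrite derive1E.
  by have ? := dF t; apply: derive_val; apply: dF; rewrite !ltW.
Qed.

(** The added 1 makes the weight at least 1 on [0,1), so that it bounds the kernel integrals also
    for t near 0, where the logarithm vanishes. *)
Definition lweight (t : R) : R := 1 - ln (1 - t).

Lemma lweight_ge1 t : 0 <= t -> t < 1 -> 1 <= lweight t.
Proof. by move=> t0 t1; rewrite /lweight lerBrDl gerDr ln_le0 // gerBl. Qed.

Lemma measurable_lweight : measurable_fun [set: R] lweight.
Proof.
apply: measurable_funB; first exact: measurable_cst.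
apply: measurableT_comp; first exact: measurable_ln.
by apply: measurable_funB; [exact: measurable_cst|exact: measurable_id].
Qed.

Lemma lweight_is_derive (t : R) : t < 1 -> is_derive t (1 : R) lweight (1 - t)^-1.
Proof.
move=> t1; have t10 : 0 < 1 - t by rewrite subr_gt0.
have d1 : is_derive t (1 : R) (fun x : R => 1 - x) (- 1).
  by have := is_deriveB (is_derive_cst (1 : R) t (1 : R)) (is_derive_id t (1 : R)); rewrite sub0r.
have d2 := @is_derive1_comp _ (@ln R) (fun x : R => 1 - x) t _ _ (is_derive1_ln t10) d1.
have := is_deriveB (is_derive_cst (1 : R) t (1 : R)) d2.
by rewrite sub0r mulrN1 opprK.
Qed.

Lemma ln2_ge_half : 2^-1 <= ln (2 : R).
Proof.
have := @le_ln1Dx R (- 2^-1).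
have -> : 1 + - 2^-1 = 2^-1 :> R by lra.
rewrite lnV ?posrE // lerN2; apply; lra.
Qed.

End real_tools.

(** * Moments of the weighted measure *)

Section carleson_moments.
Variables (R : realType) (nu : {finite_measure set (measurableTypeR R) -> \bar R}).
Local Notation leb := (@lebesgue_measure R).
Local Notation I01 := (`[0%R, 1%R[%classic : set R).

Definition tail (s : R) : R := fine (nu `[s, 1%R[%classic).

Lemma tailE s : (tail s)%:E = nu `[s, 1%R[%classic.
Proof. by rewrite fineK // fin_num_measure //; exact: measurable_itv. Qed.

Lemma tail_ge0 s : 0 <= tail s.
Proof. by rewrite fine_ge0. Qed.

(** Adding 1 to the logarithm costs a bound tail(s) <= 2 (C + M) (1 - s), M being the total mass:
    for s >= 1/2 the logarithm is at least 1/2, and for s < 1/2 one has M <= 2 M (1 - s). *)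
Lemma log_carleson_tail : log_carleson 1 1 nu ->
  exists2 C : R, 0 <= C & forall s, 0 <= s -> s < 1 -> tail s * lweight s <= C * (1 - s).
Proof.
move=> [C C0 hC]; pose M := fine (nu setT).
have M0 : 0 <= M by rewrite fine_ge0.
exists (3 * C + 2 * M) => [|s s0 s1]; first by rewrite addr_ge0 // mulr_ge0 // ltW.
have s10 : 0 < 1 - s by rewrite subr_gt0.
have lns : ln (1 - s)^-1 = - ln (1 - s) by rewrite lnV.
have L0 : 0 <= - ln (1 - s) by rewrite oppr_ge0 ln_le0 // gerBl.
have hs : tail s * - ln (1 - s) <= C * (1 - s).
  have := hC s; rewrite s0 s1 => /(_ isT).
  by rewrite lns !powRr1 // ?(ltW s10) // -tailE -EFinM lee_fin.
have T0 := tail_ge0 s.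
have TM : tail s <= M.
  rewrite -lee_fin tailE fineK ?fin_num_measure //.
  by apply: le_measure; rewrite ?inE //; exact: measurable_itv.
suff : tail s <= 2 * (C + M) * (1 - s) by rewrite /lweight; nra.
have [s2|s2] := lerP 2^-1 s.
  have L2 : 2^-1 <= - ln (1 - s).
    apply: le_trans (@ln2_ge_half R) _; rewrite -lns ler_ln ?posrE ?invr_gt0 //.
    rewrite -[leLHS]invrK lef_pV2 ?posrE ?invr_gt0 //; lra.
  nra.
nra.
Qed.

Let phi k (s : R) := s ^+ k * lweight s.
(** The exponential stands for 1/(1 - s), in a form that is visibly measurable on the whole line. At
    k = 0 the factor [k%:R] removes the truncated exponent [k.-1]. *)
Let phi' k (s : R) := k%:R * s ^+ k.-1 * lweight s + s ^+ k * expR (- ln (1 - s)).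

Let phi'_ge0 k s : 0 <= s -> s < 1 -> 0 <= phi' k s.
Proof.
move=> s0 s1; have := lweight_ge1 s0 s1 => w1.
by rewrite addr_ge0 // !mulr_ge0 ?exprn_ge0 ?expR_ge0 // (le_trans _ w1).
Qed.

Let measurable_phi' k : measurable_fun [set: R] (phi' k).
Proof.
apply: measurable_funD; apply: measurable_funM.
- by apply: measurable_funM; [exact: measurable_cst|exact: exprn_measurable].
- exact: measurable_lweight.
- exact: exprn_measurable.
apply: measurableT_comp; first exact: measurable_expR.
apply: measurable_funN; apply: measurableT_comp; first exact: measurable_ln.
by apply: measurable_funB; [exact: measurable_cst|exact: measurable_id].
Qed.

Let phi_is_derive k (t : R) : t < 1 -> is_derive t (1 : R) (phi k) (phi' k t).
Proof.
move=> t1; have dw := lweight_is_derive t1.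
have dp : is_derive t (1 : R) (fun x : R => x ^+ k) (k%:R * t ^+ k.-1).
  have := is_derive_poly 'X^k t; rewrite derivXn hornerMn hornerXn mulr_natl.
  by rewrite (_ : horner 'X^k = fun x => x ^+ k) //; apply/funext => x; rewrite hornerXn.
have := is_deriveM dp dw; rewrite /phi' expR_Nln ?subr_gt0 //.
by move=> h; apply: (is_derive_eq h); rewrite /GRing.scale /= addrC [lweight t * _]mulrC.
Qed.

Let phi'_continuous k (t : R) : t < 1 -> {for t, continuous (phi' k)}.
Proof.
move=> t1; have t10 : 0 < 1 - t by rewrite subr_gt0.
have c1 : {for t, continuous (fun x : R => 1 - x)}.
  by apply: cvgB; [exact: cvg_cst|exact: cvg_id].
have cl : {for t, continuous (fun x : R => ln (1 - x))}.
  by apply: continuous_comp => //; exact: continuous_ln.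
apply: cvgD; apply: cvgM.
- by apply: cvgM; [exact: cvg_cst|exact: exprn_continuous].
- by apply: cvgB; [exact: cvg_cst|exact: cl].
- exact: exprn_continuous.
apply: continuous_comp; last exact: continuous_expR.
by apply: cvgN; exact: cl.
Qed.

(** Integration by parts through Tonelli: t^k w(t) is its value at 0 plus the integral of [phi' k]
    over [0,t], so the moment becomes the integral of [phi' k] against [tail], where the Carleson
    bound applies pointwise. The value at 0 is 1 for k = 0 and 0 otherwise. *)
Lemma carleson_moment (C : R) : 0 <= C ->
  (forall s, 0 <= s -> s < 1 -> tail s * lweight s <= C * (1 - s)) ->
  forall k, (\int[nu]_(t in I01) (t ^+ k * lweight t)%:E <=
    (2 * C / k.+1%:R + (k == 0%N)%:R * tail 0)%:E)%E.
Proof.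
move=> C0 hC k.
pose f (q : R * R) := if q.2 <= q.1 then (phi' k q.2)%:E else 0%E.
have mI : measurable I01 by exact: measurable_itv.
have mf : measurable_fun [set: R * R] f.
  apply: measurable_fun_ifT; [|by apply/measurable_EFinP; exact: (measurableT_comp (measurable_phi' k))|exact: measurable_cst].
  by apply: measurable_fun_ler; [exact: measurable_snd|exact: measurable_fst].
have mf1 : measurable_fun (I01 `*` I01) f by exact: measurable_funTS.
have f0 t s : I01 t -> I01 s -> (0 <= f (t, s))%E.
  rewrite /= !in_itv /= => _ /andP[s0 s1]; rewrite /f /=; case: ifP => // _.
  by rewrite lee_fin phi'_ge0.
have T := tonelli_on nu leb mI mI mf1 f0.
have mF := measurable_tonelli_on leb mI mI mf1 f0.
have mG : measurable_fun I01 (fun s => \int[nu]_(t in I01) f (t, s))%E.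
  have mf2 : measurable_fun (I01 `*` I01) (fun q => f (q.2, q.1)).
    by apply: measurable_funTS; apply: (measurableT_comp mf); exact: measurable_swap.
  exact: (measurable_tonelli_on nu mI mI mf2 (fun s t sI tI => f0 t s tI sI)).
have E1 t : I01 t -> ((t ^+ k * lweight t)%:E <=
    (k == 0%N)%:R%:E + \int[leb]_(s in I01) f (t, s))%E.
  rewrite /= in_itv /= => /andP[t0 t1].
  have p0 : phi k 0 = (k == 0%N)%:R.
    by rewrite /phi /lweight subr0 ln1 subr0 mulr1 expr0n.
  have [t00|tpos] := leP t 0.
    have -> : t = 0 by apply/eqP; rewrite eq_le t00.
    rewrite -/(phi k 0) p0 leeDl //; apply: integral_ge0 => s sI.
    by apply: f0 => //=; rewrite in_itv /= lexx ltr01.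
  apply: le_trans (_ : (k == 0%N)%:R%:E + \int[leb]_(s in `[0%R, t]) (phi' k s)%:E <= _)%E.
    have c1 s : 0 <= s <= t -> {for s, continuous (phi' k)}.
      by move=> /andP[_ st]; apply: phi'_continuous; exact: le_lt_trans st t1.
    have d1 s : 0 <= s <= t -> is_derive s (1 : R) (phi k) (phi' k s).
      by move=> /andP[_ st]; apply: phi_is_derive; exact: le_lt_trans st t1.
    rewrite (FTC_on tpos c1 d1).
    by rewrite p0 -EFinD addrC subrK.
  apply: leeD => //.
  rewrite (_ : \int[leb]_(s in `[0%R, t]) (phi' k s)%:E =
    \int[leb]_(s in `[0%R, t]) f (t, s))%E; last first.
    by apply: eq_integral => s /set_mem /=; rewrite in_itv /f /= => /andP[_ ->].
  apply: ge0_subset_integral => //.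
  - by apply: measurable_funTS; exact: measurable_fun_pair2.
  - by move=> s sI; apply: f0 => //=; rewrite in_itv /= t0.
  by move=> s /=; rewrite !in_itv /= => /andP[-> st]; exact: le_lt_trans st t1.
have E2 s : I01 s -> (\int[nu]_(t in I01) f (t, s) = (phi' k s * tail s)%:E)%E.
  rewrite /= in_itv /= => /andP[s0 s1].
  rewrite (_ : \int[nu]_(t in I01) f (t, s) =
     \int[nu]_(t in `[s, 1%R[) cst (phi' k s)%:E t)%E.
    by rewrite integral_cst // EFinM tailE.
  rewrite [LHS]integral_mkcond [RHS]integral_mkcond; apply: eq_integral => t _.
  rewrite /patch /f /= !mem_setE !in_itv /=.
  case: (leP s t) => st; last by rewrite if_same.
  by rewrite (le_trans s0 st).
have E3 : (\int[leb]_(s in I01) \int[nu]_(t in I01) f (t, s) <= (C * (2 / k.+1%:R - (k == 0%N)%:R))%:E)%E.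
  (* A primitive of the pointwise bound C (k s^(k-1) (1 - s) + s^k). Its increment over [0,1] is
     2C/(k+1) for k > 0, and C for k = 0. *)
  pose P : {poly R} := C *: ('X^k + ((1 - k%:R) / k.+1%:R) *: 'X^(k.+1)).
  have PE s : P^`().[s] = C * (k%:R * s ^+ k.-1 * (1 - s) + s ^+ k).
    rewrite /P derivZ derivD derivZ !derivXn.
    rewrite hornerZ hornerD hornerZ !hornerMn !hornerXn /=.
    rewrite -(mulr_natl (s ^+ k.-1)) -(mulr_natl (s ^+ k) k.+1) mulrA divfK ?pnatr_eq0 //.
    congr (_ * _); case: (k) => [|m] /=; first by rewrite !mul0r !add0r subr0 mul1r.
    by rewrite exprS; ring.
  have mP : measurable_fun [set: R] (fun s => P^`().[s]).
    by apply: continuous_measurable_fun; exact: continuous_horner.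
  have := @FTC_on _ (fun s => P^`().[s]) (horner P) 0 1 ltr01
    (fun s _ => @continuous_horner _ _ s) (fun s _ => is_derive_poly P s).
  rewrite (_ : P.[1] - P.[0] = C * (2 / k.+1%:R - (k == 0%N)%:R)); last first.
    rewrite /P !hornerZ !hornerD !hornerZ !hornerXn !expr1n !expr0n /= mulr0 addr0 mulr1.
    rewrite -mulrBr; congr (_ * _); congr (_ - _).
    have k0 : k.+1%:R != 0 :> R by rewrite pnatr_eq0.
    rewrite -[X in X + _](divff k0) -mulrDl -natr1; congr (_ / _); ring.
  move=> <-; rewrite -integral_itv_bndo_bndc; last first.
    by apply/measurable_EFinP; exact: measurable_funTS.
  apply: ge0_le_integral => //.
  - by move=> s sI; apply: integral_ge0 => t tI; exact: f0.
  - by apply/measurable_EFinP; exact: measurable_funTS.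
  move=> s sI; rewrite E2 // PE lee_fin; move: sI; rewrite /= in_itv /= => /andP[s0 s1].
  have w1 := lweight_ge1 s0 s1; have hs := hC s s0 s1; have T0 := tail_ge0 s.
  (* The first term uses the bound on tail times weight; the second, which carries 1/(1 - s), only
     tail <= C (1 - s), a consequence of w >= 1. *)
  rewrite /phi' expR_Nln ?subr_gt0 // mulrDl [leRHS]mulrDr; apply: lerD.
    rewrite -mulrA [lweight s * _]mulrC [leRHS]mulrCA.
    by apply: ler_wpM2l => //; rewrite mulr_ge0 ?exprn_ge0.
  rewrite -mulrA mulrC ler_wpM2r ?exprn_ge0 // mulrC ler_pdivrMr ?subr_gt0 //.
  by apply: le_trans hs; rewrite ler_peMr.
apply: le_trans (_ : \int[nu]_(t in I01) (cst (k == 0%N)%:R%:E t + \int[leb]_(s in I01) f (t, s)) <= _)%E.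
  apply: ge0_le_integral => //.
  - move=> t; rewrite /= in_itv /= => /andP[t0 t1].
    by rewrite lee_fin mulr_ge0 ?exprn_ge0 // (le_trans _ (lweight_ge1 t0 t1)).
  - apply/measurable_EFinP; apply: measurable_funTS; apply: measurable_funM.
      exact: exprn_measurable.
    exact: measurable_lweight.
  - by apply: emeasurable_funD => //; exact: measurable_cst.
rewrite ge0_integralD //; last by move=> t tI; apply: integral_ge0 => s sI; exact: f0.
have -> : (\int[nu]_(x in I01) cst (k == 0%N)%:R%:E x = ((k == 0%N)%:R * tail 0)%:E)%E.
  by rewrite integral_cst // EFinM tailE.
rewrite T; apply: le_trans (leeD (le_refl _) E3) _; rewrite -EFinD lee_fin.
rewrite addrC mulrBr mulrA [C * 2]mulrC lerD2r gerBl.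
  by rewrite mulr_ge0.
by move=> t _; rewrite /= lee_fin.
Qed.

End carleson_moments.

(** * Circle integrals of powers of the Cauchy kernel *)

Section circle_kernel.
Variable R : realType.
Local Notation mu := (@lebesgue_measure R).
Local Notation circ := (`[0%R, (2 * pi)%R]%classic : set R).

Lemma pi_le4 : pi <= 4 :> R.
Proof. by have := @pihalf_lt2 R; lra. Qed.

(** From sin x = 2 sin(x/2) cos(x/2): on [0, pi/4] the cosine is at least cos(pi/4), hence by the
    mean value theorem sin y >= cos(pi/4) y, and cos(pi/4)^2 = 1/2. *)
Lemma sin_ge_half (x : R) : 0 <= x <= pi / 2 -> x / 2 <= sin x.
Proof.
move=> /andP[x0 x1]; have p0 : 0 < pi :> R := pi_gt0 R.
pose y := x / 2; have y0 : 0 <= y by rewrite divr_ge0.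
have yp : y <= pi / 4 by rewrite /y; lra.
have c2 : cos (pi / 4) ^+ 2 = 2^-1 :> R.
  have h1 := cos2Dsin2 (pi / 4 : R); have := @cosD R (pi / 4) (pi / 4).
  have -> : pi / 4 + pi / 4 = pi / 2 :> R by lra.
  by rewrite cos_pihalf -!expr2; lra.
have c0 : 0 < cos (pi / 4) :> R by apply: cos_gt0_pihalf; apply/andP; split; lra.
have cge (c : R) : 0 <= c <= pi / 4 -> cos (pi / 4 : R) <= cos c.
  move=> /andP[h1 h2]; rewrite leNgt ltr_cos -?leNgt // in_itv /=; apply/andP; split; lra.
have sy : cos (pi / 4) * y <= sin y.
  have [c] := @MVT_segment R (@sin R) (@cos R) 0 y y0 (fun z _ => is_derive_sin z)
    (continuous_subspaceT (@continuous_sin R)).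
  rewrite in_itv /= sin0 !subr0 => /andP[c1 c3] ->.
  by rewrite ler_wpM2r // cge // c1 (le_trans c3).
have cy := cge y (introT andP (conj y0 yp)).
have -> : x = y *+ 2 by rewrite /y -(mulr_natr (x / 2) 2) divfK.
rewrite sin_mulr2n -(mulr_natr y 2) -(mulr_natr (cos y * _) 2) mulfK ?pnatr_eq0 //.
have h : cos (pi / 4) * (cos (pi / 4) * y) <= cos y * sin y.
  by rewrite ler_pM // ?mulr_ge0 // ltW.
by rewrite mulrA -expr2 c2 in h; lra.
Qed.

Lemma cos_half_sin (x : R) : cos x = 1 - 2 * sin (x / 2) ^+ 2.
Proof.
have := cos2Dsin2 (x / 2); have := cosD (x / 2) (x / 2).
by rewrite -splitr -!expr2 => ->; lra.
Qed.

Lemma normc_kernel_sqr (rho t : R) :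
  normc (1 - rho%:C * cis t) ^+ 2 = 1 - 2 * rho * cos t + rho ^+ 2.
Proof.
rewrite normc_sqr /= !mul0r subr0 addr0 sub0r sqrrN.
by have := cos2Dsin2 t; nra.
Qed.

(** The squared modulus (1 - rho)^2 + 4 rho sin^2(t/2) is at least (1 - rho)^2 + rho t^2/4. For rho
    >= 1/2 this is comparable to the square of 1 - rho + t; for rho < 1/2 the constant 10 comes from
    1 - rho >= 1/2 and 1 - rho + t <= 5. *)
Lemma kernel_lower_half (rho t : R) : 0 <= rho -> rho < 1 -> 0 <= t <= pi ->
  (1 - rho + t) / 10 <= normc (1 - rho%:C * cis t).
Proof.
move=> r0 r1 /andP[t0 tp]; have d0 : 0 < 1 - rho by rewrite subr_gt0.
rewrite -(@ler_pXn2r _ 2) ?nnegrE ?normc_ge0 //; last first.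
  by rewrite divr_ge0 // addr_ge0 // ltW.
rewrite normc_kernel_sqr cos_half_sin.
have s4 : (t / 2) / 2 <= sin (t / 2).
  by apply: sin_ge_half; apply/andP; split; lra.
have s2 : (t / 4) ^+ 2 <= sin (t / 2) ^+ 2.
  have t4 : 0 <= t / 4 by rewrite divr_ge0.
  by rewrite lerXn2r ?nnegrE //; lra.
set u := sin (t / 2) ^+ 2 in s2 *.
have p4 := pi_le4.
have : (1 - rho) ^+ 2 + rho * t ^+ 2 / 4 <= 1 - 2 * rho * (1 - 2 * u) + rho ^+ 2.
  have : rho * (t / 4) ^+ 2 <= rho * u by rewrite ler_wpM2l.
  by nra.
apply: le_trans; rewrite expr_div_n ler_pdivrMr //.
set d := 1 - rho in d0 *; have [r2|r2] := lerP 2^-1 rho.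
  have : t ^+ 2 / 8 <= rho * t ^+ 2 / 4.
    by have := sqr_ge0 t; nra.
  by have := sqr_ge0 (d - t); nra.
have rt : 0 <= rho * t ^+ 2 / 4 by rewrite divr_ge0 // mulr_ge0 // sqr_ge0.
have d2 : 2^-1 <= d by rewrite /d; lra.
have d1 : d <= 1 by rewrite /d; lra.
have : d + t <= 5 by lra.
nra.
Qed.

Lemma normc_kernel_sym (rho t : R) :
  normc (1 - rho%:C * cis (2 * pi - t)) = normc (1 - rho%:C * cis t).
Proof.
apply/eqP; rewrite -(@eqrXn2 _ 2) ?normc_ge0 // !normc_kernel_sqr.
have -> : 2 * pi - t = - t + pi *+ 2 by rewrite addrC mulr_natl.
by rewrite cosD cos2pi sin2pi cosN mulr1 mulr0 subr0.
Qed.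

Lemma kernel_lower (rho t : R) : 0 <= rho -> rho < 1 -> 0 <= t <= 2 * pi ->
  (1 - rho + t) / 10 <= normc (1 - rho%:C * cis t) \/
  (1 - rho + (2 * pi - t)) / 10 <= normc (1 - rho%:C * cis t).
Proof.
move=> r0 r1 /andP[t0 t2]; have [tp|tp] := lerP t pi.
  by left; apply: kernel_lower_half => //; rewrite t0.
right; rewrite -normc_kernel_sym; apply: kernel_lower_half => //.
by apply/andP; split; lra.
Qed.

Lemma kernel_normc_gt0 (rho t : R) : 0 <= rho -> rho < 1 -> 0 < normc (1 - rho%:C * cis t).
Proof.
move=> r0 r1; apply: normc_1B_gt0.
by rewrite normcM normc_cis mulr1 normc_real ger0_norm.
Qed.

(** Adding the bounds for both ends of the period avoids cutting the circle at pi and leaves a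
    function with an elementary primitive. *)
Lemma kernel_upper (rho t : R) n : 0 <= rho -> rho < 1 -> 0 <= t <= 2 * pi ->
  (normc (1 - rho%:C * cis t))^-1 ^+ n <=
  (10 / (1 - rho + t)) ^+ n + (10 / (1 - rho + (2 * pi - t))) ^+ n.
Proof.
move=> r0 r1 tI; have N0 := kernel_normc_gt0 t r0 r1.
have d0 : 0 < 1 - rho by rewrite subr_gt0.
have H s : 0 <= s -> (1 - rho + s) / 10 <= normc (1 - rho%:C * cis t) ->
    (normc (1 - rho%:C * cis t))^-1 ^+ n <= (10 / (1 - rho + s)) ^+ n.
  move=> s0 hs; have ds0 : 0 < 1 - rho + s by rewrite ltr_pwDl.
  rewrite lerXn2r ?nnegrE ?invr_ge0 ?divr_ge0 ?(ltW ds0) ?(ltW N0) //.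
  by rewrite -invf_div lef_pV2 ?posrE ?divr_gt0.
have [t0 t2] := andP tI.
have P s : 0 <= s -> 0 <= (10 / (1 - rho + s)) ^+ n.
  by move=> s0; rewrite exprn_ge0 // divr_ge0 // addr_ge0 // ltW.
have t2' : 0 <= 2 * pi - t by rewrite subr_ge0.
case: (kernel_lower r0 r1 tI) => h.
  by apply: le_trans (H _ t0 h) _; rewrite lerDl P.
by apply: le_trans (H _ t2' h) _; rewrite lerDr P.
Qed.

Lemma measurable_kernel_circ (rho : R) n : 0 <= rho -> rho < 1 ->
  measurable_fun circ (fun t => (normc (1 - rho%:C * cis t))^-1 ^+ n).
Proof.
move=> r0 r1; apply: measurable_funX; apply: measurable_inv_pos => //.
- apply: measurable_funTS; apply: measurable_normc.
  rewrite (_ : (fun _ => _) = fun t => 1 + (- rho%:C) * cis t); last first.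
    by apply/funext => t; rewrite mulNr.
  apply: cmeasurableD; first exact: cmeasurable_cst.
  apply: cmeasurableM; first exact: cmeasurable_cst.
  exact: cmeasurable_cis.
by move=> t _; exact: kernel_normc_gt0.
Qed.

Lemma kernel_circle1 (rho : R) : 0 <= rho -> rho < 1 ->
  (\int[mu]_(t in circ) ((normc (1 - rho%:C * cis t))^-1)%:E <= (160 * lweight rho)%:E)%E.
Proof.
move=> r0 r1; set d := 1 - rho; have d0 : 0 < d by rewrite subr_gt0.
have p0 : 0 < 2 * pi :> R by rewrite mulr_gt0 ?pi_gt0.
pose f t := 10 / (d + t) + 10 / (d + (2 * pi - t)).
pose F t := 10 * ln (d + t) - 10 * ln (d + (2 * pi - t)).
have A1 t : 0 <= t <= 2 * pi -> 0 < d + t by move=> /andP[? _]; rewrite ltr_pwDl.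
have A2 t : 0 <= t <= 2 * pi -> 0 < d + (2 * pi - t).
  by move=> /andP[_ ?]; rewrite ltr_pwDl // subr_ge0.
have c1 (t : R) : {for t, continuous (fun x : R => d + x)}.
  by apply: cvgD; [exact: cvg_cst|exact: cvg_id].
have c2 (t : R) : {for t, continuous (fun x : R => d + (2 * pi - x))}.
  apply: cvgD; first exact: cvg_cst.
  by apply: cvgB; [exact: cvg_cst|exact: cvg_id].
have cf t : 0 <= t <= 2 * pi -> {for t, continuous f}.
  move=> tI; apply: cvgD; apply: cvgM; try exact: cvg_cst.
    by apply: cvgV; [rewrite gt_eqF ?A1|exact: c1].
  by apply: cvgV; [rewrite gt_eqF ?A2|exact: c2].
have dF t : 0 <= t <= 2 * pi -> is_derive t (1 : R) F (f t).
  move=> tI.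
  have d1 : is_derive t (1 : R) (fun x : R => d + x) 1.
    by have := is_deriveD (is_derive_cst d t (1 : R)) (is_derive_id t (1 : R)); rewrite add0r.
  have d2 : is_derive t (1 : R) (fun x : R => d + (2 * pi - x)) (- 1).
    have := is_deriveD (is_derive_cst d t (1 : R))
      (is_deriveB (is_derive_cst (2 * pi) t (1 : R)) (is_derive_id t (1 : R))).
    by rewrite add0r sub0r.
  have l1 := @is_derive1_comp _ (@ln R) (fun x : R => d + x) t _ _ (is_derive1_ln (A1 t tI)) d1.
  have l2 := @is_derive1_comp _ (@ln R) (fun x : R => d + (2 * pi - x)) t _ _
    (is_derive1_ln (A2 t tI)) d2.
  have := is_deriveB (is_deriveZ 10 l1) (is_deriveZ 10 l2).
  move=> h; apply: (is_derive_eq h); rewrite /f /GRing.scale /=.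
  by rewrite mulr1 mulrN1 mulrN opprK.
apply: le_trans (_ : \int[mu]_(t in `[0%R, (2 * pi)%R]) (f t)%:E <= _)%E.
  apply: ge0_le_integral => //.
  - by move=> t _; rewrite lee_fin invr_ge0 normc_ge0.
  - apply/measurable_EFinP; exact: (measurable_kernel_circ 1 r0 r1).
  - apply/measurable_EFinP; apply: subspace_continuous_measurable_fun => //.
    by apply: continuous_in_subspaceT => t /set_mem /=; rewrite in_itv; exact: cf.
  move=> t /=; rewrite in_itv lee_fin => tI.
  by have := kernel_upper 1 r0 r1 tI; rewrite !expr1.
rewrite (FTC_on p0 cf dF) lee_fin /F /lweight -/d subr0 subrr !addr0.
(* The increment of [F] is 20 (ln(d + 2 pi) - ln d), so this bound gives 160 times the weight. *)
have h9 : ln (d + 2 * pi) <= 8.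
  have h : ln (1 + 8) <= 8 :> R by apply: le_ln1Dx; lra.
  apply: le_trans h.
  rewrite ler_ln ?posrE //; last by rewrite ltr_pwDl // ltW.
  by have := pi_le4; rewrite /d; lra.
have : ln d <= 0 by rewrite ln_le0 // /d gerBl.
by lra.
Qed.

(** Used only for the test functions; 200 = 2 * 10^2, one term for each end of the period. *)
Lemma kernel_circle2 (rho : R) : 0 <= rho -> rho < 1 ->
  (\int[mu]_(t in circ) ((normc (1 - rho%:C * cis t))^-1 ^+ 2)%:E <= (200 / (1 - rho))%:E)%E.
Proof.
move=> r0 r1; set d := 1 - rho; have d0 : 0 < d by rewrite subr_gt0.
have p0 : 0 < 2 * pi :> R by rewrite mulr_gt0 ?pi_gt0.
pose f t := 10 / (d + t) * (10 / (d + t)) +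
  10 / (d + (2 * pi - t)) * (10 / (d + (2 * pi - t))).
pose F t := 100 * (d + (2 * pi - t))^-1 - 100 * (d + t)^-1.
have A1 t : 0 <= t <= 2 * pi -> 0 < d + t by move=> /andP[? _]; rewrite ltr_pwDl.
have A2 t : 0 <= t <= 2 * pi -> 0 < d + (2 * pi - t).
  by move=> /andP[_ ?]; rewrite ltr_pwDl // subr_ge0.
have c1 (t : R) : {for t, continuous (fun x : R => d + x)}.
  by apply: cvgD; [exact: cvg_cst|exact: cvg_id].
have c2 (t : R) : {for t, continuous (fun x : R => d + (2 * pi - x))}.
  apply: cvgD; first exact: cvg_cst.
  by apply: cvgB; [exact: cvg_cst|exact: cvg_id].
have cf t : 0 <= t <= 2 * pi -> {for t, continuous f}.
  move=> tI; apply: cvgD; apply: cvgM; apply: cvgM; try exact: cvg_cst.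
  - by apply: cvgV; [rewrite gt_eqF ?A1|exact: c1].
  - by apply: cvgV; [rewrite gt_eqF ?A1|exact: c1].
  - by apply: cvgV; [rewrite gt_eqF ?A2|exact: c2].
  by apply: cvgV; [rewrite gt_eqF ?A2|exact: c2].
have dF t : 0 <= t <= 2 * pi -> is_derive t (1 : R) F (f t).
  move=> tI.
  have d1 : is_derive t (1 : R) (fun x : R => d + x) 1.
    by have := is_deriveD (is_derive_cst d t (1 : R)) (is_derive_id t (1 : R)); rewrite add0r.
  have d2 : is_derive t (1 : R) (fun x : R => d + (2 * pi - x)) (- 1).
    have := is_deriveD (is_derive_cst d t (1 : R))
      (is_deriveB (is_derive_cst (2 * pi) t (1 : R)) (is_derive_id t (1 : R))).
    by rewrite add0r sub0r.
  have n1 : d + t != 0 by rewrite gt_eqF ?A1.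
  have n2 : d + (2 * pi - t) != 0 by rewrite gt_eqF ?A2.
  have v1 := @is_deriveV _ (fun x : R => d + x) t _ _ n1 d1.
  have v2 := @is_deriveV _ (fun x : R => d + (2 * pi - x)) t _ _ n2 d2.
  have := is_deriveB (is_deriveZ 100 v2) (is_deriveZ 100 v1).
  move=> h; apply: (is_derive_eq h); rewrite /f /GRing.scale /=.
  by move: (d + t) (d + (2 * pi - t)) n1 n2 => u v n1 n2; field; rewrite n1 n2.
apply: le_trans (_ : \int[mu]_(t in `[0%R, (2 * pi)%R]) (f t)%:E <= _)%E.
  apply: ge0_le_integral => //.
  - by move=> t _; rewrite lee_fin exprn_ge0 // invr_ge0 normc_ge0.
  - apply/measurable_EFinP; exact: (measurable_kernel_circ 2 r0 r1).
  - apply/measurable_EFinP; apply: subspace_continuous_measurable_fun => //.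
    by apply: continuous_in_subspaceT => t /set_mem /=; rewrite in_itv; exact: cf.
  by move=> t /=; rewrite in_itv lee_fin => tI; rewrite /f -!expr2; exact: kernel_upper.
rewrite (FTC_on p0 cf dF) lee_fin /F subr0 subrr !addr0.
have : 0 <= (d + 2 * pi)^-1 by rewrite invr_ge0 addr_ge0 // ltW.
by lra.
Qed.

End circle_kernel.

(** * Area integrals of powers of the Cauchy kernel *)

Section area_kernel.
Variable R : realType.
Local Notation mu := (@lebesgue_measure R).
Local Notation mu2 := (mu \x mu)%E.
Local Notation I := (`[(-1)%R, 1%R]%classic : set R).

Lemma kernel_Re_gt0 (t x : R) : 0 <= t -> t < 1 -> -1 <= x <= 1 -> 0 < 1 - t * x.
Proof.
move=> t0 t1 /andP[x1 x2]; rewrite subr_gt0; apply: le_lt_trans t1.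
by rewrite -[leRHS]mulr1 ler_wpM2l.
Qed.

Lemma normc_kernel_toC (t x y : R) :
  normc (1 - t%:C * toC (x, y)) ^+ 2 = (1 - t * x) ^+ 2 + (t * y) ^+ 2.
Proof. by rewrite normc_sqr /= !mul0r subr0 addr0 sub0r sqrrN. Qed.

Lemma normc_kernel_toC_gt0 (t x y : R) : 0 <= t -> t < 1 -> -1 <= x <= 1 ->
  0 < normc (1 - t%:C * toC (x, y)).
Proof.
move=> t0 t1 xI; have h := kernel_Re_gt0 t0 t1 xI.
rewrite lt_neqAle normc_ge0 andbT eq_sym; apply/eqP => n0.
have := normc_kernel_toC t x y; rewrite n0 expr0n /=.
have : 0 < (1 - t * x) ^+ 2 by rewrite exprn_gt0.
by have := sqr_ge0 (t * y); lra.
Qed.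

Lemma measurable_kernel_toC (t : R) n : 0 <= t -> t < 1 ->
  measurable_fun (I `*` I) (fun p => (normc (1 - t%:C * toC p))^-1 ^+ n).
Proof.
move=> t0 t1; apply: measurable_funX; apply: measurable_inv_pos.
- by apply: measurableX; exact: measurable_itv.
- apply: measurable_funTS; apply: measurable_normc.
  rewrite (_ : (fun _ => _) = fun p => 1 + (- t%:C) * toC p); last first.
    by apply/funext => p; rewrite mulNr.
  apply: cmeasurableD; first exact: cmeasurable_cst.
  apply: cmeasurableM; first exact: cmeasurable_cst.
  exact: cmeasurable_toC.
by move=> [x y] [/= xI _]; apply: normc_kernel_toC_gt0 => //; rewrite in_itv in xI.
Qed.

(** Area integrals are enlarged to the square, where slices have constant length. The kernel stays
    regular there because 1 - t x > 0 for |x| <= 1 and 0 <= t < 1. *)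
Lemma disc2_sub : disc2 `<=` I `*` I.
Proof.
move=> [x y]; rewrite /disc2 /unit_disc /mkset => h.
have := ler_Re_normc (x +i* y); have := ler_Im_normc (x +i* y) => /= h1 h2.
have nx : `|x| <= 1 by apply: le_trans h2 (ltW h).
have ny : `|y| <= 1 by apply: le_trans h1 (ltW h).
by split; rewrite /= in_itv /= -ler_norml.
Qed.

(** The slice is the integral of 1 / (A^2 + t^2 y^2) with A = 1 - t x, an arctangent: at most pi /
    (t A), and t >= 1/2. *)
Lemma kernel_slice (t x : R) : 2^-1 <= t -> t < 1 -> -1 <= x <= 1 ->
  (\int[mu]_(y in I) ((normc (1 - t%:C * toC (x, y)))^-1 ^+ 2)%:E <=
    (2 * pi / (1 - t * x))%:E)%E.
Proof.
move=> t2 t1 xI; have t0 : 0 < t by apply: lt_le_trans t2.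
set A := 1 - t * x; have A0 : 0 < A := kernel_Re_gt0 (ltW t0) t1 xI.
pose f y := ((normc (1 - t%:C * toC (x, y)))^-1) ^+ 2.
pose g (y : R) := (A ^+ 2 + t * y * (t * y))^-1.
have fg y : f y = g y by rewrite /f /g exprVn normc_kernel_toC [(t * y) ^+ 2]expr2.
have gn (y : R) : A ^+ 2 + t * y * (t * y) != 0.
  by rewrite gt_eqF // -expr2 ltr_pwDl ?exprn_gt0 ?sqr_ge0.
pose F (y : R) := (t * A)^-1 * atan (t / A * y).
have dF (y : R) : -1 <= y <= 1 -> is_derive y (1 : R) F (g y).
  move=> _.
  have d1 : is_derive y (1 : R) (fun x : R => t / A * x) (t / A).
    by have := is_deriveZ (t / A) (is_derive_id y (1 : R)); rewrite /GRing.scale /= mulr1.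
  have d2 := @is_derive1_comp _ (@atan R) (fun x : R => t / A * x) y _ _
    (is_derive1_atan (t / A * y)) d1.
  have h := is_deriveZ (t * A)^-1 d2; apply: (is_derive_eq h).
  rewrite /g /GRing.scale /=.
  have n1 : t != 0 by rewrite gt_eqF.
  have n2 : A != 0 by rewrite gt_eqF.
  have n3 : 1 + (t / A * y) ^+ 2 = (A ^+ 2 + t * y * (t * y)) / A ^+ 2 by field.
  by rewrite n3; have := gn y; move: (A ^+ 2 + _) => D n4; field; rewrite n1 n2 n4.
have cg (y : R) : -1 <= y <= 1 -> {for y, continuous g}.
  move=> _; apply: cvgV; first exact: gn.
  apply: cvgD; first exact: cvg_cst.
  by apply: cvgM; exact: mulrl_continuous.
under eq_integral do rewrite -/(f _) fg.
have lt11 : -1 < 1 :> R by lra.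
rewrite (FTC_on lt11 cg dF) lee_fin /F -mulrBr.
have := atan_ltpi2 (t / A * 1); have := atan_gtNpi2 (t / A * -1).
set a1 := atan _; set a2 := atan _ => h1 h2.
apply: le_trans (_ : (t * A)^-1 * pi <= _).
  by rewrite ler_wpM2l ?invr_ge0 ?mulr_ge0 ?(ltW t0) ?(ltW A0) //; lra.
rewrite invfM mulrAC [t^-1 * _]mulrC ler_wpM2r ?invr_ge0 ?(ltW A0) //.
rewrite mulrC [2 * _]mulrC; rewrite [leLHS]mulrC ler_wpM2l ?pi_ge0 //.
by rewrite -[leRHS]invrK lef_pV2 ?posrE ?invr_gt0.
Qed.

(** The weight [g] lets one estimate serve two exponents: g = 1 for the square of the kernel and g =
    1 / (1 - t x) for the cube. *)
Lemma kernel_area_le (g : R -> R) (t : R) : 2^-1 <= t -> t < 1 ->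
  measurable_fun I g -> (forall x, I x -> 0 <= g x) ->
  (\int[mu2]_(p in disc2) (g p.1 * (normc (1 - t%:C * toC p))^-1 ^+ 2)%:E <=
   \int[mu]_(x in I) (g x * (2 * pi / (1 - t * x)))%:E)%E.
Proof.
move=> t2 t1 mg g0; have t0 : 0 <= t by apply: le_trans t2.
pose f (p : R * R) := (g p.1 * (normc (1 - t%:C * toC p))^-1 ^+ 2)%:E.
have mI : measurable I by exact: measurable_itv.
have mII : measurable (I `*` I) by exact: measurableX.
have mg2 : measurable_fun (I `*` I) (fun p : R * R => g p.1).
  have -> : (fun p : R * R => g p.1) = g \o fst by [].
  apply: (measurable_comp mI) => //; last exact: measurable_funTS.
  by move=> _ [p [pI _] <-].
have mf : measurable_fun (I `*` I) f.
  apply/measurable_EFinP; apply: measurable_funM => //.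
  exact: measurable_kernel_toC.
have f0 x y : I x -> I y -> (0 <= f (x, y))%E.
  by move=> xI _; rewrite lee_fin mulr_ge0 ?g0 // exprn_ge0 // invr_ge0 normc_ge0.
apply: le_trans (_ : \int[mu2]_(p in I `*` I) f p <= _)%E.
  apply: ge0_subset_integral => //; first exact: measurable_disc2.
    by move=> [x y] [xI yI]; exact: f0.
  exact: disc2_sub.
rewrite (product_integral_on mu mu mI mI mf f0).
have mF := measurable_tonelli_on mu mI mI mf f0.
apply: ge0_le_integral => //.
- by move=> x xI; apply: integral_ge0 => y yI; exact: f0.
- apply/measurable_EFinP; apply: measurable_funM => //; apply: measurable_funM => //.
  apply: measurable_inv_pos => //.
    apply: measurable_funB => //; exact: measurable_funM.
  by move=> x /=; rewrite in_itv => xI; exact: kernel_Re_gt0.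
move=> x xI; have xI' : -1 <= x <= 1 by move: xI; rewrite /= in_itv.
have -> : (\int[mu]_(y in I) f (x, y) =
    (g x)%:E * \int[mu]_(y in I) ((normc (1 - t%:C * toC (x, y)))^-1 ^+ 2)%:E)%E.
  rewrite -ge0_integralZl ?lee_fin ?g0 //.
  - apply/measurable_EFinP; apply: (eq_measurable_fun (fun y => ((1 - t * x) ^+ 2 + (t * y) ^+ 2)^-1)).
      by move=> y _; rewrite exprVn normc_kernel_toC.
    apply: measurable_inv_pos => //.
      apply: measurable_funD => //; apply: measurable_funX; exact: measurable_funM.
    by move=> y _; rewrite ltr_pwDl ?sqr_ge0 // exprn_gt0 // kernel_Re_gt0.
  by move=> y _; rewrite lee_fin exprn_ge0 // invr_ge0 normc_ge0.
by rewrite EFinM lee_wpmul2l ?lee_fin ?g0 // kernel_slice.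
Qed.

Let lin_is_derive (t x : R) : is_derive x (1 : R) (fun x : R => 1 - t * x) (- t).
Proof.
have := is_deriveB (is_derive_cst (1 : R) x (1 : R)) (is_deriveZ t (is_derive_id x (1 : R))).
by rewrite sub0r /GRing.scale /= mulr1.
Qed.

Let lin_continuous (t x : R) : {for x, continuous (fun x : R => 1 - t * x)}.
Proof. by apply: cvgB; [exact: cvg_cst|exact: mulrl_continuous]. Qed.

Lemma kernel_area2 (t : R) : 0 <= t -> t < 1 ->
  (\int[mu2]_(p in disc2) ((normc (1 - t%:C * toC p))^-1 ^+ 2)%:E <= (16 * lweight t)%:E)%E.
Proof.
move=> t0 t1; have w1 := lweight_ge1 t0 t1.
have [t2|t2] := lerP 2^-1 t.
  have tpos : 0 < t by apply: lt_le_trans t2.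
  have m1 : measurable_fun I (cst (1 : R)) by exact: measurable_cst.
  have := kernel_area_le t2 t1 m1 (fun _ _ => ler01).
  under eq_integral do rewrite mul1r.
  move/le_trans; apply.
  pose f (x : R) := 2 * pi / (1 - t * x).
  pose F (x : R) := - (2 * pi / t) * ln (1 - t * x).
  under eq_integral do rewrite mul1r -/(f _).
  have dF (x : R) : -1 <= x <= 1 -> is_derive x (1 : R) F (f x).
    move=> xI; have A0 := kernel_Re_gt0 t0 t1 xI.
    have l1 := @is_derive1_comp _ (@ln R) (fun x : R => 1 - t * x) x _ _
      (is_derive1_ln A0) (lin_is_derive t x).
    have h := is_deriveZ (- (2 * pi / t)) l1; apply: (is_derive_eq h).
    have n1 : t != 0 by rewrite gt_eqF.
    have n2 : 1 - t * x != 0 by rewrite gt_eqF.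
    by rewrite /f /GRing.scale /=; field; rewrite n1 n2.
  have cf (x : R) : -1 <= x <= 1 -> {for x, continuous f}.
    move=> xI; apply: cvgM; first exact: cvg_cst.
    by apply: cvgV; [rewrite gt_eqF // kernel_Re_gt0|exact: lin_continuous].
  have lt11 : -1 < 1 :> R by lra.
  rewrite (FTC_on lt11 cf dF) lee_fin /F mulr1 mulrN1 opprK /lweight.
  have l2 : ln (1 + t) <= t by apply: le_ln1Dx; lra.
  have l1 : ln (1 - t) <= 0 by rewrite ln_le0 // gerBl.
  have pt : 2 * pi / t <= 16.
    by rewrite ler_pdivrMr //; have := pi_le4 R; lra.
  have pt0 : 0 <= 2 * pi / t by rewrite divr_ge0 ?mulr_ge0 ?pi_ge0.
  apply: le_trans (_ : (2 * pi / t) * (1 - ln (1 - t)) <= _); last first.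
    by rewrite ler_wpM2r //; lra.
  by rewrite mulNr mulNr opprK addrC -mulrBr ler_wpM2l //; lra.
(* For t < 1/2 the kernel is harmless: |1 - tz| >= 1/2 on a square of area 4, so the integral is at
   most 16. *)
apply: le_trans (_ : \int[mu2]_(p in I `*` I) cst 4%:E p <= _)%E.
  have mII : measurable (I `*` I) by apply: measurableX; exact: measurable_itv.
  apply: le_trans (_ : \int[mu2]_(p in I `*` I) ((normc (1 - t%:C * toC p))^-1 ^+ 2)%:E <= _)%E.
    apply: ge0_subset_integral => //; first exact: measurable_disc2.
    - by apply/measurable_EFinP; exact: measurable_kernel_toC.
    - by move=> p _; rewrite lee_fin exprn_ge0 // invr_ge0 normc_ge0.
    exact: disc2_sub.
  apply: ge0_le_integral => //.
  - by move=> p _; rewrite lee_fin exprn_ge0 // invr_ge0 normc_ge0.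
  - by apply/measurable_EFinP; exact: measurable_kernel_toC.
  move=> [x y] [/= xI _]; rewrite lee_fin exprVn normc_kernel_toC.
  have A2 : 2^-1 <= 1 - t * x.
    by move: xI; rewrite in_itv /= => /andP[x1 x2]; nra.
  rewrite -[leRHS]invrK lef_pV2 ?posrE ?invr_gt0 //; last first.
    by rewrite ltr_pwDl ?sqr_ge0 // exprn_gt0 //; lra.
  by have := sqr_ge0 (t * y); nra.
rewrite integral_cst; last by apply: measurableX; exact: measurable_itv.
have mII2 : mu2 (I `*` I) = (mu I * mu I)%E.
  by apply: product_measure1E; exact: measurable_itv.
rewrite [X in (_ * X)%E](_ : _ = (mu I * mu I)%E) //.
have -> : mu I = 2%:E.
  by rewrite lebesgue_measure_itv /= lte_fin; case: ifP => [_|/negP]; [rewrite -EFinB; congr EFin; lra|case; lra].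
by rewrite -!EFinM lee_fin; lra.
Qed.

(** One factor of the cube is bounded by 1 / (1 - t x), as the real part does not exceed the
    modulus. Integrating (1 - t x)^(-2) then gives the order 1/(1 - t). *)
Lemma kernel_area3 (t : R) : 2^-1 <= t -> t < 1 ->
  (\int[mu2]_(p in disc2) ((normc (1 - t%:C * toC p))^-1 ^+ 3)%:E <= (16 / (1 - t))%:E)%E.
Proof.
move=> t2 t1; have tpos : 0 < t by apply: lt_le_trans t2.
have t0 := ltW tpos; have t10 : 0 < 1 - t by rewrite subr_gt0.
pose g (x : R) := (1 - t * x)^-1.
have mI : measurable I by exact: measurable_itv.
have mII : measurable (I `*` I) by exact: measurableX.
have Apos x : I x -> 0 < 1 - t * x by rewrite /= in_itv => xI; exact: kernel_Re_gt0.
have mg : measurable_fun I g.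
  apply: measurable_inv_pos => //.
  by apply: measurable_funB => //; exact: measurable_funM.
have g0 x : I x -> 0 <= g x by move=> /Apos h; rewrite invr_ge0 ltW.
have mg2 : measurable_fun (I `*` I) (fun p : R * R => g p.1).
  have -> : (fun p : R * R => g p.1) = g \o fst by [].
  apply: (measurable_comp mI) => //; last exact: measurable_funTS.
  by move=> _ [p [pI _] <-].
apply: le_trans (_ : \int[mu2]_(p in disc2) (g p.1 * (normc (1 - t%:C * toC p))^-1 ^+ 2)%:E <= _)%E.
  have ms : forall h : R * R -> R, measurable_fun (I `*` I) h -> measurable_fun disc2 h.
    by move=> h; apply: measurable_funS => //; exact: disc2_sub.
  apply: ge0_le_integral; first exact: measurable_disc2.
  - by move=> p _; rewrite lee_fin exprn_ge0 // invr_ge0 normc_ge0.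
  - by apply/measurable_EFinP; apply: ms; exact: measurable_kernel_toC.
  - apply/measurable_EFinP; apply: ms; apply: measurable_funM => //.
    exact: measurable_kernel_toC.
  move=> [x y] pD; have [xI yI] := disc2_sub pD.
  have A0 := Apos x xI.
  have N0 : 0 < normc (1 - t%:C * toC (x, y)).
    by apply: normc_kernel_toC_gt0 => //; move: xI; rewrite /= in_itv.
  rewrite lee_fin exprS ler_wpM2r ?exprn_ge0 ?invr_ge0 ?(ltW N0) //.
  rewrite /g /= lef_pV2 ?posrE //.
  rewrite -(@ler_pXn2r _ 2) ?nnegrE ?(ltW N0) ?(ltW A0) // normc_kernel_toC.
  by rewrite lerDl sqr_ge0.
apply: le_trans (kernel_area_le t2 t1 mg g0) _.
pose f (x : R) := (1 - t * x)^-1 * (2 * pi / (1 - t * x)).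
pose F (x : R) := (2 * pi / t) * (1 - t * x)^-1.
have dF (x : R) : -1 <= x <= 1 -> is_derive x (1 : R) F (f x).
  move=> xI; have A0 := kernel_Re_gt0 t0 t1 xI.
  have n1 : t != 0 by rewrite gt_eqF.
  have n2 : 1 - t * x != 0 by rewrite gt_eqF.
  have v1 := @is_deriveV _ (fun x : R => 1 - t * x) x _ _ n2 (lin_is_derive t x).
  have h := is_deriveZ (2 * pi / t) v1; apply: (is_derive_eq h).
  by rewrite /f /GRing.scale /=; field; rewrite n1 n2.
have cf (x : R) : -1 <= x <= 1 -> {for x, continuous f}.
  move=> xI; have n2 : 1 - t * x != 0 by rewrite gt_eqF // kernel_Re_gt0.
  apply: cvgM; first by apply: cvgV => //; exact: lin_continuous.
  apply: cvgM; first exact: cvg_cst.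
  by apply: cvgV => //; exact: lin_continuous.
have lt11 : -1 < 1 :> R by lra.
under eq_integral do rewrite -/(f _).
rewrite (FTC_on lt11 cf dF) lee_fin /F mulr1 mulrN1 opprK -mulrBr.
have pt : 2 * pi / t <= 16.
  by rewrite ler_pdivrMr //; have := pi_le4 R; lra.
have i1 : 0 <= (1 + t)^-1 by rewrite invr_ge0 addr_ge0.
have i2 : 0 <= (1 - t)^-1 by rewrite invr_ge0 ltW.
have pt0 : 0 <= 2 * pi / t by rewrite divr_ge0 ?mulr_ge0 ?pi_ge0.
apply: le_trans (_ : (2 * pi / t) * (1 - t)^-1 <= _).
  by rewrite ler_wpM2l //; lra.
by rewrite ler_wpM2r.
Qed.

End area_kernel.

(** * Sufficiency of the Carleson condition *)

Section hankel_sufficiency.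
Variables (R : realType) (nu : {finite_measure set (measurableTypeR R) -> \bar R}).
Local Notation I01 := (`[0%R, 1%R[%classic : set R).

Lemma measurable_exprn_lweight k : measurable_fun I01 (fun t : R => t ^+ k * lweight t).
Proof.
apply: measurable_funTS; apply: measurable_funM; first exact: exprn_measurable.
exact: measurable_lweight.
Qed.

Lemma cvg_finite_sum (I : Type) (s : seq I) (u : I -> nat -> R) (l : I -> R) :
  (forall i, u i @ \oo --> l i) ->
  (fun n => \sum_(i <- s) u i n) @ \oo --> \sum_(i <- s) l i.
Proof.
move=> ul; elim: s => [|i s IH].
  by under eq_fun do rewrite big_nil; rewrite big_nil; exact: cvg_cst.
under eq_fun do rewrite big_cons; rewrite big_cons; exact: (cvgD (ul i) IH).
Qed.

Lemma exprn_integrable n : nu.-integrable I01 (fun t : R => (t ^+ n)%:E).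
Proof.
apply: measurable_bounded_integrable.
- exact: measurable_itv.
- by rewrite -ge0_fin_numE //; exact: fin_num_measure.
- by apply: measurable_funTS; exact: exprn_measurable.
exists 1; split; first exact: num_real.
move=> M M1 t; rewrite /= in_itv /= => /andP[t0 t1].
by rewrite ger0_norm ?exprn_ge0 // (le_trans _ (ltW M1)) // exprn_ile1 // ltW.
Qed.

Lemma momentE n : (moment nu n)%:E = (\int[nu]_(t in I01) (t ^+ n)%:E)%E.
Proof. by rewrite /moment /Rintegral fineK // integrable_fin_num //; exact: exprn_integrable. Qed.

Lemma moment_ge0 n : 0 <= moment nu n.
Proof.
rewrite -lee_fin momentE; apply: integral_ge0 => t; rewrite /= in_itv /= => /andP[t0 _].
by rewrite lee_fin exprn_ge0.
Qed.

(** The triangle inequality for a complex integral, written for a finite sum of moments. Multiplying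
    by a phase makes the sum real, so real integration suffices. *)
Lemma normc_moment_sum (I : Type) (s : seq I) (e : I -> nat) (c : I -> R[i]) :
  ((normc (\sum_(i <- s) (moment nu (e i))%:C * c i))%:E <=
    \int[nu]_(t in I01) (normc (\sum_(i <- s) (t ^+ e i)%:C * c i))%:E)%E.
Proof.
have [u u1 hu] := normc_eq1_dual (\sum_(i <- s) (moment nu (e i))%:C * c i).
have mI : measurable (I01 : set (measurableTypeR R)) by exact: measurable_itv.
have int1 i : nu.-integrable I01 (fun t : R => (Re (u * c i) * t ^+ e i)%:E).
  rewrite (_ : (fun t : R => _) = fun t : R => ((Re (u * c i))%:E * (t ^+ e i)%:E)%E) //.
  have h := integrableZl mI (Re (u * c i)) (exprn_integrable (e i)); exact: h.
have -> : (normc (\sum_(i <- s) (moment nu (e i))%:C * c i))%:E =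
    (\int[nu]_(t in I01) (\sum_(i <- s) Re (u * c i) * t ^+ e i)%:E)%E.
  under eq_integral do rewrite -sumEFin.
  rewrite integral_sum //.
  rewrite -hu mulr_sumr Re_sum -sumEFin; apply: eq_bigr => i _.
  rewrite mulrCA ReZ mulrC EFinM momentE.
  by rewrite -(integralZl mI (exprn_integrable (e i)) (Re (u * c i))).
have mt : measurable_fun I01 (fun t : R => normc (\sum_(i <- s) (t ^+ e i)%:C * c i)).
  apply: measurable_normc; apply: cmeasurable_sum => i.
  apply: cmeasurableM; last exact: cmeasurable_cst.
  by apply: cmeasurable_real; apply: measurable_funTS; exact: exprn_measurable.
apply: le_trans (_ : \int[nu]_(t in I01) `|(\sum_(i <- s) Re (u * c i) * t ^+ e i)%:E| <= _)%E.
  apply: le_trans (lee_abs _) _; apply: le_abse_integral => //.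
  by apply/measurable_EFinP; apply: measurable_sum => i; apply: measurable_funM.
apply: ge0_le_integral => //.
- apply/measurable_EFinP; apply: measurableT_comp => //.
  by apply: measurable_sum => i; apply: measurable_funM.
- exact/measurable_EFinP.
move=> t _; rewrite lee_fin.
have -> : \sum_(i <- s) Re (u * c i) * t ^+ e i = Re (u * \sum_(i <- s) (t ^+ e i)%:C * c i).
  by rewrite mulr_sumr Re_sum; apply: eq_bigr => i _; rewrite mulrCA ReZ mulrC.
by apply: le_trans (ler_Re_normc _) _; rewrite normcM u1 mul1r.
Qed.

(** In the closed form the two remainder terms are at most 1/2 each, uniformly in t because |tz| <=
    |z|. The uniformity allows integration in t at a fixed truncation. *)
Lemma sum_derive_geometric_near (z : R[i]) : unit_disc z ->
  \forall N \near \oo, forall t : R, I01 t ->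
    normc (\sum_(n < N) (t%:C * z) ^+ n *+ n.+1) <= 2 * (normc (1 - t%:C * z))^-1 ^+ 2.
Proof.
move=> zD.
have h0 : (fun n => normc z ^+ n *+ n.+1) @ \oo --> (0 : R).
  have c1 : cvgn (series (fun n => normc z ^+ n *+ n.+1)).
    apply: (@bounded_nondecreasing_cvg _ _ ((1 - normc z) ^+ 2)^-1).
      by move=> n; rewrite mulrn_wge0 // exprn_ge0 // normc_ge0.
    by move=> n; apply: sum_derive_geometric_le => //; exact: normc_ge0.
  exact: (cvg_series_cvg_0 c1).
near=> N => t; rewrite /= in_itv /= => /andP[t0 t1].
set x := t%:C * z; have xz : normc x <= normc z.
  by rewrite normcM normc_real ger0_norm // ler_piMl ?normc_ge0 ?ltW.
have x1 : normc x < 1 by apply: le_lt_trans (zD : normc z < 1).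
have x0 := normc_1B_gt0 x1.
rewrite exprVn ler_pdivlMr ?exprn_gt0 // -normcX -normcM mulrC.
rewrite -(big_mkord xpredT (fun n => x ^+ n *+ n.+1)) sum_derive_geometric.
have zN : normc z ^+ N *+ N.+1 <= 2^-1.
  have : `|0 - normc z ^+ N *+ N.+1| <= 2^-1 by near: N; move/cvgrPdist_le: h0; apply; rewrite invr_gt0.
  by rewrite sub0r normrN => /(le_trans (ler_norm _)).
have xN : normc (x ^+ N *+ N.+1) <= 2^-1.
  apply: le_trans zN; rewrite normcMn normcX ler_wMn2r // lerXn2r // nnegrE ?normc_ge0 //.
have xN' : normc (x ^+ N.+1 *+ N) <= 2^-1.
  apply: le_trans xN; rewrite !normcMn !normcX exprS.
  apply: le_trans (_ : normc x ^+ N *+ N <= _).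
    by rewrite ler_wMn2r // ler_piMl ?exprn_ge0 ?normc_ge0 // ltW.
  by apply: ler_wpMn2l => //; rewrite exprn_ge0 // normc_ge0.
apply: le_trans (le_normcD _ _) _.
have := le_normcD 1 (- (x ^+ N *+ N.+1)); rewrite normc1 normcN; lra.
Unshelve. all: by end_near. Qed.

Variables (B : R) (B0 : 0 <= B).
Hypothesis hB : forall k,
  (\int[nu]_(t in I01) (t ^+ k * lweight t)%:E <= (B / k.+1%:R)%:E)%E.

Lemma moment_le k : moment nu k <= B / k.+1%:R.
Proof.
rewrite -lee_fin momentE; apply: le_trans (hB k); apply: ge0_le_integral => //.
- by move=> t; rewrite /= in_itv /= => /andP[t0 _]; rewrite lee_fin exprn_ge0.
- by apply/measurable_EFinP; apply: measurable_funTS; exact: exprn_measurable.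
- by apply/measurable_EFinP; exact: measurable_exprn_lweight.
move=> t; rewrite /= in_itv /= => /andP[t0 t1]; rewrite lee_fin ler_peMr ?exprn_ge0 //.
exact: lweight_ge1.
Qed.

Variables (a : nat -> R[i]) (S : R).
Hypothesis aabs : abs_expansion a.
Hypothesis aS : forall K, \sum_(k < K) normc (a k) / k.+1%:R <= S.

Let S0 : 0 <= S.
Proof. by have := aS 0; rewrite big_ord0. Qed.

(** The moment of index n + k is at most B/(k+1), whatever n. Hence the image has bounded
    coefficients and converges in the whole disc. *)
Lemma hankel_row_partial n K : \sum_(0 <= k < K) normc (hankel_row nu a n k) <= B * S.
Proof.
apply: le_trans (_ : B * (\sum_(k < K) normc (a k) / k.+1%:R) <= _); last exact: ler_wpM2l.
rewrite big_mkord mulr_sumr; apply: ler_sum => k _.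
rewrite /hankel_row normcM normc_real ger0_norm ?moment_ge0 //.
rewrite mulrCA [leLHS]mulrC ler_wpM2l ?normc_ge0 //; apply: le_trans (moment_le _) _.
by rewrite ler_wpM2l // lef_pV2 ?posrE ?ltr0n // ler_nat ltnS leq_addl.
Qed.

Lemma hankel_row_cvg n : series (hankel_row nu a n) @ \oo --> hankel_coef nu a n.
Proof.
apply: normc_series_cvg; apply: (@bounded_nondecreasing_cvg _ _ (B * S)).
  by move=> k; exact: normc_ge0.
by move=> K; exact: hankel_row_partial.
Qed.

Lemma hankel_coef_le n : normc (hankel_coef nu a n) <= B * S.
Proof.
have h := @hankel_row_cvg n.
apply: (@normc_lim_le R _ _ (B * S) h); apply: nearW => K.
by apply: le_trans (ler_normc_sum _ _ _) _; exact: hankel_row_partial.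
Qed.

Lemma hankel_abs_expansion : abs_expansion (hankel_coef nu a).
Proof.
move=> rho r0 r1; apply: (terms_bounded_abs_summable r0 r1 (M := B * S)) => k.
by rewrite expr1n mulr1 hankel_coef_le.
Qed.

Lemma hankel_expands : expands (hankel nu a) (hankel_coef nu a).
Proof. exact: (abs_expansion_expands hankel_abs_expansion). Qed.

Lemma hankel_is_defined : hankel_defined nu a.
Proof.
split.
- by move=> n; apply/cvg_ex; exists (hankel_coef nu a n); exact: hankel_row_cvg.
- by move=> z zD; apply/cvg_ex; exists (hankel nu a z); exact: hankel_expands.
exact: (expands_analytic hankel_expands).
Qed.

(** The function Phi of the overview. *)
Definition majorant (t : R) : R := limn (series (fun k => normc (a k) * t ^+ k)).

Lemma majorant_ge_partial K (t : R) : I01 t ->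
  \sum_(k < K) normc (a k) * t ^+ k <= majorant t.
Proof.
rewrite /= in_itv /= => /andP[t0 t1].
have := @series_le_lim R (fun k => normc (a k) * t ^+ k) K.
rewrite /series /= big_mkord; apply; last exact: aabs.
by move=> k; rewrite mulr_ge0 ?normc_ge0 ?exprn_ge0.
Qed.

Lemma majorant_ge0 (t : R) : I01 t -> 0 <= majorant t.
Proof. by move=> tI; have := majorant_ge_partial 0 tI; rewrite big_ord0. Qed.

Lemma measurable_majorant : measurable_fun I01 majorant.
Proof.
apply: (@measurable_fun_cvg _ _ _ _ (fun n (t : R) => series (fun k => normc (a k) * t ^+ k) n)).
  by move=> n; apply: measurable_sum => k; apply: measurable_funM.
by move=> t; rewrite /= in_itv /= => /andP[t0 t1]; exact: aabs.
Qed.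

(** Monotone convergence on the partial sums, whose k-th term contributes at most |a_k| B/(k+1). *)
Lemma majorant_lweight :
  (\int[nu]_(t in I01) (majorant t * lweight t)%:E <= (B * S)%:E)%E.
Proof.
have mI : measurable I01 by exact: measurable_itv.
pose g n (t : R) : \bar R := (series (fun k => normc (a k) * t ^+ k) n * lweight t)%:E.
have w0 t : I01 t -> 0 <= lweight t.
  by rewrite /= in_itv /= => /andP[t0 t1]; apply: le_trans (lweight_ge1 t0 t1).
have tk k t : I01 t -> 0 <= normc (a k) * t ^+ k.
  by rewrite /= in_itv /= => /andP[t0 t1]; rewrite mulr_ge0 ?normc_ge0 ?exprn_ge0.
have gE n t : g n t = (\sum_(k < n) (normc (a k))%:E * (t ^+ k * lweight t)%:E)%E.
  rewrite /g /series /= big_mkord mulr_suml -sumEFin.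
  by apply: eq_bigr => k _; rewrite -EFinM mulrA.
have mg n : measurable_fun I01 (g n).
  apply/measurable_EFinP; apply: measurable_funM.
    by apply: measurable_sum => k; apply: measurable_funM.
  by apply: measurable_funTS; exact: measurable_lweight.
have g0 n t : I01 t -> (0 <= g n t)%E.
  by move=> tI; rewrite lee_fin mulr_ge0 ?w0 //; apply: sumr_ge0 => k _; exact: tk.
have gmono t : I01 t -> {homo g^~ t : n m / (n <= m)%N >-> (n <= m)%E}.
  move=> tI n m nm; rewrite lee_fin ler_wpM2r ?w0 //.
  have ns : nondecreasing_seq (series (fun k => normc (a k) * t ^+ k)).
    by apply: nondecreasing_series => *; exact: tk.
  exact: ns.
have h := @cvg_monotone_convergence _ _ _ nu _ mI g mg g0 gmono.
have E : (\int[nu]_(t in I01) (majorant t * lweight t)%:E =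
    \int[nu]_(t in I01) (fun t => limn (g^~ t)) t)%E.
  apply: eq_integral => t /set_mem; rewrite /= in_itv /= => /andP[t0 t1].
  apply/esym/cvg_lim => //; apply: cvg_EFin; first exact: nearW.
  by apply: cvgMr_tmp; exact: aabs.
rewrite E -(cvg_lim _ h) //; apply: lime_le; first by apply/cvg_ex; eexists; exact: h.
apply: nearW => n; under eq_integral do rewrite gE.
rewrite ge0_integral_sum //; last 2 first.
- move=> k; apply/measurable_EFinP; apply: measurable_funM => //.
  exact: measurable_exprn_lweight.
- move=> k t tI; rewrite -EFinM lee_fin mulrA mulr_ge0 ?w0 //; exact: tk.
apply: le_trans (_ : \sum_(k < n) (normc (a k))%:E * (B / k.+1%:R)%:E <= _)%E.
  apply: lee_sum => k _.
  have -> : (\int[nu]_(t in I01) ((normc (a k))%:E * (t ^+ k * lweight t)%:E) =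
      (normc (a k))%:E * \int[nu]_(t in I01) (t ^+ k * lweight t)%:E)%E.
    apply: ge0_integralZl => //.
    - by apply/measurable_EFinP; exact: measurable_exprn_lweight.
    - move=> t tI; have := tI; rewrite /= in_itv /= => /andP[t0 t1].
      by rewrite lee_fin mulr_ge0 ?exprn_ge0 ?w0.
    - by rewrite lee_fin normc_ge0.
  by apply: lee_wpmul2l; rewrite ?lee_fin ?normc_ge0.
under eq_bigr do rewrite -EFinM.
rewrite sumEFin lee_fin; under eq_bigr do rewrite mulrCA.
by rewrite -mulr_sumr ler_wpM2l.
Qed.

(** The weights [q] and the shift [s] treat the image (q = 1, s = 0) and its derivative (q(n) = n +
    1, s = 1) together. With both sums truncated, the double sum is the integral of t^s times a
    partial sum of the a_k t^k times a truncated kernel. *)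
Lemma hankel_kernel_le (q : nat -> nat) s d (z l : R[i]) :
  (\forall N \near \oo, forall t : R, I01 t ->
     normc (\sum_(n < N) (t%:C * z) ^+ n *+ q n) <= 2 * (normc (1 - t%:C * z))^-1 ^+ d) ->
  unit_disc z ->
  power_series (fun n => hankel_coef nu a (s + n) *+ q n) z @ \oo --> l ->
  ((normc l)%:E <=
    2%:E * \int[nu]_(t in I01) (majorant t * (normc (1 - t%:C * z))^-1 ^+ d)%:E)%E.
Proof.
move=> hq zD hl; set J := (\int[nu]_(t in I01) _)%E.
have J0 : (0 <= J)%E.
  apply: integral_ge0 => t tI; rewrite lee_fin mulr_ge0 ?majorant_ge0 //.
  by rewrite exprn_ge0 // invr_ge0 normc_ge0.
have mI : measurable (I01 : set (measurableTypeR R)) by exact: measurable_itv.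
have mk : measurable_fun I01 (fun t : R => (normc (1 - t%:C * z))^-1 ^+ d).
  apply: measurable_funX; apply: measurable_inv_pos => //.
    apply: measurable_normc.
    rewrite (_ : (fun _ => _) = fun t : R => 1 + t%:C * (- z)); last first.
      by apply/funext => t; rewrite mulrN.
    apply: cmeasurableD; first exact: cmeasurable_cst.
    apply: cmeasurableM; last exact: cmeasurable_cst.
    by apply: cmeasurable_real; exact: measurable_id.
  move=> t; rewrite /= in_itv /= => /andP[t0 t1].
  by apply/normc_1B_gt0/normcZ_lt1 => //; exact: ltW.
have [->|Jf] := eqVneq J +oo%E; first by rewrite gt0_muley ?leey // lte_fin.
have JE : J = (fine J)%:E by rewrite fineK // ge0_fin_numE // lt_neqAle Jf leey.
rewrite JE -EFinM lee_fin; apply: (normc_lim_le hl).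
near=> N.
have hN : forall t : R, I01 t ->
     normc (\sum_(n < N) (t%:C * z) ^+ n *+ q n) <= 2 * (normc (1 - t%:C * z))^-1 ^+ d.
  by near: N; exact: hq.
(* The truncation K of the inner sums goes to infinity first, at fixed N; the error is a finite
   combination of N convergence errors. *)
have cN : (fun K => \sum_(n < N) ((\sum_(k < K) hankel_row nu a (s + n) k) *+ q n) * z ^+ n)
    @ \oo --> power_series (fun n => hankel_coef nu a (s + n) *+ q n) z N.
  rewrite /power_series /series /= big_mkord.
  apply/cvg_normcP.
  have : (fun K => \sum_(n < N) normc (\sum_(k < K) hankel_row nu a (s + n) k -
      hankel_coef nu a (s + n)) * (normc z ^+ n *+ q n)) @ \oo --> \sum_(n < N) (0 : R).
    apply: cvg_finite_sum => n.
    rewrite -[X in _ --> X](mul0r (normc z ^+ n *+ q n)); apply: cvgM; last exact: cvg_cst.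
    apply/cvg_normcP; have := @hankel_row_cvg (s + n); rewrite /series /=.
    by under eq_fun do rewrite big_mkord.
  rewrite big1 // => h0; apply: (squeeze_cvgr _ (cvg_cst 0) h0).
  apply: nearW => K; rewrite normc_ge0 /= -sumrB.
  apply: le_trans (ler_normc_sum _ _ _) _; apply: ler_sum => n _.
  by rewrite -mulrBl -mulrnBl normcM normcMn normcX mulrnAl mulrnAr.
apply: (normc_lim_le cN); apply: nearW => K.
rewrite -lee_fin EFinM -JE /J.
have -> : \sum_(n < N) ((\sum_(k < K) hankel_row nu a (s + n) k) *+ q n) * z ^+ n =
    \sum_(p <- index_enum ('I_N * 'I_K)%type)
      (moment nu (s + p.1 + p.2))%:C * (a p.2 * (z ^+ p.1 *+ q p.1)).
  rewrite -(pair_bigA _ (fun (n : 'I_N) (k : 'I_K) =>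
    (moment nu (s + n + k))%:C * (a k * (z ^+ n *+ q n)))) /=.
  apply: eq_bigr => n _; rewrite mulrnAl -mulrnAr mulr_suml; apply: eq_bigr => k _.
  by rewrite /hankel_row mulrA.
apply: le_trans (normc_moment_sum _ (fun p : 'I_N * 'I_K => s + p.1 + p.2)%N _) _.
have -> : (2%:E * \int[nu]_(t in I01) (majorant t * (normc (1 - t%:C * z))^-1 ^+ d)%:E =
    \int[nu]_(t in I01) (2%:E * (majorant t * (normc (1 - t%:C * z))^-1 ^+ d)%:E))%E.
  apply/esym; apply: ge0_integralZl => //.
  - apply/measurable_EFinP; apply: measurable_funM => //; exact: measurable_majorant.
  - move=> t tI; rewrite lee_fin mulr_ge0 ?majorant_ge0 //.
    by rewrite exprn_ge0 // invr_ge0 normc_ge0.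
apply: ge0_le_integral => //.
- by move=> t _; rewrite lee_fin normc_ge0.
- apply/measurable_EFinP; apply: measurable_normc; apply: cmeasurable_sum => i.
  apply: cmeasurableM; last exact: cmeasurable_cst.
  by apply: cmeasurable_real; apply: measurable_funTS; exact: exprn_measurable.
- apply: emeasurable_funM => //; apply/measurable_EFinP; apply: measurable_funM => //.
  exact: measurable_majorant.
move=> t tI; have /andP[t0 t1] : 0 <= t < 1 by move: tI; rewrite /= in_itv.
rewrite -EFinM lee_fin.
have -> : \sum_(p <- index_enum ('I_N * 'I_K)%type)
    (t ^+ (s + p.1 + p.2))%:C * (a p.2 * (z ^+ p.1 *+ q p.1)) =
    (t ^+ s)%:C * (\sum_(k < K) a k * (t ^+ k)%:C) * \sum_(n < N) (t%:C * z) ^+ n *+ q n.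
  rewrite -mulrA mulrC big_distrlr /= exchange_big /= mulr_suml.
  rewrite -(pair_bigA _ (fun (n : 'I_N) (k : 'I_K) =>
    (t ^+ (s + n + k))%:C * (a k * (z ^+ n *+ q n)))) /=.
  apply: eq_bigr => n _; rewrite mulr_suml; apply: eq_bigr => k _.
  rewrite !exprD !rmorphM /= exprMn !rmorphXn /=.
  by rewrite !(mulrnAr, mulrnAl); congr (_ *+ _); ring.
have ts : 0 <= t ^+ s <= 1 by rewrite exprn_ge0 //= exprn_ile1 // ltW.
rewrite !normcM normc_real ger0_norm; last by case/andP: ts.
have mp := majorant_ge_partial K tI.
have hp : normc (\sum_(k < K) a k * (t ^+ k)%:C) <= majorant t.
  apply: le_trans (ler_normc_sum _ _ _) (le_trans _ mp); apply: ler_sum => k _.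
  by rewrite normcM normc_real ger0_norm // exprn_ge0.
rewrite mulrCA; apply: ler_pM; rewrite ?normc_ge0 ?mulr_ge0 ?normc_ge0 //; first by case/andP: ts.
  rewrite -[leRHS]mul1r; apply: ler_pM; rewrite ?normc_ge0 //; by case/andP: ts.
exact: hN.
Unshelve. all: by end_near. Qed.

Lemma hankel_kernel1 (z : R[i]) : unit_disc z ->
  ((normc (hankel nu a z))%:E <=
    2%:E * \int[nu]_(t in I01) (majorant t * (normc (1 - t%:C * z))^-1 ^+ 1)%:E)%E.
Proof.
move=> zD; apply: (@hankel_kernel_le (fun=> 1%N) 0 1 z) => //; last exact: hankel_expands.
apply: nearW => N t; rewrite /= in_itv /= => /andP[t0 t1].
set x := t%:C * z; have x1 : normc x < 1 by apply: normcZ_lt1 => //; exact: ltW.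
have x0 := normc_1B_gt0 x1.
rewrite expr1 ler_pdivlMr // -normcM mulrC.
have -> : (1 - x) * \sum_(n < N) x ^+ n *+ 1 = 1 - x ^+ N.
  by rewrite (eq_bigr (fun i : 'I_N => x ^+ i)) // -(opprB x 1) mulNr -subrX1 opprB.
apply: le_trans (le_normcD _ _) _; rewrite normc1 normcN normcX.
by have := exprn_ile1 N (normc_ge0 x) (ltW x1); lra.
Qed.

Lemma hankel_kernel2 (z : R[i]) : unit_disc z ->
  ((normc (power_sum (deriv_coef (hankel_coef nu a)) z))%:E <=
    2%:E * \int[nu]_(t in I01) (majorant t * (normc (1 - t%:C * z))^-1 ^+ 2)%:E)%E.
Proof.
move=> zD; apply: (@hankel_kernel_le succn 1 2 z) => //; last first.
  apply: (abs_expansion_cvg _ zD); apply: abs_expansion_deriv; exact: hankel_abs_expansion.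
exact: sum_derive_geometric_near.
Qed.

End hankel_sufficiency.

(** * Norm bounds for the image *)

Section hankel_norms.
Variables (R : realType) (nu : {finite_measure set (measurableTypeR R) -> \bar R}).
Local Notation I01 := (`[0%R, 1%R[%classic : set R).
Local Notation mu := (@lebesgue_measure R).
Local Notation circ := (`[0%R, (2 * pi)%R]%classic : set R).
Variables (B : R) (B0 : 0 <= B).
Hypothesis hB : forall k,
  (\int[nu]_(t in I01) (t ^+ k * lweight t)%:E <= (B / k.+1%:R)%:E)%E.
Variables (a : nat -> R[i]) (S : R).
Hypothesis aabs : abs_expansion a.
Hypothesis aS : forall K, \sum_(k < K) normc (a k) / k.+1%:R <= S.

(** Common to both target norms: [m] and [Z] are arc length with z = r e^(it), or area with z
    itself. Tonelli moves the integral over [D] inside, where the kernel costs A w(t), and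
    [majorant_lweight] finishes. *)
Lemma hankel_integral_le d (T : measurableType d) (m : {sigma_finite_measure set T -> \bar R})
    (D : set T) (Z : T -> R[i]) (F : T -> \bar R) (A : R) k :
  measurable D -> cmeasurable [set: T] Z -> (forall x, D x -> normc (Z x) < 1) -> 0 <= A ->
  (forall t, I01 t ->
    (\int[m]_(x in D) ((normc (1 - t%:C * Z x))^-1 ^+ k)%:E <= (A * lweight t)%:E)%E) ->
  measurable_fun D F -> (forall x, D x -> (0 <= F x)%E) ->
  (forall x, D x -> (F x <=
    2%:E * \int[nu]_(t in I01) (majorant a t * (normc (1 - t%:C * Z x))^-1 ^+ k)%:E)%E) ->
  (\int[m]_(x in D) F x <= (2 * (A * (B * S)))%:E)%E.
Proof.
move=> mD mZ ZD A0 hA mF F0 hF.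
pose f (p : T * R) := (majorant a p.2 * (normc (1 - (p.2)%:C * Z p.1))^-1 ^+ k)%:E.
have mI : measurable (I01 : set (measurableTypeR R)) by exact: measurable_itv.
have mDI : measurable (D `*` I01) by exact: measurableX.
have mmaj : measurable_fun (D `*` I01) (fun p : T * R => majorant a p.2).
  have -> : (fun p : T * R => majorant a p.2) = majorant a \o snd by [].
  apply: (measurable_comp mI _ (measurable_majorant aabs)).
    by move=> _ [p [_ pI] <-].
  by apply: measurable_funTS; exact: measurable_snd.
have mk : measurable_fun (D `*` I01)
    (fun p : T * R => (normc (1 - (p.2)%:C * Z p.1))^-1 ^+ k).
  apply: measurable_funX; apply: measurable_inv_pos => //.
    apply: measurable_funTS; apply: measurable_normc.
    rewrite (_ : (fun _ => _) = fun p : T * R => 1 + (p.2)%:C * (- 1 * Z p.1)); last first.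
      by apply/funext => p; rewrite mulN1r mulrN.
    apply: cmeasurableD; first exact: cmeasurable_cst.
    apply: cmeasurableM; first by apply: cmeasurable_real; exact: measurable_snd.
    apply: cmeasurableM; first exact: cmeasurable_cst.
    by case: mZ => m1 m2; split; [exact: (measurableT_comp m1 measurable_fst)|exact: (measurableT_comp m2 measurable_fst)].
  move=> [x t] [/= xD]; rewrite in_itv /= => /andP[t0 t1].
  by apply/normc_1B_gt0/normcZ_lt1 => //; [exact: ltW|exact: ZD].
have mf : measurable_fun (D `*` I01) f.
  by apply/measurable_EFinP; exact: measurable_funM.
have f0 x t : D x -> I01 t -> (0 <= f (x, t))%E.
  move=> xD tI; rewrite lee_fin mulr_ge0 ?majorant_ge0 //.
  by rewrite exprn_ge0 // invr_ge0 normc_ge0.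
have T1 := tonelli_on m nu mD mI mf f0.
have mg := measurable_tonelli_on nu mD mI mf f0.
have g0 x : D x -> (0 <= \int[nu]_(t in I01) f (x, t))%E.
  by move=> xD; apply: integral_ge0 => t tI; exact: f0.
apply: le_trans (_ : \int[m]_(x in D) (2%:E * \int[nu]_(t in I01) f (x, t)) <= _)%E.
  apply: ge0_le_integral => //.
  by apply: emeasurable_funM => //; exact: measurable_cst.
have -> : (\int[m]_(x in D) (2%:E * \int[nu]_(t in I01) f (x, t)) =
    2%:E * \int[m]_(x in D) \int[nu]_(t in I01) f (x, t))%E.
  by apply: ge0_integralZl.
rewrite T1 [leRHS]EFinM; apply: lee_wpmul2l; first by rewrite lee_fin.
apply: le_trans (_ : \int[nu]_(t in I01) (A%:E * (majorant a t * lweight t)%:E) <= _)%E.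
  have mf' : measurable_fun (I01 `*` D) (fun p => f (p.2, p.1)).
    have -> : (fun p : R * T => f (p.2, p.1)) = f \o (fun p : R * T => (p.2, p.1)) by [].
    apply: (measurable_comp mDI _ mf); first by move=> _ [[t x] [tI xD] <-].
    by apply: measurable_funTS; exact: measurable_swap.
  apply: ge0_le_integral => //.
  - by move=> t tI; apply: integral_ge0 => x xD; exact: f0.
  - exact: (measurable_tonelli_on m mI mD mf' (fun t x tI xD => f0 x t xD tI)).
  - apply: emeasurable_funM; first exact: measurable_cst.
    apply/measurable_EFinP; apply: measurable_funM; first exact: measurable_majorant.
    by apply: measurable_funTS; exact: measurable_lweight.
  move=> t tI.
  have -> : (\int[m]_(x in D) f (x, t) = (majorant a t)%:E *
      \int[m]_(x in D) ((normc (1 - t%:C * Z x))^-1 ^+ k)%:E)%E.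
    transitivity (\int[m]_(x in D)
      ((majorant a t)%:E * ((normc (1 - t%:C * Z x))^-1 ^+ k)%:E))%E; first by [].
    apply: ge0_integralZl => //.
    - apply/measurable_EFinP; apply: measurable_funX; apply: measurable_inv_pos => //.
        apply: measurable_funTS; apply: measurable_normc.
        rewrite (_ : (fun _ => _) = fun x : T => 1 + (- t%:C) * Z x); last first.
          by apply/funext => x; rewrite mulNr.
        apply: cmeasurableD; first exact: cmeasurable_cst.
        by apply: cmeasurableM; first exact: cmeasurable_cst.
      by move=> x xD; move: tI; rewrite /= in_itv /= => /andP[t0 t1];
        apply/normc_1B_gt0/normcZ_lt1 => //; [exact: ltW|exact: ZD].
    - by move=> x _; rewrite lee_fin exprn_ge0 // invr_ge0 normc_ge0.
    - by rewrite lee_fin majorant_ge0.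
  rewrite -EFinM mulrCA EFinM; apply: lee_wpmul2l; first by rewrite lee_fin majorant_ge0.
  exact: hA.
have -> : (\int[nu]_(t in I01) (A%:E * (majorant a t * lweight t)%:E) =
    A%:E * \int[nu]_(t in I01) (majorant a t * lweight t)%:E)%E.
  apply: ge0_integralZl => //.
  - apply/measurable_EFinP; apply: measurable_funM; first exact: measurable_majorant.
    by apply: measurable_funTS; exact: measurable_lweight.
  - move=> t tI; rewrite lee_fin mulr_ge0 ?majorant_ge0 //.
    move: tI; rewrite /= in_itv /= => /andP[t0 t1].
    by rewrite (le_trans _ (lweight_ge1 t0 t1)).
rewrite [leRHS]EFinM; apply: lee_wpmul2l; first by rewrite lee_fin.
exact: majorant_lweight.
Qed.

Lemma lweight_mono (s t : R) : 0 <= s -> s <= t -> t < 1 -> lweight s <= lweight t.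
Proof.
move=> s0 st t1; rewrite /lweight lerD2l lerN2 ler_ln ?posrE ?subr_gt0 //.
  by rewrite lerD2l lerN2.
exact: le_lt_trans t1.
Qed.

Lemma hankel_hardy1_le : (hardy1_norm (hankel nu a) <= (320 * (B * S))%:E)%E.
Proof.
have S0 : 0 <= S by have := aS 0; rewrite big_ord0.
have p0 : 1 <= 2 * pi :> R by have := pi_ge2 R; lra.
have pV : (2 * pi)^-1 <= 1 :> R by rewrite invf_le1 //; lra.
have pV0 : 0 <= (2 * pi)^-1 :> R by rewrite invr_ge0; lra.
apply: ge_ereal_sup => y [r /=]; rewrite in_itv /= => /andP[r0 r1] <-.
have nr : normc r%:C = r by rewrite normc_real ger0_norm // ltW.
have rD t : normc (r%:C * cis t) < 1 by rewrite normcM nr normc_cis mulr1.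
have mZ : cmeasurable [set: R] (fun t => r%:C * cis t).
  by apply: cmeasurableM; [exact: cmeasurable_cst|exact: cmeasurable_cis].
rewrite circle_meanE.
have h : (\int[mu]_(t in circ) (normc (hankel nu a (r%:C * cis t)))%:E <=
    (2 * (160 * (B * S)))%:E)%E.
  apply: (@hankel_integral_le _ _ mu circ (fun t => r%:C * cis t) _ 160 1) => //.
  - move=> t tI; have /andP[t0 t1] : 0 <= t < 1 by move: tI; rewrite /= in_itv.
    have tr0 : 0 <= t * r by rewrite mulr_ge0 // ltW.
    have trt : t * r <= t by rewrite ler_piMr // ltW.
    have tr1 : t * r < 1 by apply: le_lt_trans t1.
    (* On the circle of radius r the kernel has parameter t r <= t, and the weight is increasing. *)
    apply: le_trans (_ : (160 * lweight (t * r))%:E <= _)%E.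
      apply: le_trans (kernel_circle1 tr0 tr1); rewrite le_eqVlt; apply/orP; left; apply/eqP.
      by apply: eq_integral => x _; rewrite expr1 mulrA -rmorphM.
    by rewrite lee_fin ler_wpM2l // lweight_mono.
  - apply/measurable_EFinP; apply: measurable_normc.
    apply: (cmeasurable_expands (hankel_expands B0 hB aS)) => [|t _]; last exact: rD.
    by case: mZ => m1 m2; split; exact: measurable_funTS.
  - by move=> t _; rewrite lee_fin normc_ge0.
  move=> t _; exact: (hankel_kernel1 B0 hB aabs aS (rD t)).
apply: le_trans (lee_wpmul2l _ h) _; first by rewrite lee_fin.
rewrite -EFinM lee_fin mulrA (_ : 2 * 160 = 320 :> R) //; last by ring.
apply: ler_piMl; last exact: pV.
by apply: mulr_ge0; [exact: ler0n|exact: mulr_ge0].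
Qed.

(** 33 = 1 + 2 * 16: the first term is |H f(0)|, the second the area integral; the factor 1/pi <= 1
    is dropped. *)
Lemma hankel_dirichlet1_le : (dirichlet1_norm (hankel nu a) <= (33 * (B * S))%:E)%E.
Proof.
have S0 : 0 <= S by have := aS 0; rewrite big_ord0.
have p0 : 1 <= pi :> R by have := pi_ge2 R; lra.
have pV : pi^-1 <= 1 :> R by rewrite invf_le1 //; lra.
have he := hankel_expands B0 hB aS.
rewrite /dirichlet1_norm (area_integral_derive he) (expands_at0 he).
have h : (\int[@lebesgue2 R]_(p in disc2)
      (normc (power_sum (deriv_coef (hankel_coef nu a)) (p.1 +i* p.2)))%:E <=
    (2 * (16 * (B * S)))%:E)%E.
  apply: (@hankel_integral_le _ _ (@lebesgue2 R) disc2 (@toC R) _ 16 2) => //.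
  - exact: measurable_disc2.
  - exact: cmeasurable_toC.
  - by move=> t; rewrite /= in_itv /= => /andP[t0 t1]; exact: kernel_area2.
  - apply/measurable_EFinP; apply: measurable_normc.
    apply: (cmeasurable_expands (abs_expansion_expands
      (abs_expansion_deriv (hankel_abs_expansion B0 hB aS)))) => //.
    by case: (cmeasurable_toC R) => m1 m2; split; exact: measurable_funTS.
  - by move=> p _; rewrite lee_fin normc_ge0.
  move=> p pD; exact: (hankel_kernel2 B0 hB aabs aS pD).
have h0 : ((normc (hankel_coef nu a 0))%:E <= (B * S)%:E)%E.
  by rewrite lee_fin; exact: (hankel_coef_le B0 hB aS 0).
have pi0 : (0 <= (pi^-1 : R)%:E)%E by rewrite lee_fin invr_ge0; lra.
apply: (le_trans (leeD h0 (lee_wpmul2l pi0 h))).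
rewrite -EFinM -EFinD lee_fin.
have BS : 0 <= B * S by rewrite mulr_ge0.
have : pi^-1 * (2 * (16 * (B * S))) <= 2 * (16 * (B * S)).
  apply: ler_piMl; last exact: pV.
by apply: mulr_ge0; [exact: ler0n|exact: mulr_ge0].
by lra.
Qed.

End hankel_norms.

(** * From the Carleson condition to boundedness *)

Section hankel_bounded_spaces.
Variables (R : realType) (nu : {finite_measure set (measurableTypeR R) -> \bar R}).
Local Notation I01 := (`[0%R, 1%R[%classic : set R).

(** All that sufficiency needs to know of the domain norm; necessity uses it for both norms. The
    case K = 0 already yields that the functional is nonnegative on functions with an expansion. *)
Definition hardy_ineq (N : (R[i] -> R[i]) -> \bar R) := exists2 c : R, 0 < c &
  forall f a K, expands f a -> ((\sum_(k < K) normc (a k) / k.+1%:R)%:E <= c%:E * N f)%E.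

Lemma hardy_ineq_hardy1 : hardy_ineq (@hardy1_norm R).
Proof. by exists 4 => // f a K; exact: hardy_H1. Qed.

Lemma hardy_ineq_dirichlet1 : hardy_ineq (@dirichlet1_norm R).
Proof.
by exists (32 * pi) => [|f a K]; [rewrite mulr_gt0 ?pi_gt0|exact: hardy_dirichlet].
Qed.

Lemma log_carleson_moment : log_carleson 1 1 nu -> exists2 B : R, 0 <= B &
  forall k, (\int[nu]_(t in I01) (t ^+ k * lweight t)%:E <= (B / k.+1%:R)%:E)%E.
Proof.
move=> /log_carleson_tail[C C0 hC]; have t0 := tail_ge0 nu 0.
exists (2 * C + tail nu 0) => [|k]; first by rewrite addr_ge0 ?mulr_ge0.
apply: le_trans (carleson_moment C0 hC k) _; rewrite lee_fin [leRHS]mulrDl lerD2l.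
case: k => [|k]; first by rewrite mul1r divr1.
by rewrite mul0r divr_ge0.
Qed.

Lemma log_carleson_bounded (NX NY : (R[i] -> R[i]) -> \bar R) (c : R) :
  hardy_ineq NX -> 0 <= c ->
  (forall B a S, 0 <= B ->
    (forall k, (\int[nu]_(t in I01) (t ^+ k * lweight t)%:E <= (B / k.+1%:R)%:E)%E) ->
    abs_expansion a -> (forall K, \sum_(k < K) normc (a k) / k.+1%:R <= S) ->
    (NY (hankel nu a) <= (c * (B * S))%:E)%E) ->
  log_carleson 1 1 nu -> hankel_bounded nu NX NY.
Proof.
move=> [d d0 hX] c0 hY /log_carleson_moment[B B0 hB].
exists (c * (B * d)) => f a [_ Nfin] fa.
have N0 : (0 <= NX f)%E.
  have := hX f a 0 fa; rewrite big_ord0 => h.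
  by rewrite -(@pmule_rge0 _ d%:E) ?lte_fin.
have NE : NX f = (fine (NX f))%:E by rewrite fineK // ge0_fin_numE.
have aS K : \sum_(k < K) normc (a k) / k.+1%:R <= d * fine (NX f).
  by rewrite -lee_fin EFinM -NE; exact: hX.
have aabs := expands_abs_expansion fa.
have h := hY _ _ _ B0 hB aabs aS.
split.
- exact: (hankel_is_defined B0 hB aS).
- split; first exact: (expands_analytic (hankel_expands B0 hB aS)).
  by apply: le_lt_trans h _; rewrite ltry.
by rewrite NE -EFinM -!mulrA; exact: h.
Qed.

Lemma log_carleson_hardy1 NX : hardy_ineq NX ->
  log_carleson 1 1 nu -> hankel_bounded nu NX (@hardy1_norm R).
Proof.
move=> hX; apply: (log_carleson_bounded (c := 320) hX (ler0n _ _)) => B a S B0 hB aabs aS.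
exact: hankel_hardy1_le.
Qed.

Lemma log_carleson_dirichlet1 NX : hardy_ineq NX ->
  log_carleson 1 1 nu -> hankel_bounded nu NX (@dirichlet1_norm R).
Proof.
move=> hX; apply: (log_carleson_bounded (c := 33) hX (ler0n _ _)) => B a S B0 hB aabs aS.
exact: hankel_dirichlet1_le.
Qed.

End hankel_bounded_spaces.

(** * Test functions and necessity *)

Section test_functions.
Variable R : realType.
Local Notation mu := (@lebesgue_measure R).
Local Notation circ := (`[0%R, (2 * pi)%R]%classic : set R).

Lemma sum_derive2_geometric (F : comNzRingType) (x : F) n :
  (1 - x) ^+ 3 * \sum_(0 <= k < n) (k.+1%:R * k.+2%:R * x ^+ k) =
  2 - n.+1%:R * n.+2%:R * x ^+ n + 2 * n%:R * n.+2%:R * x ^+ n.+1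
    - n%:R * n.+1%:R * x ^+ n.+2.
Proof.
elim: n => [|n IH]; first by rewrite big_nil expr0; ring.
rewrite big_nat_recr //= mulrDr IH !exprS; ring.
Qed.

(** The full series has numerator 2; the three remainder terms add at most 1/4 + 1/2 + 1/4, all
    controlled by (N+1)(N+2)|z|^N <= 1/4. *)
Lemma sum_derive2_geometric_near (z : R[i]) : unit_disc z ->
  \forall N \near \oo,
    normc (\sum_(0 <= k < N) (k.+1%:R * k.+2%:R * z ^+ k)) <= 3 * (normc (1 - z))^-1 ^+ 3.
Proof.
move=> zD; have z1 : normc z < 1 by [].
have h0 : (fun n => normc z ^+ n *+ n.+1 *+ n.+2) @ \oo --> (0 : R).
  have c0 : abs_expansion (fun=> 1 : R[i]).
    by move=> r r0 r1; apply: (terms_bounded_abs_summable r0 r1 (M := 1)) => k;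
      rewrite normc1 expr1n mulr1.
  have c2 := abs_expansion_deriv (abs_expansion_deriv c0).
  have := cvg_series_cvg_0 (c2 _ (normc_ge0 z) z1).
  rewrite (_ : (fun k => _) = fun n => normc z ^+ n *+ n.+1 *+ n.+2) //.
  apply/funext => n; rewrite /deriv_coef !normcMn normc1 mulrnAC.
  by rewrite -mulrnA mulrnAl mul1r -mulrnA.
have n0 := normc_1B_gt0 z1.
have nat n (w : R[i]) : normc (n%:R * w) = n%:R * normc w.
  by rewrite mulr_natl normcMn mulr_natl.
near=> N; rewrite exprVn ler_pdivlMr ?exprn_gt0 // -normcX -normcM mulrC.
rewrite sum_derive2_geometric.
have zN : N.+1%:R * N.+2%:R * normc z ^+ N <= 4^-1.
  have : `|0 - normc z ^+ N *+ N.+1 *+ N.+2| <= 4^-1.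
    by near: N; move/cvgrPdist_le: h0; apply; rewrite invr_gt0.
  rewrite sub0r normrN => /(le_trans (ler_norm _)).
  by rewrite -mulrnA -(mulr_natl (normc z ^+ N)) natrM.
set x1 := _ * z ^+ N in zN *; set x2 := _ * z ^+ N.+1; set x3 := _ * z ^+ N.+2.
have zp : 0 <= normc z ^+ N by rewrite exprn_ge0 ?normc_ge0.
have e1 : normc x1 <= 4^-1 by rewrite /x1 -mulrA !nat mulrA normcX.
have sm k : normc z ^+ (k + N) <= normc z ^+ N.
  by rewrite exprD ler_piMl // exprn_ile1 ?normc_ge0 // ltW.
have e2 : normc x2 <= 2^-1.
  rewrite /x2 -!mulrA !nat normcX.
  apply: le_trans (_ : 2 * (N.+1%:R * N.+2%:R * normc z ^+ N) <= _); last by lra.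
  rewrite ler_wpM2l // -mulrA; apply: ler_pM; rewrite ?mulr_ge0 ?exprn_ge0 ?normc_ge0 ?ler_nat //.
  by rewrite ler_wpM2l //; exact: (sm 1%N).
have e3 : normc x3 <= 4^-1.
  rewrite /x3 -!mulrA !nat normcX.
  have z2 : 0 <= normc z ^+ N.+2 by exact: exprn_ge0 (normc_ge0 z).
  apply: le_trans zN; rewrite -mulrA.
  apply: ler_pM; [exact: ler0n|exact: mulr_ge0 (ler0n _ _) z2|by rewrite ler_nat|].
  by apply: ler_pM; [exact: ler0n|exact: z2|by rewrite ler_nat|exact: (sm 2%N)].
have n2 : normc (2 : R[i]) = 2 by rewrite -(mulr1 2) nat normc1 mulr1.
apply: le_trans (le_normcD _ _) _; rewrite normcN.
have h1 := le_normcD (2 - x1) x2; have h2 := le_normcD 2 (- x1).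
move: h2; rewrite n2 normcN => h2; lra.
Unshelve. all: by end_near. Qed.

(** Taylor coefficients of (1 - b) / (1 - b z)^2. They are nonnegative, so the Hankel sums have no
    cancellation. *)
Definition test_coef (b : R) (k : nat) : R[i] := ((1 - b) * b ^+ k *+ k.+1)%:C.

Variables (b : R) (b0 : 0 <= b) (b1 : b < 1).

Let d0 : 0 < 1 - b. Proof. by rewrite subr_gt0. Qed.

Lemma test_abs_expansion : abs_expansion (test_coef b).
Proof.
have c0 : abs_expansion (fun k => (b ^+ k)%:C : R[i]).
  move=> r r0 r1; apply: (terms_bounded_abs_summable r0 r1 (M := 1)) => k.
  by rewrite normc_real ger0_norm ?exprn_ge0 // expr1n mulr1 exprn_ile1 // ltW.
move=> r r0 r1.
apply: (@bounded_nondecreasing_cvg _ _ ((1 - r) ^+ 2)^-1) => [n|n].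
  by rewrite mulr_ge0 ?normc_ge0 ?exprn_ge0.
apply: le_trans (sum_derive_geometric_le n r0 r1); apply: ler_sum => k _.
rewrite -[leRHS]mulr_natl ler_wpM2r ?exprn_ge0 // normc_real ger0_norm.
  rewrite -[leLHS]mulr_natl ler_piMr ?ler0n //.
  have bk : b ^+ k <= 1 by rewrite exprn_ile1 // ltW.
  have bk0 : 0 <= b ^+ k by rewrite exprn_ge0.
  by rewrite -[leRHS]mulr1; apply: ler_pM; [exact: ltW|exact: bk0|by rewrite gerBl|exact: bk].
by rewrite mulrn_wge0 // mulr_ge0 ?exprn_ge0 // ltW.
Qed.

Lemma test_expands : expands (power_sum (test_coef b)) (test_coef b).
Proof. exact: abs_expansion_expands test_abs_expansion. Qed.

Let bzD (z : R[i]) : unit_disc z -> unit_disc (b%:C * z).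
Proof.
exact: normcZ_lt1 (ltW b1).
Qed.

Lemma test_le (z : R[i]) : unit_disc z ->
  normc (power_sum (test_coef b) z) <= 2 * (1 - b) * (normc (1 - b%:C * z))^-1 ^+ 2.
Proof.
move=> zD; apply: (normc_lim_le (test_expands zD)); near=> N.
rewrite /power_series /series /=.
have -> : \sum_(0 <= k < N) test_coef b k * z ^+ k =
    (1 - b)%:C * \sum_(n < N) (b%:C * z) ^+ n *+ n.+1.
  rewrite big_mkord mulr_sumr; apply: eq_bigr => k _.
  by rewrite /test_coef rmorphMn rmorphM rmorphXn /= exprMn mulrnAr mulrnAl mulrA.
rewrite normcM normc_real (gtr0_norm d0) mulrAC [leRHS]mulrC ler_wpM2l ?(ltW d0) //.
near: N; have := sum_derive_geometric_near zD; apply: filterS => N; apply.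
by rewrite /= in_itv /= b0.
Unshelve. all: by end_near. Qed.

Lemma test_deriv_le (z : R[i]) : unit_disc z ->
  normc (power_sum (deriv_coef (test_coef b)) z) <=
    3 * (1 - b) * (normc (1 - b%:C * z))^-1 ^+ 3.
Proof.
move=> zD; have := abs_expansion_expands (abs_expansion_deriv test_abs_expansion) zD.
move=> h; apply: (normc_lim_le h); near=> N.
rewrite /power_series /series /=.
have -> : \sum_(0 <= k < N) deriv_coef (test_coef b) k * z ^+ k =
    ((1 - b) * b)%:C * \sum_(0 <= k < N) (k.+1%:R * k.+2%:R * (b%:C * z) ^+ k).
  rewrite mulr_sumr; apply: eq_bigr => k _.
  rewrite /deriv_coef /test_coef rmorphMn rmorphM rmorphXn /= exprMn rmorphM /= exprS.
  by rewrite -(mulr_natl _ k.+2) -(mulr_natl _ k.+1); ring.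
have d1 : 0 <= (1 - b) * b by rewrite mulr_ge0 // ltW.
rewrite normcM normc_real (ger0_norm d1).
apply: le_trans (_ : (1 - b) * b * (3 * (normc (1 - b%:C * z))^-1 ^+ 3) <= _).
  rewrite ler_wpM2l //; near: N; exact: (sum_derive2_geometric_near (bzD zD)).
rewrite mulrA; apply: ler_wpM2r; first by rewrite exprn_ge0 // invr_ge0 normc_ge0.
by rewrite mulrC ler_wpM2l // ler_piMr // ltW.
Unshelve. all: by end_near. Qed.

(** 400 = 2 * 200: the numerator 1 - b cancels the growth 1 / (1 - b r) of the circle mean of the
    squared kernel. *)
Lemma test_hardy1 : (hardy1_norm (power_sum (test_coef b)) <= 400%:E)%E.
Proof.
have p0 : 1 <= 2 * pi :> R by have := pi_ge2 R; lra.
have pV : (2 * pi)^-1 <= 1 :> R by rewrite invf_le1 //; lra.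
have pV0 : 0 <= (2 * pi)^-1 :> R by rewrite invr_ge0; lra.
apply: ge_ereal_sup => y [r /=]; rewrite in_itv /= => /andP[r0 r1] <-.
have nr : normc r%:C = r by rewrite normc_real ger0_norm // ltW.
have rD t : unit_disc (r%:C * cis t) by rewrite /unit_disc /mkset normcM nr normc_cis mulr1.
have br0 : 0 <= b * r by rewrite mulr_ge0 // ltW.
have brb : b * r <= b by rewrite ler_piMr // ltW.
have br1 : b * r < 1 by apply: le_lt_trans b1.
have mk := measurable_kernel_circ 2 br0 br1.
have h : (\int[mu]_(t in circ) (normc (power_sum (test_coef b) (r%:C * cis t)))%:E <= 400%:E)%E.
  apply: le_trans (_ : \int[mu]_(t in circ)
      ((2 * (1 - b))%:E * ((normc (1 - (b * r)%:C * cis t))^-1 ^+ 2)%:E) <= _)%E.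
    apply: ge0_le_integral; first exact: measurable_circ.
    - by move=> t _; rewrite lee_fin normc_ge0.
    - apply/measurable_EFinP; apply: measurable_normc.
      apply: (cmeasurable_expands test_expands) => [|t _]; last exact: rD.
      apply: cmeasurableM; first exact: cmeasurable_cst.
      by case: (cmeasurable_cis R) => m1 m2; split; exact: measurable_funTS.
    - by apply: emeasurable_funM; [exact: measurable_cst|exact/measurable_EFinP].
    move=> t _; rewrite -EFinM lee_fin; apply: le_trans (test_le (rD t)) _.
    by rewrite mulrA -rmorphM.
  have -> : (\int[mu]_(t in circ)
      ((2 * (1 - b))%:E * ((normc (1 - (b * r)%:C * cis t))^-1 ^+ 2)%:E) =
      (2 * (1 - b))%:E * \int[mu]_(t in circ) ((normc (1 - (b * r)%:C * cis t))^-1 ^+ 2)%:E)%E.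
    apply: ge0_integralZl; first exact: measurable_circ.
    - exact/measurable_EFinP.
    - by move=> t _; rewrite lee_fin exprn_ge0 // invr_ge0 normc_ge0.
    - by rewrite lee_fin mulr_ge0 // ltW.
  apply: le_trans (lee_wpmul2l _ (kernel_circle2 br0 br1)) _.
    by rewrite lee_fin mulr_ge0 // ltW.
  rewrite -EFinM lee_fin mulrA ler_pdivrMr ?subr_gt0 //; nra.
rewrite circle_meanE; apply: le_trans (lee_wpmul2l _ h) _; first by rewrite lee_fin.
rewrite -EFinM lee_fin; apply: ler_piMl; [exact: ler0n|exact: pV].
Qed.

(** The derivative contributes 3 * 16 = 48 and the value at 0 at most 1; 400 is kept as a bound
    common to both norms. The restriction b >= 1/2 is that of [kernel_area3]. *)
Lemma test_dirichlet1 : 2^-1 <= b -> (dirichlet1_norm (power_sum (test_coef b)) <= 400%:E)%E.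
Proof.
move=> b2; have p0 : 1 <= pi :> R by have := pi_ge2 R; lra.
have pV : pi^-1 <= 1 :> R by rewrite invf_le1 //; lra.
have he := test_expands.
rewrite /dirichlet1_norm (area_integral_derive he) (expands_at0 he).
have mk : measurable_fun disc2 (fun p => (normc (1 - b%:C * toC p))^-1 ^+ 3).
  apply: measurable_funS (measurable_kernel_toC 3 b0 b1); last exact: disc2_sub.
  by apply: measurableX; exact: measurable_itv.
have h : (\int[(mu \x mu)%E]_(p in disc2)
    (normc (power_sum (deriv_coef (test_coef b)) (p.1 +i* p.2)))%:E <= 48%:E)%E.
  apply: le_trans (_ : \int[(mu \x mu)%E]_(p in disc2)
      ((3 * (1 - b))%:E * ((normc (1 - b%:C * toC p))^-1 ^+ 3)%:E) <= _)%E.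
    apply: ge0_le_integral; first exact: measurable_disc2.
    - by move=> t _; rewrite lee_fin normc_ge0.
    - apply/measurable_EFinP; apply: measurable_normc.
      apply: (cmeasurable_expands (abs_expansion_expands
        (abs_expansion_deriv test_abs_expansion))) => //.
      by case: (cmeasurable_toC R) => m1 m2; split; exact: measurable_funTS.
    - by apply: emeasurable_funM; [exact: measurable_cst|exact/measurable_EFinP].
    by move=> p pD; rewrite -EFinM lee_fin; exact: (test_deriv_le pD).
  have -> : (\int[(mu \x mu)%E]_(p in disc2)
      ((3 * (1 - b))%:E * ((normc (1 - b%:C * toC p))^-1 ^+ 3)%:E) =
      (3 * (1 - b))%:E * \int[(mu \x mu)%E]_(p in disc2)
         ((normc (1 - b%:C * toC p))^-1 ^+ 3)%:E)%E.
    apply: ge0_integralZl; first exact: measurable_disc2.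
    - exact/measurable_EFinP.
    - by move=> t _; rewrite lee_fin exprn_ge0 // invr_ge0 normc_ge0.
    - by rewrite lee_fin mulr_ge0 // ltW.
  apply: le_trans (lee_wpmul2l _ (kernel_area3 b2 b1)) _.
    by rewrite lee_fin mulr_ge0 // ltW.
  by rewrite -EFinM lee_fin mulrA ler_pdivrMr //; lra.
have h0 : ((normc (test_coef b 0))%:E <= 1%:E)%E.
  rewrite lee_fin /test_coef mulr1n expr0 mulr1 normc_real (gtr0_norm d0); lra.
have pi0 : (0 <= (pi^-1 : R)%:E)%E by rewrite lee_fin invr_ge0; lra.
apply: (le_trans (leeD h0 (lee_wpmul2l pi0 h))).
rewrite -EFinM -EFinD lee_fin.
have : pi^-1 * 48 <= 48 :> R by rewrite ler_piMl.
by lra.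
Qed.

End test_functions.

(** * From boundedness to the Carleson condition *)

Section necessity.
Variables (R : realType) (nu : {finite_measure set (measurableTypeR R) -> \bar R}).
Local Notation I01 := (`[0%R, 1%R[%classic : set R).

Lemma ln_le_harmonic N : ln N.+1%:R <= \sum_(n < N) n.+1%:R^-1 :> R.
Proof.
elim: N => [|N IH]; first by rewrite big_ord0 ln1.
rewrite big_ord_recr /=; have h0 : 0 < N.+1%:R :> R by rewrite ltr0n.
have -> : N.+2%:R = N.+1%:R * (1 + N.+1%:R^-1) :> R.
  by rewrite mulrDr mulr1 mulfV ?gt_eqF // natr1.
have i0 : 0 < N.+1%:R^-1 :> R by rewrite invr_gt0.
rewrite lnM ?posrE // ?addr_gt0 //.
by apply: lerD => //; apply: le_ln1Dx; apply: lt_trans i0; exact: ltrN10.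
Qed.

Lemma bernoulli_expr (b : R) n : 0 <= b -> b <= 1 -> 1 - n%:R * (1 - b) <= b ^+ n.
Proof.
move=> b0 b1; elim: n => [|n IH]; first by rewrite mul0r subr0 expr0.
rewrite exprS -natr1; have n0 : 0 <= n%:R :> R by exact: ler0n.
apply: le_trans (ler_wpM2l b0 IH).
have : 0 <= n%:R * (1 - b) ^+ 2 by rewrite mulr_ge0 ?sqr_ge0.
by rewrite expr2; lra.
Qed.

Lemma moment_ge_tail (b : R) n : 0 <= b -> b < 1 -> b ^+ n * tail nu b <= moment nu n.
Proof.
move=> b0 b1; rewrite -lee_fin momentE EFinM tailE.
have mJ : measurable (`[b, 1%R[%classic : set (measurableTypeR R)) by exact: measurable_itv.
have <- : (\int[nu]_(t in `[b, 1%R[) cst (b ^+ n)%:E t = (b ^+ n)%:E * nu `[b, 1%R[%classic)%E.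
  by rewrite integral_cst.
have me (D : set R) : measurable_fun D (fun t : R => (t ^+ n)%:E).
  by apply/measurable_EFinP; apply: measurable_funTS; exact: exprn_measurable.
apply: le_trans (_ : \int[nu]_(t in `[b, 1%R[) (t ^+ n)%:E <= _)%E.
  apply: ge0_le_integral => //.
  - by move=> t _; rewrite lee_fin exprn_ge0.
  - exact: me.
  move=> t; rewrite /= in_itv /= => /andP[bt t1].
  by rewrite lee_fin lerXn2r // nnegrE (le_trans b0).
apply: ge0_subset_integral => //.
- exact: me.
- by move=> t; rewrite /= in_itv /= => /andP[t0 _]; rewrite lee_fin exprn_ge0.
by move=> t; rewrite /= !in_itv /= => /andP[bt ->]; rewrite (le_trans b0 bt).
Qed.

(** All terms being nonnegative, only those with k < K are kept, and their powers of b are lowered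
    to the common exponents n + K and K. *)
Lemma hankel_test_coef_ge (b : R) n K : 0 <= b -> b < 1 ->
  hankel_defined nu (test_coef b) ->
  tail nu b * b ^+ (n + K) * (1 - b) * b ^+ K * (\sum_(k < K) k.+1%:R) <=
    normc (hankel_coef nu (test_coef b) n).
Proof.
move=> b0 b1 [hc _ _]; have d0 : 0 < 1 - b by rewrite subr_gt0.
apply: le_trans (_ : Re (hankel_coef nu (test_coef b) n) <= _); last first.
  by apply: le_trans (ler_norm _) (ler_Re_normc _).
have T0 := tail_ge0 nu b.
apply: (Re_lim_ge (hc n)); exists K => // M /= KM.
have rowE k : Re (hankel_row nu (test_coef b) n k) =
    moment nu (n + k) * ((1 - b) * b ^+ k *+ k.+1).
  by rewrite /hankel_row ReZ /test_coef.
have row0 k : 0 <= Re (hankel_row nu (test_coef b) n k).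
  by rewrite rowE mulr_ge0 ?moment_ge0 // mulrn_wge0 // mulr_ge0 ?exprn_ge0 // ltW.
rewrite /series /= Re_sum (big_cat_nat (leq0n K) KM).
apply: le_trans (_ : \sum_(0 <= k < K) Re (hankel_row nu (test_coef b) n k) <= _); last first.
  by rewrite lerDl sumr_ge0.
rewrite big_mkord mulr_sumr; apply: ler_sum => k _; rewrite rowE.
have kK : (k <= K)%N by exact: ltnW.
have bm i j : (i <= j)%N -> b ^+ j <= b ^+ i.
  by move=> ij; apply: ler_wiXn2l => //; exact: ltW.
rewrite -(mulr_natr ((1 - b) * b ^+ k)) !mulrA ler_wpM2r ?ler0n //.
apply: ler_pM; rewrite ?mulr_ge0 ?exprn_ge0 ?(ltW d0) ?bm //.
rewrite ler_wpM2r ?(ltW d0) //; apply: le_trans (moment_ge_tail (n + k) b0 b1).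
by rewrite mulrC ler_wpM2r // bm // leq_add2l.
Qed.

Lemma hankel_bounded_log_carleson (NX NY : (R[i] -> R[i]) -> \bar R) (M : R) :
  hardy_ineq NX -> hardy_ineq NY ->
  (forall b, 2^-1 <= b -> b < 1 -> (NX (power_sum (test_coef b)) <= M%:E)%E) ->
  hankel_bounded nu NX NY -> log_carleson 1 1 nu.
Proof.
move=> [dX dX0 hX] [dY dY0 hY] hM [C hC].
(* The absolute value is there because the constant in [hankel_bounded] carries no sign
   condition. *)
pose L := dY * (`|C| * M).
have key b N : 2^-1 <= b -> b < 1 -> hankel_defined nu (test_coef b) /\
    \sum_(n < N) normc (hankel_coef nu (test_coef b) n) / n.+1%:R <= L.
  move=> b2 b1; have b0 : 0 <= b by apply: le_trans b2.
  have te := test_expands b0 b1.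
  have Mb := hM b b2 b1.
  have N0 : (0 <= NX (power_sum (test_coef b)))%E.
    have := hX _ _ 0 te; rewrite big_ord0 => h.
    by rewrite -(@pmule_rge0 _ dX%:E) ?lte_fin.
  have sX : in_space NX (power_sum (test_coef b)).
    split; first exact: (expands_analytic te).
    by apply: le_lt_trans Mb _; rewrite ltry.
  have [hd _ hN] := hC _ _ sX te; split => //.
  have he : expands (hankel nu (test_coef b)) (hankel_coef nu (test_coef b)).
    by case: hd => _ h _.
  rewrite -lee_fin; apply: le_trans (hY _ _ N he) _.
  rewrite /L EFinM; apply: lee_wpmul2l; first by rewrite lee_fin ltW.
  apply: le_trans hN _; rewrite EFinM.
  apply: le_trans (_ : `|C|%:E * NX (power_sum (test_coef b)) <= _)%E.
    by apply: lee_wpmul2r => //; rewrite lee_fin ler_norm.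
  by apply: lee_wpmul2l => //; rewrite lee_fin.
have L0 : 0 <= L.
  have lt21 : 2^-1 < 1 :> R by lra.
  by have [_] := key 2^-1 0 (lexx _) lt21; rewrite big_ord0.
have T0 := tail_ge0 nu 0.
have Tm t : 0 <= t -> tail nu t <= tail nu 0.
  move=> t0; rewrite -lee_fin !tailE; apply: le_measure; rewrite ?inE //.
  by move=> x /=; rewrite !in_itv /= => /andP[tx ->]; rewrite (le_trans t0 tx).
(* The first term serves t near 1, the second the range 1 - t > 1/16, and the final 1 makes the
   constant positive. *)
exists (32 * 32 * L + 16 * 15 * tail nu 0 + 1).
  apply: ltr_pwDr; first exact: ltr01.
  by apply: addr_ge0; apply: mulr_ge0 => //; apply: mulr_ge0; exact: ler0n.
move=> t /andP[t0 t1]; set d := 1 - t; have d0 : 0 < d by rewrite subr_gt0.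
have d1 : d <= 1 by rewrite /d; lra.
have i1 : 1 <= d^-1 by rewrite invr_ge1 ?unitfE ?gt_eqF.
have l0 : 0 <= ln d^-1 by rewrite ln_ge0.
have -> (x : R) : (32 * 32 * L + 16 * 15 * tail nu 0 + 1) * x =
  32 * (32 * (L * x)) + 16 * (15 * (tail nu 0 * x)) + x by ring.
rewrite !powRr1 ?(ltW d0) // -tailE -EFinM lee_fin.
have Tt := tail_ge0 nu t; have Tt0 := Tm t t0.
(* Away from 1 the logarithm is at most 15 and 16 d > 1, so monotonicity of [tail] is enough. *)
have [d16|d16] := lerP d 16^-1; last first.
  have l15 : ln d^-1 <= 15.
    have dV : d^-1 <= 16 by rewrite -[leRHS]invrK lef_pV2 ?posrE ?invr_gt0 // ltW.
    have h1 : -1 < d^-1 - 1 by lra.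
    have := le_ln1Dx h1; rewrite addrC subrK; lra.
  apply: le_trans (_ : tail nu 0 * 15 <= _); first exact: ler_pM.
  have h1 : tail nu 0 <= tail nu 0 * (16 * d) by rewrite ler_peMr //; lra.
  have h2 : 0 <= L * d by rewrite mulr_ge0 // ltW.
  by lra.
(* K is the integer part of 1/(4d). As d <= 1/16, this gives 1/8 <= K d <= 1/4: large enough for the
   logarithm, small enough that t^(2K) >= 1/2 by Bernoulli. *)
have x0 : 0 <= (4 * d)^-1 by rewrite invr_ge0 mulr_ge0 // ltW.
have /andP[] := truncn_itv x0; set K := Num.truncn _ => K1 K2.
have t2 : 2^-1 <= t by move: d16; rewrite /d; lra.
have [hd hs] := key t K t2 t1.
have xd : (4 * d)^-1 * d = 4^-1 by rewrite invfM -mulrA mulVf ?gt_eqF // mulr1.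
have Kd1 : K%:R * d <= 4^-1 by rewrite -xd ler_wpM2r // ltW.
have Kd2 : 4^-1 <= (K%:R + 1) * d by rewrite -xd ler_wpM2r ?(ltW d0) // natr1 ltW.
have K0 : 0 <= K%:R :> R by exact: ler0n.
have Kd : 8^-1 <= K%:R * d by lra.
have bK : 2^-1 <= t ^+ (K + K).
  apply: le_trans (bernoulli_expr (K + K) t0 (ltW t1)).
  by rewrite natrD -/d mulrDl; lra.
have bKK : 2^-1 <= t ^+ K.
  apply: le_trans bK _; apply: ler_wiXn2l => //; [exact: ltW|exact: leq_addr].
have sK : K%:R ^+ 2 / 2 <= \sum_(k < K) k.+1%:R :> R.
  elim: (K) => [|m IH]; first by rewrite big_ord0 expr0n mul0r.
  rewrite big_ord_recr /=; apply: le_trans (lerD IH (lexx _)).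
  by rewrite -natr1; have := ler0n R m; rewrite !expr2; lra.
(* The two powers give 1/2 each and the sum of k + 1 gives K^2/2, so the coefficient is at least
   tail * d K^2/8; with (K d)^2 >= 1/64 this is tail / (512 d). *)
have cn n : (n < K)%N -> tail nu t / (16 * 32 * d) <= normc (hankel_coef nu (test_coef t) n).
  move=> nK; apply: le_trans (hankel_test_coef_ge n K t0 t1 hd).
  have bn : 2^-1 <= t ^+ (n + K).
    apply: le_trans bK _; apply: ler_wiXn2l => //; first exact: ltW.
    by rewrite leq_add2r ltnW.
  rewrite -/d -!mulrA; apply: ler_wpM2l => //.
  rewrite invfM.
  apply: le_trans (_ : 2^-1 * (d * (2^-1 * (K%:R ^+ 2 / 2))) <= _).
    rewrite -(ler_pM2r d0) invfM mulrA -[leLHS]mulrA mulVf ?gt_eqF // mulr1.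
    have : 8^-1 * 8^-1 <= (K%:R * d) * (K%:R * d) by apply: ler_pM.
    by rewrite expr2; lra.
  have q0 : 0 <= K%:R ^+ 2 / 2 :> R by rewrite divr_ge0 ?sqr_ge0.
  apply: ler_pM => //; first by rewrite mulr_ge0 ?(ltW d0) // mulr_ge0.
  apply: ler_wpM2l; first exact: ltW.
  exact: ler_pM.
(* Since 1/d >= 16 = 4^2, passing from 1/d to 1/(4d) costs at most half of the logarithm. *)
have lnK : ln d^-1 / 2 <= ln K.+1%:R.
  have d4 : (4 * d)^-1 <= K.+1%:R by exact: ltW.
  apply: le_trans (_ : ln (4 * d)^-1 <= _); last first.
    by rewrite ler_ln ?posrE ?invr_gt0 ?mulr_gt0 // ltr0n.
  rewrite invfM lnM ?posrE ?invr_gt0 // !lnV ?posrE //.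
  have : ln (4 * 4) <= ln d^-1.
    rewrite ler_ln ?posrE ?invr_gt0 // ?mulr_gt0 //.
    by rewrite -[leLHS]invrK lef_pV2 ?posrE ?invr_gt0 ?mulr_gt0 //; lra.
  by rewrite lnM ?posrE // lnV ?posrE //; lra.
have fin : tail nu t / (16 * 32 * d) * (ln d^-1 / 2) <= L.
  apply: le_trans hs; apply: le_trans (_ : tail nu t / (16 * 32 * d) * ln K.+1%:R <= _).
    by rewrite ler_wpM2l // divr_ge0 // mulr_ge0 // ltW.
  apply: le_trans (_ : tail nu t / (16 * 32 * d) * (\sum_(n < K) n.+1%:R^-1) <= _).
    by rewrite ler_wpM2l ?ln_le_harmonic // divr_ge0 // mulr_ge0 // ltW.
  by rewrite mulr_sumr; apply: ler_sum => n _; rewrite ler_wpM2r ?invr_ge0 // cn.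
have E : tail nu t / (16 * 32 * d) * (ln d^-1 / 2) = (tail nu t * ln d^-1) / (32 * 32 * d).
  have dn : d != 0 by rewrite gt_eqF.
  by move: (ln d^-1) => l; field; exact: dn.
move: fin; rewrite E ler_pdivrMr ?mulr_gt0 // => fin.
have h2 : 0 <= tail nu 0 * d by rewrite mulr_ge0 // ltW.
by lra.
Qed.

End necessity.

Theorem theorem1 (R : realType)
    (mu : {finite_measure set (measurableTypeR R) -> \bar R})
    (mu01 : carried_by_01 mu) :
  [<-> log_carleson 1 1 mu;
       hankel_bounded mu (@hardy1_norm R) (@hardy1_norm R);
       hankel_bounded mu (@hardy1_norm R) (@dirichlet1_norm R);
       hankel_bounded mu (@dirichlet1_norm R) (@dirichlet1_norm R)].
Proof.
have hH := @hardy_ineq_hardy1 R; have hD := @hardy_ineq_dirichlet1 R.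
have necessity NX NY : hardy_ineq NX -> hardy_ineq NY ->
    (forall b : R, 2^-1 <= b -> b < 1 -> (NX (power_sum (test_coef b)) <= 400%:E)%E) ->
    hankel_bounded mu NX NY -> log_carleson 1 1 mu.
  exact: hankel_bounded_log_carleson.
have tH (b : R) : 2^-1 <= b -> b < 1 ->
    (hardy1_norm (power_sum (test_coef b)) <= 400%:E)%E.
  by move=> b2 b1; apply: test_hardy1 => //; apply: le_trans b2; rewrite invr_ge0.
have tD (b : R) : 2^-1 <= b -> b < 1 ->
    (dirichlet1_norm (power_sum (test_coef b)) <= 400%:E)%E.
  by move=> b2 b1; apply: test_dirichlet1 => //; apply: le_trans b2; rewrite invr_ge0.
(* The cycle passes through the Carleson condition each time: a boundedness statement first returns
   to it by [necessity], then yields the next one. *)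
tfae.
- exact: log_carleson_hardy1.
- by move=> /(necessity _ _ hH hH tH); exact: log_carleson_dirichlet1.
- by move=> /(necessity _ _ hH hD tH); exact: log_carleson_dirichlet1.
exact: necessity.
Qed.
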